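(* Let $G,H$ be locally compact second countable groups, let $G\curvearrowright(X,\mu)$ be a non-singular action such that the pair $(G,X)$ is amenable, and let $\omega:G\times X\to H$ be a proper cocycle. If $H$ has the Haagerup property (respectively is weakly amenable, respectively has the weak Haagerup property), then so does $G$. Moreover, \[\Lambda_{WA}(G)\leq\Lambda_{WA}(H)\quad\text{and}\quad \Lambda_{WH}(G)\leq\Lambda_{WH}(H).\]
   Context: **Actions and cocycles.** A non-singular action $G\curvearrowright(X,\mu)$ is a Borel action of a locally compact second countable (l.c.s.c.) group on a standard probability space preserving the class of null sets. A cocycle is a Borel map $\omega:G\times X\to H$ into an l.c.s.c. group $H$ such that for all $g,h\in G$, $\omega(gh,x)=\omega(g,hx)\omega(h,x)$ for almost every $x\in X$. **Proper cocycle.** A cocycle $\omega:G\times X\to H$ is proper with respect to a family $\mathcal{A}$ of Borel sets in $X$ if (1) for every compact $K\subset G$ and all $A,B\in\mathcal{A}$ there is a precompact set $L(K,A,B)\subset H$ such that for every $g\in K$, $\omega(g,x)\in L(K,A,B)$ for almost all $x\in A\cap g^{-1}B$; and (2) for every compact $L\subset H$ and all $A,B\in\mathcal{A}$, the set $K(L,A,B)$ of all $g\in G$ such that $\mu\{x\in X\mid x\in A,\ gx\in B,\ \omega(g,x)\in L\}>0$ is precompact in $G$. The cocycle $\omega$ is proper if it is proper with respect to some family $\mathcal{A}$ of Borel sets such that for every $\varepsilon>0$ there is $A\in\mathcal{A}$ with $\mu(X\setminus A)<\varepsilon$. **Amenable pair.** Let $\chi(g,x)=\frac{d(\mu\circ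 g)}{d\mu}(x)$ be the Radon–Nikodym cocycle and let $\pi:G\to\mathcal{U}(L^2(X,\mu))$, $(\pi(g)\xi)(x)=\xi(g^{-1}x)\sqrt{\chi(g^{-1},x)}$, be the Koopman representation. The pair $(G,X)$ is amenable if there is a sequence of unit vectors $\xi_n\in L^2(X,\mu)$ with $\|\xi_n-\pi(g)\xi_n\|\to0$ uniformly on compact subsets of $G$. **Herz–Schur multipliers.** A continuous function $\varphi:G\to\mathbb{C}$ is a Herz–Schur multiplier if there are bounded continuous maps $\xi,\eta:G\to\mathcal{H}$ into a Hilbert space with $\varphi(g^{-1}h)=\langle\xi_g,\eta_h\rangle$ for all $g,h\in G$. Its norm $\|\varphi\|_{HS}$ is the infimum of $\|\xi\|_\infty\|\eta\|_\infty$ over all such pairs, where $\|\xi\|_\infty=\sup_{g}\|\xi_g\|$. **Approximation properties** of an l.c.s.c. group $G$: - Haagerup property: there is a sequence $(\varphi_n)$ of continuous positive type functions $\varphi_n\in C_0(G)$ converging to $1$ uniformly on compact subsets of $G$. - Weakly amenable: there are $C\geq1$ and a sequence $(\varphi_n)$ of continuous compactly supported Herz–Schur multipliers converging to $1$ uniformly on compact sets, with $\|\varphi_n\|_{HS}\leq C$ for all $n$. The infimum of all such $C$ is $\Lambda_{WA}(G)$. - Weak Haagerup property: there are $C\geq1$ and a sequence $(\varphi_n)$ of continuous Herz–Schur multipliers $\varphi_n\in C_0(G)$ converging to $1$ uniformly on compact sets, with $\|\varphi_n\|_{HS}\leq C$ for all $n$. The infimum of all such $C$ is $\Lambda_{WH}(G)$.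 (The infimum of the empty set is $\infty$.) *)

(* Defs.v *)
From HB Require Import structures.
From mathcomp Require Import all_boot all_order all_algebra.
From mathcomp Require Import complex.
From mathcomp Require Import all_classical all_reals all_analysis.

Set Implicit Arguments.
Unset Strict Implicit.
Unset Printing Implicit Defensive.

Import Order.TTheory GRing.Theory Num.Theory.
Import numFieldNormedType.Exports.

Local Open Scope classical_set_scope.
Local Open Scope ring_scope.

(* numFieldNormedType.Exports only reaches abstract fields: the concrete type
   R[i] gets its norm and topology here. *)
HB.instance Definition _ (R : rcfType) := NormedModule.copy R[i] R[i]^o.

Notation normc := ComplexField.Normc.normc.

HB.structure Definition PreTopologicalGroup := {G of Group G & Topological G}.

HB.mixin Record PreTopologicalGroup_isTopologicalGroup G
    & PreTopologicalGroup G := {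
  mulg_continuous : continuous (fun x : G * G => (x.1 * x.2)%g) ;
  invg_continuous : continuous (fun x : G => (x^-1)%g) ;
}.

#[short(type="topologicalGroupType")]
HB.structure Definition TopologicalGroup :=
  {G of PreTopologicalGroup G & PreTopologicalGroup_isTopologicalGroup G}.

Definition lcsc (G : topologicalGroupType) :=
  [/\ hausdorff_space G, locally_compact [set: G] & @second_countable G].

(* G with its Borel sigma-algebra; measurable types are pointed, whence the
   alias. *)
Definition borel (G : topologicalGroupType) : Type := G.

Section borel.
Variable G : topologicalGroupType.

HB.instance Definition _ := Choice.on (borel G).
HB.instance Definition _ := isPointed.Build (borel G) (1%g : G).
HB.instance Definition _ :=
  @isMeasurable.Build (sigma_display (@open G)) (borel G) <<s @open G >>
    (@sigma_algebra0 _ setT (@open G)) (@sigma_algebraC (borel G) (@open G))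
    (@sigma_algebra_bigcup _ setT (@open G)).

End borel.

(* X is Borel isomorphic to a Polish space. *)
Definition standard_borel (R : realType) d (X : measurableType d) : Prop :=
  exists (P : completePseudoMetricType R) (f : X -> P),
    [/\ hausdorff_space P, @second_countable P, bijective f &
        forall A : set X,
          measurable A <-> exists2 B, <<s @open P >> B & A = f @^-1` B].

Section actions.
Context (R : realType) (G : topologicalGroupType) (d : measure_display)
        (X : measurableType d) (mu : probability X R).

Record nonsingular_action := NonsingularAction {
  act :> G -> X -> X ;
  act1 : forall x, act 1%g x = x ;
  actM : forall g h x, act (g * h)%g x = act g (act h x) ;
  measurable_act :
    measurable_fun [set: borel G * X] (fun gx => act gx.1 gx.2) ;
  act_null : forall g (A : set X), measurable A ->
    mu (act g @^-1` A) = 0%E <-> mu A = 0%E }.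

Lemma measurable_act1 (a : nonsingular_action) g : measurable_fun setT (act a g).
Proof.
have mg : measurable_fun [set: X] (fun x => (g, x) : borel G * X).
  exact: pair1_measurable.
exact: (measurableT_comp (measurable_act a) mg).
Qed.

HB.instance Definition _ (a : nonsingular_action) g :=
  isMeasurableFun.Build _ _ X X (act a g) (measurable_act1 a g).

(* mu \o g, i.e. A |-> mu (g A): g A is the preimage of A under g^-1. *)
Definition translate (a : nonsingular_action) (g : G) :
  probability X R := distribution mu (act a g^-1%g).


Definition radon_nikodym_cocycle (a : nonsingular_action) (g : G) (x : X) : R :=
  fine (Radon_Nikodym (charge_of_finite_measure (translate a g)) mu x).

(* Elements of L^2(X, mu) are represented by Borel functions X -> C; the norm
   and the Koopman operators only depend on their classes modulo null sets. *)
Definition L2norm (xi : X -> R[i]) : \bar R :=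
  Lnorm mu 2%:E (fun x => (normc (xi x))%:E).

Definition L2 (xi : X -> R[i]) : Prop :=
  (forall U : set R[i], open U -> measurable (xi @^-1` U)) /\
  (L2norm xi < +oo)%E.

Definition koopman (a : nonsingular_action) (g : G) (xi : X -> R[i]) :
    X -> R[i] :=
  fun x => xi (a g^-1%g x) *
           (Num.sqrt (radon_nikodym_cocycle a g^-1%g x))%:C%C.

Definition amenable_pair (a : nonsingular_action) : Prop :=
  exists2 xi : nat -> X -> R[i],
    forall n, L2 (xi n) /\ L2norm (xi n) = 1%E &
    {family compact,
      (fun n g => L2norm (fun x => xi n x - koopman a g (xi n) x)) @ \oo
        --> (fun _ : G => 0%E : \bar R)}.

Context (H : topologicalGroupType).

Definition cocycle (a : nonsingular_action) (omega : G -> X -> H) : Prop :=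
  measurable_fun [set: borel G * X] (fun gx => omega gx.1 gx.2 : borel H) /\
  forall g h, {ae mu, forall x,
    omega (g * h)%g x = (omega g (a h x) * omega h x)%g}.

Definition proper_wrt (a : nonsingular_action) (omega : G -> X -> H)
    (F : set (set X)) : Prop :=
  (forall K, compact K -> forall A B, F A -> F B ->
     exists2 L : set H, precompact L &
       forall g, K g -> {ae mu, forall x, A x -> B (a g x) -> L (omega g x)}) /\
  (forall L, compact L -> forall A B, F A -> F B ->
     precompact
       [set g | (0 < mu [set x | [/\ A x, B (a g x) & L (omega g x)]])%E]).

Definition proper_cocycle (a : nonsingular_action) (omega : G -> X -> H) :
    Prop :=
  exists F : set (set X),
    [/\ F `<=` measurable, proper_wrt a omega F &
        forall e : R, 0 < e -> exists2 A, F A & (mu (~` A) < e%:E)%E].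

End actions.

(* A complex Hilbert space: a complete normed space whose norm comes from an
   inner product (linear in the first variable). *)
Record hilbertType (R : realType) := HilbertType {
  hilbert_sort :> completeNormedModType R[i] ;
  inner : {dot hilbert_sort for Num.conj} ;
  inner_norm : forall x : hilbert_sort, inner x x = `|x| ^+ 2 }.

Section multipliers.
Context (R : realType) (G : topologicalGroupType).
Implicit Types phi : G -> R[i].

(* The norm of V is valued in R[i]; its values are real. *)
Definition sup_norm (V : hilbertType R) (xi : G -> V) : \bar R :=
  ereal_sup [set (complex.Re `|xi g|)%:E | g in [set: G]].

Definition hs_pair phi (V : hilbertType R) (xi eta : G -> V) : Prop :=
  [/\ continuous xi, continuous eta,
      (sup_norm xi < +oo)%E, (sup_norm eta < +oo)%E &
      forall g h, phi (g^-1 * h)%g = inner V (xi g) (eta h)].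

Definition herz_schur phi : Prop :=
  continuous phi /\ exists (V : hilbertType R) (xi eta : G -> V),
    hs_pair phi xi eta.

Definition hs_norm phi : \bar R :=
  ereal_inf [set r | exists (V : hilbertType R) (xi eta : G -> V),
    hs_pair phi xi eta /\ r = (sup_norm xi * sup_norm eta)%E].

Definition positive_type phi : Prop :=
  forall (n : nat) (g : 'I_n -> G) (c : 'I_n -> R[i]),
    0 <= \sum_i \sum_j Num.conj (c i) * c j * phi ((g i)^-1 * g j)%g.

Definition vanishes_at_infinity phi : Prop :=
  forall e : R, 0 < e ->
    exists2 K : set G, compact K & forall g, ~ K g -> normc (phi g) < e.

Definition compactly_supported phi : Prop :=
  compact (closure [set g | phi g != 0]).

Definition cvg_to_1 (phi : nat -> G -> R[i]) : Prop :=
  {family compact, phi @ \oo --> (fun _ : G => 1 : R[i])}.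

End multipliers.

Section approximation_properties.
Context (R : realType) (G : topologicalGroupType).

Definition haagerup : Prop :=
  exists2 phi : nat -> G -> R[i],
    forall n, [/\ continuous (phi n), positive_type (phi n) &
                  vanishes_at_infinity (phi n)] &
    cvg_to_1 phi.

Definition wa_constants : set R :=
  [set C | 1 <= C /\ exists2 phi : nat -> G -> R[i],
    forall n, [/\ herz_schur (phi n), compactly_supported (phi n) &
                  (hs_norm (phi n) <= C%:E)%E] &
    cvg_to_1 phi].

Definition weakly_amenable : Prop := wa_constants !=set0.

Definition Lambda_WA : \bar R := ereal_inf [set C%:E | C in wa_constants].

Definition wh_constants : set R :=
  [set C | 1 <= C /\ exists2 phi : nat -> G -> R[i],
    forall n, [/\ herz_schur (phi n), vanishes_at_infinity (phi n) &
                  (hs_norm (phi n) <= C%:E)%E] &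
    cvg_to_1 phi].

Definition weak_haagerup : Prop := wh_constants !=set0.

Definition Lambda_WH : \bar R := ereal_inf [set C%:E | C in wh_constants].

End approximation_properties.

(* Main.v *)
From HB Require Import structures.
Require Import Defs.
From mathcomp Require Import all_boot all_order all_algebra.
From mathcomp Require Import complex.
From mathcomp Require Import all_classical all_reals all_analysis.
From mathcomp Require Import measurable_realfun.
From mathcomp Require Import ring lra.

Set Implicit Arguments.
Unset Strict Implicit.
Unset Printing Implicit Defensive.

Import Order.TTheory GRing.Theory Num.Theory.
Import numFieldNormedType.Exports.

Local Open Scope classical_set_scope.
Local Open Scope ring_scope.

(** A multiplier on [H] is pulled back to [G] by averaging along the cocycle.
    Let [f] be a nonnegative vector of norm at most 1 in L^2(X, mu) that vanishes
    off a member A of the family for which omega is proper, let [koop g f] be its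
    Koopman translate, and for phi on [H] put
      psi(k) = int (koop k^-1 f)(x) f(x) phi(omega(k, x)) dmu(x),
    which is [induced a omega f phi].  The change of variables by h^-1, the
    cocycle identity and the chain rule for the Radon-Nikodym derivative give
      psi(g^-1 h) = int (koop g f)(y) (koop h f)(y) phi(s_g(y)^-1 s_h(y)) dmu(y)
    with s_g(y) = omega(g^-1, y)^-1 ([induced_kernelE]).  Hence psi is of positive
    type when phi is ([induced_positive]), and if phi(s^-1 t) = <xi_s, eta_t>
    then psi(g^-1 h) = <Xi_g, Eta_h> for the vector-valued functions
    Xi_g(y) = (koop g f)(y) xi_(s_g(y)), whose L^2 norm is at most the supremum
    of the norms of xi; so psi is a Herz-Schur multiplier of no larger norm
    ([induced_herz_schur]).  The space L^2(X, mu; V) itself is avoided: the scalar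
    Gram kernel of Xi and Eta is positive semidefinite, and Kolmogorov's
    construction of a Hilbert space from such a kernel ([kolmogorov], through the
    completion of the reproducing kernel space) returns vectors with these inner
    products ([multiplier_vectors]).

    Properness controls psi.  On the support of its integrand both x and kx lie
    in A.  By the second half of properness, for k outside a compact set
    omega(k, x) almost surely avoids a given compact subset L of [H], so that
    psi(k) is as small as phi is off L ([induced_support]): vanishing at infinity
    and compact support pass from phi to psi.  By the first half, for k in a
    compact set omega(k, x) stays in a compact set, on which a late member of a
    sequence tending to 1 is close to 1; then psi(k) is close to the coefficient
    int (koop k^-1 f) f dmu, and this is close to 1 when f = |xi| 1_A for an
    almost invariant unit vector xi and a large A ([overlap_truncated],
    [approximate_unit]).

    What remains is the continuity of psi and of Xi, Eta, although the action
    and the cocycle are only Borel.  Both follow from Pettis' theorem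
    ([pettis]): in a cover of [G] by countably many Borel sets, some member E is
    such that E^-1 E is a neighbourhood of 1.  Since X is standard, countably
    many step functions approximate every integrable function and every
    partition into countably many measurable pieces.  Covering [G] by the sets
    of k for which the translate of a density, respectively omega(k, _), is close
    to one of these countably many models shows that the action is strongly
    continuous on L^1 ([nu_continuous]) and that omega(g, _) tends to 1 in
    measure as g tends to 1 ([cocycle_continuous]).  Together they give the
    continuity of integrals along orbits ([L2_continuous],
    [weight_continuous]). *)

(** * Combinations of points over a positive semidefinite kernel *)

Section complex_facts.
Context {R : realType}.
Local Notation C := R[i].

Lemma normCE (z : C) : `|z| = (normc z)%:C%C.
Proof. by []. Qed.

(** The quadratic form of a two-dimensional Gram matrix: at its minimum a = - z
    / B the hypothesis says A - |z|^2 / B >= 0. *)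
Lemma cauchy_schwarz_of_quadratic (A B z : C) : 0 <= A -> 0 <= B ->
  (forall a : C, 0 <= A + a * z^* + a^* * z + a * a^* * B) ->
  `|z| ^+ 2 <= A * B.
Proof.
move=> A0 B0 q; have [B_eq|Bn0] := eqVneq B 0.
  rewrite B_eq mulr0 in q *; have [->|zn0] := eqVneq z 0.
    by rewrite normr0 expr0n.
  have z2 : z * z^* != 0 by rewrite mulf_neq0 // conjC_eq0.
  have zz : (z * z^*)^* = z * z^*. by rewrite rmorphM /= conjCK mulrC.
  have A1 : (A + 1)^* = A + 1 by apply/CrealP/ger0_real; rewrite addr_ge0.
  (* With B = 0 the quadratic is affine along a = t z; this t makes it
     negative. *)
  pose t := - (A + 1) / (z * z^*).
  have tE : t^* = t by rewrite /t rmorphM rmorphN fmorphV /= A1 zz.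
  have tz : t * (z * z^*) = - (A + 1) by rewrite /t mulfVK.
  have := q (t * z); rewrite rmorphM /= tE.
  have -> : A + t * z * z^* + t * z^* * z + t * z * (t * z^*) * 0
    = A + (t * (z * z^*)) *+ 2 by ring.
  rewrite tz => h; have : 0 < A + 2 by rewrite ltr_wpDl.
  have -> : A + 2 = - (A + - (A + 1) *+ 2) by ring.
  by rewrite oppr_gt0 => /(le_lt_trans h); rewrite ltxx.
have Bgt0 : 0 < B by rewrite lt_def Bn0.
have BE : B^* = B by apply/CrealP/ger0_real.
have := q (- z / B); rewrite rmorphM rmorphN fmorphV /= BE.
have -> : A + - z / B * z^* + - z^* / B * z + - z / B * (- z^* / B) * B
   = A - z * z^* / B by field.
by rewrite subr_ge0 ler_pdivrMr // normCK.
Qed.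

Lemma add_conj_le (z : C) : z + z^* <= `|z| + `|z|.
Proof.
case: z => x y; rewrite normCE -[_%:C%C + _]rmorphD /= lecE /=.
rewrite subrr eqxx /=.
have : `|x| <= Num.sqrt (x ^+ 2 + y ^+ 2).
  by rewrite -sqrtr_sqr ler_wsqrtr// lerDl sqr_ge0.
by have := ler_norm x; lra.
Qed.

(** Completeness of [R[i]], from that of [R] applied to both coordinates. *)
Lemma cvgC_of_cauchy (z : nat -> C) :
  (forall e : C, 0 < e -> exists N, forall m n, (N <= m)%N -> (N <= n)%N ->
    `|z m - z n| < e) ->
  exists l : C, z @ \oo --> l.
Proof.
move=> zc.
have part (f : C -> R) : (forall x y, f (x - y) = f x - f y) ->
    (forall x, `|f x| <= normc x) -> cvgn (f \o z).
  move=> fB fle; apply/cauchy_cvgP/cauchy_ballP => e e0.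
  have [N Nz] := zc e%:C%C (ltac:(by rewrite ltcR)).
  exists (f @` (z @` [set n | (N <= n)%N]), f @` (z @` [set n | (N <= n)%N])) => /=.
    by split; exists N => // n /= Nn; exists (z n) => //; exists n.
  move=> [_ _] /= [[_ [m Nm <-] <-] [_ [n Nn <-] <-]].
  rewrite /ball /= -fB (le_lt_trans (fle _))//.
  by have := Nz m n Nm Nn; rewrite normCE ltcR.
have /cvg_ex[a za] : cvgn (@complex.Re R \o z).
  apply: part => [[? ?] [? ?]//|[x y] /=].
  by rewrite -sqrtr_sqr ler_wsqrtr// lerDl sqr_ge0.
have /cvg_ex[b zb] : cvgn (@complex.Im R \o z).
  apply: part => [[? ?] [? ?]//|[x y] /=].
  by rewrite -sqrtr_sqr ler_wsqrtr// lerDr sqr_ge0.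
exists (a +i* b)%C; apply/cvgrPdist_le => /= e e0.
have eE : e = (complex.Re e)%:C%C by rewrite RRe_real// ger0_real// ltW.
have d0 : 0 < complex.Re e / 2 by move: e0; rewrite eE ltcR; lra.
move/cvgrPdist_le : za => /(_ _ d0) za; move/cvgrPdist_le : zb => /(_ _ d0) zb.
near=> n.
have h1 : `|a - complex.Re (z n)| <= complex.Re e / 2 by near: n.
have h2 : `|b - complex.Im (z n)| <= complex.Re e / 2 by near: n.
rewrite eE normCE lecR; case: (z n) h1 h2 => x y /= h1 h2.
have -> : complex.Re e = Num.sqrt ((complex.Re e) ^+ 2).
  by rewrite sqrtr_sqr ger0_norm//; lra.
rewrite ler_wsqrtr//; move: h1 h2; rewrite !ler_norml => /andP[? ?] /andP[? ?].
nra.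
Unshelve. all: by end_near. Qed.

Lemma cvg_conj (z : nat -> C) l : z @ \oo --> l -> (fun n => (z n)^*) @ \oo --> l^*.
Proof.
move/cvgrPdist_le => zl; apply/cvgrPdist_le => e /zl; apply: filterS => n.
by rewrite -rmorphB norm_conjC.
Qed.

Lemma cvgn_ge0C (z : nat -> C) l : z @ \oo --> l -> (forall n, 0 <= z n) -> 0 <= l.
Proof.
move=> zl z0.
have nz : (fun n => `|z n|) @ \oo --> `|l| by exact: cvg_norm.
suff -> : l = `|l| by exact: normr_ge0.
apply: (@cvg_unique C (@norm_hausdorff _ C) (z @ \oo) _ l `|l| zl).
by have -> : z = (fun n => `|z n|) by apply/funext => n; rewrite ger0_norm.
Qed.

End complex_facts.

Record psd_kernel (R : realType) (S : Type) := PsdKernel {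
  ker :> S -> S -> R[i] ;
  ker_conj : forall s t, ker t s = (ker s t)^* ;
  ker_psd : forall (n : nat) (s : 'I_n -> S) (c : 'I_n -> R[i]),
    0 <= \sum_i \sum_j c i * (c j)^* * ker (s i) (s j) }.

Section kolmogorov.
Context {R : realType} {S : Type} (k : psd_kernel R S).
Local Notation C := R[i].
Local Notation comb := (seq (C * S)).
Implicit Types l m : comb.

(** A list of pairs (c, s) stands for the formal combination of points with
    coefficients c; [comb_ip] is the semi-inner product in which the points s
    and t have inner product k s t. *)
Definition comb_ip l m : C := \sum_(x <- l) \sum_(y <- m) x.1 * (y.1)^* * k x.2 y.2.
Definition comb_scale (a : C) l : comb := [seq (a * x.1, x.2) | x <- l].
Definition comb_diff l m : comb := l ++ comb_scale (-1) m.
Definition comb_norm l : C := sqrtC (comb_ip l l).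
(** The function it represents: the inner products with the points. *)
Definition comb_ev l (t : S) : C := \sum_(x <- l) x.1 * k x.2 t.

Lemma comb_ipDl l l' m : comb_ip (l ++ l') m = comb_ip l m + comb_ip l' m.
Proof. by rewrite /comb_ip big_cat. Qed.

Lemma comb_ipZl a l m : comb_ip (comb_scale a l) m = a * comb_ip l m.
Proof.
rewrite /comb_ip big_map mulr_sumr; apply: eq_bigr => x _ /=.
by rewrite mulr_sumr; apply: eq_bigr => y _; rewrite !mulrA.
Qed.

Lemma comb_ipC l m : comb_ip m l = (comb_ip l m)^*.
Proof.
rewrite /comb_ip exchange_big rmorph_sum; apply: eq_bigr => x _ /=.
rewrite rmorph_sum; apply: eq_bigr => y _.
by rewrite /= !rmorphM /= conjCK -ker_conj (mulrC x.1^*).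
Qed.

Lemma comb_ipDr l m m' : comb_ip l (m ++ m') = comb_ip l m + comb_ip l m'.
Proof. by rewrite comb_ipC comb_ipDl rmorphD /= -!comb_ipC. Qed.

Lemma comb_ipZr a l m : comb_ip l (comb_scale a m) = a^* * comb_ip l m.
Proof. by rewrite comb_ipC comb_ipZl rmorphM /= -comb_ipC. Qed.

Lemma comb_ipBl l l' m : comb_ip (comb_diff l l') m = comb_ip l m - comb_ip l' m.
Proof. by rewrite comb_ipDl comb_ipZl mulN1r. Qed.

Lemma comb_ipBr l m m' : comb_ip l (comb_diff m m') = comb_ip l m - comb_ip l m'.
Proof. by rewrite comb_ipDr comb_ipZr rmorphN rmorph1 mulN1r. Qed.

Lemma comb_ip_ge0 l : 0 <= comb_ip l l.
Proof.
have := ker_psd k (fun i => (tnth (in_tuple l) i).2) (fun i => (tnth (in_tuple l) i).1).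
congr (_ <= _); rewrite /comb_ip [RHS]big_tnth; apply: eq_bigr => i _.
by rewrite [RHS]big_tnth.
Qed.

Lemma comb_norm_ge0 l : 0 <= comb_norm l. Proof. by rewrite sqrtC_ge0 comb_ip_ge0. Qed.

Lemma comb_norm2 l : comb_norm l ^+ 2 = comb_ip l l. Proof. exact: sqrtCK. Qed.

Lemma comb_ip_cs l m : `|comb_ip l m| <= comb_norm l * comb_norm m.
Proof.
rewrite -(@ler_pXn2r _ 2) ?nnegrE ?mulr_ge0 ?comb_norm_ge0// exprMn !comb_norm2.
apply: cauchy_schwarz_of_quadratic; rewrite ?comb_ip_ge0// => a.
have := comb_ip_ge0 (l ++ comb_scale a m); congr (_ <= _).
rewrite comb_ipDl !comb_ipDr !comb_ipZl !comb_ipZr (comb_ipC l m); ring.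
Qed.

(** The triangle inequality is stated with a difference because lists have no
    cancellation: [l] and [(l - m) + m] are different lists. *)
Lemma comb_norm_tri l m : comb_norm l <= comb_norm (comb_diff l m) + comb_norm m.
Proof.
rewrite -(@ler_pXn2r _ 2) ?nnegrE ?addr_ge0 ?comb_norm_ge0// sqrrD !comb_norm2.
have -> : comb_ip l l = comb_ip (comb_diff l m) (comb_diff l m) + (comb_ip (comb_diff l m) m + (comb_ip (comb_diff l m) m)^*)
  + comb_ip m m.
  by rewrite -comb_ipC !comb_ipBl !comb_ipBr; ring.
rewrite lerD2r lerD2l mulr2n.
by apply: (le_trans (add_conj_le _)); rewrite lerD// comb_ip_cs.
Qed.

Lemma comb_norm_eq l m : comb_ip l l = comb_ip m m -> comb_norm l = comb_norm m.
Proof. by rewrite /comb_norm => ->. Qed.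

Lemma comb_ipE l m : comb_ip l m = \sum_(y <- m) (y.1)^* * comb_ev l y.2.
Proof.
rewrite /comb_ip exchange_big; apply: eq_bigr => y _ /=; rewrite /comb_ev mulr_sumr.
by apply: eq_bigr => x _; ring.
Qed.

Lemma comb_evE l t : comb_ev l t = comb_ip l [:: (1, t)].
Proof. by rewrite comb_ipE big_seq1 rmorph1 mul1r. Qed.

Definition fundamental (u : nat -> comb) : Prop := forall e : C, 0 < e ->
  exists N, forall m n : nat, (N <= m)%N -> (N <= n)%N -> comb_norm (comb_diff (u m) (u n)) < e.

Lemma fundamental_bounded u : fundamental u ->
  exists2 M : C, 0 < M & \forall n \near \oo, comb_norm (u n) <= M.
Proof.
move=> /(_ 1 ltr01)[N uN]; exists (1 + comb_norm (u N)); first by rewrite ltr_wpDr ?comb_norm_ge0.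
exists N => // n /= Nn; apply: le_trans (comb_norm_tri _ (u N)) _.
by rewrite lerD2r ltW// uN.
Qed.

(** The completion is taken to consist of the functions on [S] that fundamental
    sequences represent, rather than of classes of sequences, so that an
    element is determined by its values. *)
Definition represents u (F : S -> C) : Prop :=
  fundamental u /\ forall t, (fun n => comb_ev (u n) t) @ \oo --> F t.

Lemma fundamental_cat u v : fundamental u -> fundamental v ->
  fundamental (fun n => u n ++ v n).
Proof.
move=> hu hv e e0; have e2 : 0 < e / 2 by rewrite divr_gt0.
have [N uN] := hu _ e2; have [M vM] := hv _ e2; exists (maxn N M) => m n.
rewrite !geq_max => /andP[Nm Mm] /andP[Nn Mn]; rewrite (splitr e).
apply: le_lt_trans (ltrD (uN _ _ Nm Nn) (vM _ _ Mm Mn)).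
have := comb_norm_tri (comb_diff (u m ++ v m) (u n ++ v n)) (comb_diff (v m) (v n)).
congr (_ <= _ + _); apply: comb_norm_eq.
by rewrite !comb_ipBl !comb_ipBr !comb_ipDl !comb_ipDr; ring.
Qed.

Lemma comb_norm_scale a l : comb_norm (comb_scale a l) = `|a| * comb_norm l.
Proof.
rewrite /comb_norm comb_ipZl comb_ipZr mulrA -normCK rootCMl ?exprn_ge0//.
by rewrite -[sqrtC (_ ^+ 2)]/(sqrtC _) sqrCK.
Qed.

Lemma fundamental_scale a u : fundamental u -> fundamental (fun n => comb_scale a (u n)).
Proof.
move=> hu e e0; have a1 : 0 < `|a| + 1 by rewrite ltr_wpDl.
have [N uN] := hu _ (divr_gt0 e0 a1); exists N => m n Nm Nn.
have -> : comb_norm (comb_diff (comb_scale a (u m)) (comb_scale a (u n))) = comb_norm (comb_scale a (comb_diff (u m) (u n))).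
  by apply: comb_norm_eq; rewrite !comb_ipBl !comb_ipBr !comb_ipZl !comb_ipZr !comb_ipBl !comb_ipBr; ring.
have := uN _ _ Nm Nn; rewrite comb_norm_scale ltr_pdivlMr// mulrC; apply: le_lt_trans.
by rewrite ler_wpM2r ?comb_norm_ge0// lerDl.
Qed.

(** |<u_m, v_m> - <u_n, v_n>| <= |u_m - u_n| |v_m| + |u_n| |v_m - v_n|, and
    fundamental sequences are bounded. *)
Lemma fundamental_ip u v : fundamental u -> fundamental v ->
  exists z : C, (fun n => comb_ip (u n) (v n)) @ \oo --> z.
Proof.
move=> hu hv; apply: cvgC_of_cauchy => e e0.
have [Mu Mu0 [N1 _ uM]] := fundamental_bounded hu.
have [Mv Mv0 [N2 _ vM]] := fundamental_bounded hv.
have e2 : 0 < e / 2 by rewrite divr_gt0.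
have [N3 uN] := hu _ (divr_gt0 e2 Mv0); have [N4 vN] := hv _ (divr_gt0 e2 Mu0).
exists (maxn (maxn N1 N2) (maxn N3 N4)) => m n.
rewrite !geq_max => /andP[/andP[m1 m2] /andP[m3 m4]] /andP[/andP[n1 n2] /andP[n3 n4]].
have -> : comb_ip (u m) (v m) - comb_ip (u n) (v n) =
    comb_ip (comb_diff (u m) (u n)) (v m) + comb_ip (u n) (comb_diff (v m) (v n)).
  by rewrite comb_ipBl comb_ipBr; ring.
rewrite (splitr e) (le_lt_trans (ler_normD _ _))// ltr_leD//.
  apply: le_lt_trans (comb_ip_cs _ _) _; have := uN _ _ m3 n3.
  rewrite ltr_pdivlMr//; apply: le_lt_trans.
  by rewrite ler_wpM2l ?comb_norm_ge0// vM.
apply: le_trans (comb_ip_cs _ _) _; have := ltW (vN _ _ m4 n4).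
rewrite ler_pdivlMr// mulrC; apply: le_trans.
by rewrite ler_wpM2r ?comb_norm_ge0// uM.
Qed.

Lemma cvg_ip_fixed u F m : represents u F ->
  (fun n => comb_ip (u n) m) @ \oo --> \sum_(y <- m) (y.1)^* * F y.2.
Proof.
move=> [_ uF]; under eq_fun do rewrite comb_ipE.
elim: m => [|y m ih].
  by rewrite big_nil; under eq_fun do rewrite big_nil; exact: cvg_cst.
rewrite big_cons.
have -> : (fun n => \sum_(j <- y :: m) (j.1)^* * comb_ev (u n) j.2) =
    (fun n => (y.1)^* * comb_ev (u n) y.2) + (fun n => \sum_(j <- m) (j.1)^* * comb_ev (u n) j.2).
  by apply/funext => n; rewrite big_cons.
by apply: cvgD ih; apply: cvgM (uF _); exact: cvg_cst.
Qed.

(** The point of the whole encoding: a fundamental sequence that represents the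
    zero function has norms tending to 0. Indeed <u_n, u_n> = <u_n, u_n - u_N>
    + <u_n, u_N>; the first term is small for N large, and for this N the
    second tends to 0 because [u_N] is a fixed finite combination of points. *)
Lemma represents0_norm u : represents u (fun=> 0) -> (fun n => comb_norm (u n)) @ \oo --> (0 : C).
Proof.
move=> [hu uF]; apply/cvgr0Pnorm_lt => e e0.
have [M M0 [N1 _ uM]] := fundamental_bounded hu.
have e2 : 0 < e ^+ 2 / 2 by rewrite divr_gt0 ?exprn_gt0.
have [N2 uN] := hu _ (divr_gt0 e2 M0); pose N := maxn N1 N2.
have := @cvg_ip_fixed u (fun=> 0) (u N) (conj hu uF).
rewrite big1 => [|y _]; last by rewrite mulr0.
move=> /cvgr0Pnorm_lt /(_ _ e2) [N3 _ ipN].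
exists (maxn N N3) => // n /=; rewrite !geq_max => /andP[/andP[n1 n2] n3].
rewrite ger0_norm ?comb_norm_ge0// -(@ltr_pXn2r _ 2) ?nnegrE ?comb_norm_ge0// ?ltW//.
rewrite comb_norm2 (splitr (e ^+ 2)).
have -> : comb_ip (u n) (u n) = comb_ip (u n) (comb_diff (u n) (u N)) + comb_ip (u n) (u N).
  by rewrite comb_ipBr subrK.
have : `|comb_ip (u n) (comb_diff (u n) (u N)) + comb_ip (u n) (u N)| < e ^+ 2 / 2 + e ^+ 2 / 2.
  apply: le_lt_trans (ler_normD _ _) _; apply: ler_ltD; last exact: ipN.
  apply: le_trans (comb_ip_cs _ _) _; have := ltW (uN n N n2 (leq_maxr _ _)).
  rewrite ler_pdivlMr// mulrC; apply: le_trans.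
  by rewrite ler_wpM2r ?comb_norm_ge0// uM.
by rewrite ger0_norm// comb_ipBr subrK comb_ip_ge0.
Qed.

Lemma represents_cat u v F G : represents u F -> represents v G ->
  represents (fun n => u n ++ v n) (fun t => F t + G t).
Proof.
move=> [hu uF] [hv vG]; split; first exact: fundamental_cat.
move=> t; have -> : (fun n => comb_ev (u n ++ v n) t) = (fun n => comb_ev (u n) t) + (fun n => comb_ev (v n) t).
  by apply/funext => n; rewrite /comb_ev big_cat.
exact: cvgD (uF t) (vG t).
Qed.

Lemma represents_scale a u F : represents u F ->
  represents (fun n => comb_scale a (u n)) (fun t => a * F t).
Proof.
move=> [hu uF]; split; first exact: fundamental_scale.
move=> t; under eq_fun do rewrite comb_evE comb_ipZl -comb_evE.
by apply: cvgM => //; exact: cvg_cst.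
Qed.

Lemma represents_cst l : represents (fun=> l) (comb_ev l).
Proof.
split=> [e e0|t]; last exact: cvg_cst.
by exists 0%N => i j _ _; rewrite /comb_norm comb_ipBl !comb_ipBr !subrr sqrtC0.
Qed.

(** The limit of inner products depends only on the represented functions: the
    difference of two sequences representing the same function represents 0. *)
Lemma represents_ip_unique u u' v v' F G (z : C) :
  represents u F -> represents u' F -> represents v G -> represents v' G ->
  (fun n => comb_ip (u n) (v n)) @ \oo --> z -> (fun n => comb_ip (u' n) (v' n)) @ \oo --> z.
Proof.
have key w w' H : represents w H -> represents w' H ->
    (fun n => comb_norm (comb_diff (w n) (w' n))) @ \oo --> (0 : C).
  move=> hw hw'; apply: represents0_norm.
  have := represents_cat hw (represents_scale (-1) hw').
  congr represents; apply/funext => t; ring.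
move=> uF uF' vG vG' uvz.
have [Mu Mu0 uM] := fundamental_bounded (proj1 uF').
have [Mv Mv0 vM] := fundamental_bounded (proj1 vG).
have d0 : (fun n => comb_ip (u' n) (v' n) - comb_ip (u n) (v n)) @ \oo --> (0 : C).
  have b0 : (fun n => comb_norm (comb_diff (u n) (u' n)) * Mv + Mu * comb_norm (comb_diff (v n) (v' n))) @ \oo
      --> (0 : C).
    rewrite -[X in _ --> X]addr0; apply: cvgD.
      by rewrite -[X in _ --> X](mul0r Mv); apply: cvgMl; apply: key uF uF'.
    by rewrite -[X in _ --> X](mulr0 Mu); apply: cvgMr; apply: key vG vG'.
  apply/cvgr0Pnorm_lt => e e0; move/cvgr0Pnorm_lt : b0 => /(_ _ e0).
  move: uM vM; apply: filterS3 => n uM vM.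
  rewrite ger0_norm; last first.
    by apply: addr_ge0; apply: mulr_ge0; rewrite ?comb_norm_ge0// ltW.
  apply: le_lt_trans; rewrite distrC.
  have -> : comb_ip (u n) (v n) - comb_ip (u' n) (v' n) =
    comb_ip (comb_diff (u n) (u' n)) (v n) + comb_ip (u' n) (comb_diff (v n) (v' n)).
    by rewrite comb_ipBl comb_ipBr; ring.
  apply: le_trans (ler_normD _ _) _; apply: lerD; apply: le_trans (comb_ip_cs _ _) _.
    by rewrite ler_wpM2l ?comb_norm_ge0.
  by rewrite ler_wpM2r ?comb_norm_ge0.
have -> : (fun n => comb_ip (u' n) (v' n)) =
    (fun n => comb_ip (u' n) (v' n) - comb_ip (u n) (v n)) + (fun n => comb_ip (u n) (v n)).
  by apply/funext => n; rewrite fctE subrK.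
by rewrite -[z]add0r; exact: cvgD d0 uvz.
Qed.

End kolmogorov.

(** * The reproducing kernel Hilbert space *)

Section rkhs.
Context {R : realType} {S : Type} (k : psd_kernel R S).
Local Notation C := R[i].

Definition rkhs_pred : {pred (S -> C)} := fun F => `[< exists u, represents k u F >].

Lemma rkhs_closed : subsemimod_closed rkhs_pred.
Proof.
split=> [|a F /asboolP[u uF]]; last first.
  by apply/asboolP; exists (fun n => comb_scale a (u n)); exact: represents_scale.
split=> [|F G /asboolP[u uF] /asboolP[v vG]]; apply/asboolP; last first.
  by exists (fun n => u n ++ v n); exact: represents_cat.
exists (fun=> [::]); have := @represents_cst _ _ k [::].
by congr represents; apply/funext => t; rewrite /comb_ev big_nil.
Qed.

HB.instance Definition _ := @GRing.isSubmodClosed.Build C (S -> C) rkhs_pred rkhs_closed.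

Record rkhs := Rkhs { rkhs_fun : S -> C ; rkhsP : rkhs_pred rkhs_fun }.
HB.instance Definition _ := [isSub for rkhs_fun].
HB.instance Definition _ := gen_eqMixin rkhs.
HB.instance Definition _ := gen_choiceMixin rkhs.
HB.instance Definition _ := [SubChoice_isSubLmodule of rkhs by <:].

Implicit Types (F G : rkhs) (a : C).

Lemma rkhs_rep (F : rkhs) : exists u, represents k u (rkhs_fun F).
Proof. exact/asboolP/rkhsP. Qed.

Definition rep (F : rkhs) := projT1 (cid (rkhs_rep F)).

Lemma repP F : represents k (rep F) (rkhs_fun F).
Proof. exact: projT2 (cid (rkhs_rep F)). Qed.

Lemma rkhs_dot_exists : exists rkhs_dot : rkhs -> rkhs -> C, forall u v F G,
  represents k u (rkhs_fun F) -> represents k v (rkhs_fun G) ->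
  (fun n => comb_ip k (u n) (v n)) @ \oo --> rkhs_dot F G.
Proof.
exists (fun F G => lim ((fun n => comb_ip k (rep F n) (rep G n)) @ \oo)).
move=> u v F G uF vG; apply: (represents_ip_unique (repP F) uF (repP G) vG).
by have [z hz] := fundamental_ip (proj1 (repP F)) (proj1 (repP G)); apply/cvg_ex; exists z.
Qed.

Definition rkhs_dot : rkhs -> rkhs -> C := projT1 (cid rkhs_dot_exists).

Lemma rkhs_dot_cvg u v F G : represents k u (rkhs_fun F) -> represents k v (rkhs_fun G) ->
  (fun n => comb_ip k (u n) (v n)) @ \oo --> rkhs_dot F G.
Proof. exact: (projT2 (cid rkhs_dot_exists) u v F G). Qed.

Lemma rkhs_dot_eq u v F G z : represents k u (rkhs_fun F) -> represents k v (rkhs_fun G) ->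
  (fun n => comb_ip k (u n) (v n)) @ \oo --> z -> rkhs_dot F G = z.
Proof. by move=> uF vG; apply: cvg_unique => //; exact: rkhs_dot_cvg. Qed.

Lemma rkhs_dotC F G : rkhs_dot G F = (rkhs_dot F G)^*.
Proof.
apply: (rkhs_dot_eq (repP G) (repP F)); under eq_fun do rewrite comb_ipC.
exact/cvg_conj/rkhs_dot_cvg/repP/repP.
Qed.

Lemma rkhs_funP a F F' t :
  rkhs_fun (a *: F + F') t = a * rkhs_fun F t + rkhs_fun F' t.
Proof. by rewrite /= !fctE. Qed.

Lemma represents_lin a F F' :
  represents k (fun n => comb_scale a (rep F n) ++ rep F' n) (rkhs_fun (a *: F + F')).
Proof.
have := represents_cat (represents_scale a (repP F)) (repP F').
by congr represents; apply/funext => t; rewrite rkhs_funP.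
Qed.

Lemma rkhs_dotPl a F F' G : rkhs_dot (a *: F + F') G = a * rkhs_dot F G + rkhs_dot F' G.
Proof.
apply: (@rkhs_dot_eq _ _ (a *: F + F') G _ (represents_lin a F F') (repP G)).
have -> : (fun n => comb_ip k (comb_scale a (rep F n) ++ rep F' n) (rep G n)) =
    (fun n => a * comb_ip k (rep F n) (rep G n)) + (fun n => comb_ip k (rep F' n) (rep G n)).
  by apply/funext => n; rewrite comb_ipDl comb_ipZl.
apply: cvgD; last exact: (rkhs_dot_cvg (repP F') (repP G)).
apply: cvgMr; exact: (rkhs_dot_cvg (repP F) (repP G)).
Qed.

Lemma rkhs_dotPr a F F' G : rkhs_dot G (a *: F + F') = a^* * rkhs_dot G F + rkhs_dot G F'.
Proof. by rewrite rkhs_dotC rkhs_dotPl rmorphD rmorphM /= (rkhs_dotC F G) (rkhs_dotC F' G). Qed.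

Lemma rkhs_dot_ge0 F : 0 <= rkhs_dot F F.
Proof.
by apply: (cvgn_ge0C (rkhs_dot_cvg (repP F) (repP F))) => n; exact: comb_ip_ge0.
Qed.

Lemma rkhs_dotDl F F' G : rkhs_dot (F + F') G = rkhs_dot F G + rkhs_dot F' G.
Proof. by have := rkhs_dotPl 1 F F' G; rewrite scale1r mul1r. Qed.

Lemma rkhs_dot0l G : rkhs_dot 0 G = 0.
Proof. by have := rkhs_dotPl (-1) 0 0 G; rewrite scaler0 addr0 mulN1r addNr. Qed.

Lemma rkhs_dotZl a F G : rkhs_dot (a *: F) G = a * rkhs_dot F G.
Proof. by have := rkhs_dotPl a F 0 G; rewrite addr0 rkhs_dot0l addr0. Qed.

Lemma rkhs_dotZr a F G : rkhs_dot F (a *: G) = a^* * rkhs_dot F G.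
Proof. by rewrite rkhs_dotC rkhs_dotZl rmorphM /= (rkhs_dotC G F). Qed.

Lemma rkhs_dotDr F G G' : rkhs_dot F (G + G') = rkhs_dot F G + rkhs_dot F G'.
Proof. by rewrite rkhs_dotC rkhs_dotDl rmorphD /= (rkhs_dotC G F) (rkhs_dotC G' F). Qed.

Definition emb (l : seq (C * S)) : rkhs :=
  Rkhs (introT (asboolP _) (ex_intro _ (fun=> l) (represents_cst k l))).

Lemma rkhs_dot_emb l m : rkhs_dot (emb l) (emb m) = comb_ip k l m.
Proof.
by apply: (@rkhs_dot_eq _ _ (emb l) (emb m) _ (represents_cst k l) (represents_cst k m)); exact: cvg_cst.
Qed.

(** The reproducing property. *)
Lemma rkhs_dot_emb1 F t : rkhs_dot F (emb [:: (1, t)]) = rkhs_fun F t.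
Proof.
apply: (@rkhs_dot_eq _ _ F (emb [:: (1, t)]) _ (repP F) (represents_cst k _)).
have -> : (fun n => comb_ip k (rep F n) [:: (1, t)]) = (fun n => comb_ev k (rep F n) t).
  by apply/funext => n; rewrite comb_evE.
exact: (proj2 (repP F) t).
Qed.

Lemma rkhs_dot_cs F G : `|rkhs_dot F G| ^+ 2 <= rkhs_dot F F * rkhs_dot G G.
Proof.
apply: cauchy_schwarz_of_quadratic; rewrite ?rkhs_dot_ge0// => a.
have := rkhs_dot_ge0 (F + a *: G); congr (_ <= _).
rewrite (rkhs_dotDl F (a *: G)) (rkhs_dotDr F F (a *: G)) (rkhs_dotDr (a *: G) F (a *: G)).
rewrite (rkhs_dotZl a G F) (rkhs_dotZl a G (a *: G)) (rkhs_dotZr a F G) (rkhs_dotZr a G G) (rkhs_dotC F G).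
by move: (rkhs_dot F F) (rkhs_dot F G) (rkhs_dot G G) => A z B; ring.
Qed.

(** By Cauchy-Schwarz and the reproducing property, a function of norm 0
    vanishes at every point. *)
Lemma rkhs_dot_eq0 F : rkhs_dot F F = 0 -> F = 0.
Proof.
move=> F0; apply/val_inj/funext => t; rewrite [RHS]/=; apply: (etrans (esym (rkhs_dot_emb1 F t))).
have := rkhs_dot_cs F (emb [:: (1, t)]); rewrite F0 mul0r => h.
apply/eqP; rewrite -normr_eq0 -sqrf_eq0 eq_le h /=.
by rewrite exprn_ge0.
Qed.

Definition hnorm F : C := sqrtC (rkhs_dot F F).

Lemma hnorm_ge0 F : 0 <= hnorm F. Proof. by rewrite sqrtC_ge0 rkhs_dot_ge0. Qed.

Lemma hnormZ a F : hnorm (a *: F) = `|a| * hnorm F.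
Proof.
rewrite /hnorm (rkhs_dotZl a F) (rkhs_dotZr a F F) mulrA -normCK rootCMl ?exprn_ge0//.
by rewrite -[sqrtC (_ ^+ 2)]/(sqrtC _) sqrCK.
Qed.

Lemma hnorm2 F : hnorm F ^+ 2 = rkhs_dot F F. Proof. exact: sqrtCK. Qed.

Lemma rkhs_dot_norm F G : `|rkhs_dot F G| <= hnorm F * hnorm G.
Proof.
rewrite -(@ler_pXn2r _ 2) ?nnegrE ?mulr_ge0 ?hnorm_ge0// exprMn.
have := rkhs_dot_cs F G; have := hnorm2 F; have := hnorm2 G.
by move: (hnorm F) (hnorm G) => p q -> ->.
Qed.

Lemma hnorm_tri F G : hnorm (F + G) <= hnorm F + hnorm G.
Proof.
rewrite -(@ler_pXn2r _ 2) ?nnegrE ?addr_ge0 ?hnorm_ge0// sqrrD.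
have := rkhs_dot_norm F G; have := hnorm2 (F + G); have := hnorm2 F; have := hnorm2 G.
move: (hnorm F) (hnorm G) (hnorm (F + G)) => p q r -> -> -> {r}.
rewrite (rkhs_dotDl F G (F + G)) (rkhs_dotDr F F G) (rkhs_dotDr G F G) (rkhs_dotC F G).
move: (rkhs_dot F F) (rkhs_dot F G) (rkhs_dot G G) (p * q) => A z B pq zp.
rewrite addrA lerD2r -addrA lerD2l mulr2n.
apply: le_trans (add_conj_le z) _; exact: lerD.
Qed.

Lemma hnorm_eq0 F : hnorm F = 0 -> F = 0.
Proof. by move/eqP; rewrite sqrtC_eq0 => /eqP/rkhs_dot_eq0. Qed.

HB.instance Definition _ := @Lmodule_isNormed.Build C rkhs hnorm hnorm_tri hnormZ hnorm_eq0.

Lemma rkhs_normE (F : rkhs) : `|F| = hnorm F. Proof. by []. Qed.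

Lemma hnorm_emb l : hnorm (emb l) = comb_norm k l.
Proof. by rewrite /hnorm rkhs_dot_emb. Qed.

Lemma emb_dif l m : emb (comb_diff l m) = emb l - emb m.
Proof.
apply/val_inj/funext => t; rewrite /= !fctE.
by rewrite !comb_evE comb_ipBl.
Qed.

Lemma represents_emb_sub u F l : represents k u (rkhs_fun F) ->
  represents k (fun n => comb_diff l (u n)) (rkhs_fun (emb l - F)).
Proof.
move=> uF; have := represents_cat (represents_cst k l) (represents_scale (-1) uF).
by congr represents; apply/funext => t; rewrite /= !fctE mulN1r.
Qed.

(** A represented function is the limit of the combinations that represent it,
    so combinations are dense. *)
Lemma emb_cvg u F : represents k u (rkhs_fun F) ->
  forall e : C, 0 < e -> exists N, forall n : nat, (N <= n)%N -> hnorm (emb (u n) - F) < e.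
Proof.
move=> uF e e0; have e2 : 0 < e / 2 by rewrite divr_gt0.
have [N uN] := (proj1 uF) _ e2; exists N => n Nn.
apply: (@le_lt_trans _ _ (e / 2)); last by rewrite ltr_pdivrMr// mulr2n mulrDr mulr1 ltrDl.
rewrite -(@ler_pXn2r _ 2) ?nnegrE ?hnorm_ge0 ?(ltW e2)//.
have hr := represents_emb_sub (u n) uF.
have := rkhs_dot_cvg hr hr; have := hnorm2 (emb (u n) - F).
move: (hnorm _) (rkhs_dot _ _) => q p -> hc.
rewrite -subr_ge0; apply: (@cvgn_ge0C _ (fun m => (e / 2) ^+ 2 -
    comb_ip k (comb_diff (u n) (u (m + N)%N)) (comb_diff (u n) (u (m + N)%N)))).
  apply: cvgB; first exact: cvg_cst.
  by move: hc; rewrite -(cvg_shiftn N).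
move=> m; rewrite subr_ge0 -comb_norm2 lerXn2r ?nnegrE ?comb_norm_ge0 ?(ltW e2)// ltW//.
by rewrite uN// leq_addl.
Qed.

Lemma natSinv_ltC (e : C) : 0 < e ->
  exists N, forall n, (N <= n)%N -> n.+1%:R^-1 < e.
Proof.
move=> e0; have eE : e = (complex.Re e)%:C%C by rewrite RRe_real// ger0_real// ltW.
move: e0; rewrite eE ltcR => e0.
have [N _ hN] := near_infty_natSinv_lt (PosNum e0).
exists N => n Nn; have := hN n Nn; rewrite /= -ltcR.
by rewrite fmorphV rmorph_nat.
Qed.

(** Approximate a Cauchy filter by combinations; these form a fundamental
    sequence, and the function that it represents is the limit. *)
Lemma rkhs_complete (A : set_system rkhs) : ProperFilter A -> cauchy A -> cvg A.
Proof.
move=> AF /cauchyP Ac.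
have /choice[x xA] : forall n : nat, exists x, A (ball x (n.+1%:R^-1 : C)).
  by move=> n; apply: Ac; rewrite invr_gt0.
(* Combinations u n close to points x n of the filter. *)
have /choice[u ux] : forall n : nat, exists l, hnorm (emb l - x n) < (n.+1%:R^-1 : C).
  move=> n; have n0 : 0 < (n.+1%:R^-1 : C) by rewrite invr_gt0.
  by have [N hN] := emb_cvg (repP (x n)) n0; exists (rep (x n) N); exact: hN.
have xx i j : `|x i - x j| < (i.+1%:R^-1 : C) + j.+1%:R^-1.
  have [y [yi yj]] := filter_ex (filterI (xA i) (xA j)).
  rewrite -ball_normE /= in yi; rewrite -ball_normE /= in yj.
  apply: le_lt_trans (ltrD yi yj); rewrite -(subrKA y) (distrC (x j) y).
  exact: ler_normD.
have hu : fundamental k u.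
  move=> e e0; have e4 : 0 < e / 4 by rewrite divr_gt0.
  have [N hN] := natSinv_ltC e4; exists N => i j Ni Nj.
  rewrite -hnorm_emb emb_dif -rkhs_normE.
  have -> : emb (u i) - emb (u j) =
      (emb (u i) - x i) + (x i - x j) - (emb (u j) - x j).
    by rewrite opprB !subrKA.
  apply: le_lt_trans (ler_normB _ _) _.
  apply: (@le_lt_trans _ _ (`|emb (u i) - x i| + `|x i - x j| + `|emb (u j) - x j|)).
    by rewrite lerD2r ler_normD.
  have -> : e = (e / 4) + (e / 4 + e / 4) + e / 4 by field.
  apply: ltrD; first apply: ltrD.
  - exact: lt_trans (ux i) (hN i Ni).
  - exact: lt_trans (xx i j) (ltrD (hN i Ni) (hN j Nj)).
  - exact: lt_trans (ux j) (hN j Nj).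
have /choice[F uF] : forall t, exists z : C, (fun n => comb_ev k (u n) t) @ \oo --> z.
  move=> t; have [z hz] := fundamental_ip hu (proj1 (represents_cst k [:: (1, t)])).
  exists z; suff <- : (fun n => comb_ip k (u n) [:: (1, t)]) = (fun n => comb_ev k (u n) t) by [].
  by apply/funext => n; rewrite comb_evE.
have rF : rkhs_pred F by apply/asboolP; exists u.
pose G := Rkhs rF; apply/cvg_ex; exists G; apply/cvgrPdist_lt => e e0.
have e3 : 0 < e / 3 by rewrite divr_gt0.
have uG : represents k u (rkhs_fun G) by [].
have [N1 hN1] := emb_cvg uG e3; have [N2 hN2] := natSinv_ltC e3.
pose n := maxn N1 N2; have := xA n; apply: filterS => y.
rewrite -ball_normE /= => xy.
have -> : G - y = - (emb (u n) - G) + (emb (u n) - x n) + (x n - y).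
  by rewrite opprB !subrKA.
apply: le_lt_trans (ler_normD _ _) _.
apply: (@le_lt_trans _ _ (`|emb (u n) - G| + `|emb (u n) - x n| + `|x n - y|)).
  by rewrite lerD2r -(normrN (emb (u n) - G)) ler_normD.
have -> : e = e / 3 + e / 3 + e / 3 by field.
have n2 := hN2 n (leq_maxr _ _).
apply: ltrD; first apply: ltrD.
- exact: hN1 (leq_maxl _ _).
- exact: lt_trans (ux n) n2.
- exact: lt_trans xy n2.
Qed.

HB.instance Definition _ := Uniform_isComplete.Build rkhs rkhs_complete.

Lemma rkhs_dot_bilinear : bilinear_for (GRing.Scale.Law.clone _ _ *%R _) (GRing.Scale.Law.clone _ _ (Num.conj \; *%R) _) rkhs_dot.
Proof.
split=> [G a F F'|F a G G'] /=; [exact: rkhs_dotPl|exact: rkhs_dotPr].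
Qed.

HB.instance Definition _ := @bilinear_isBilinear.Build C rkhs rkhs C _ _ rkhs_dot rkhs_dot_bilinear.

Lemma rkhs_dot_herm (F G : rkhs) : rkhs_dot F G = (-1) ^+ false * Num.conj (rkhs_dot G F).
Proof. by rewrite expr0 mul1r; exact: rkhs_dotC. Qed.

HB.instance Definition _ := @isHermitianSesquilinear.Build C rkhs false Num.conj rkhs_dot rkhs_dot_herm.

Lemma rkhs_dot_gt0 (F : rkhs) : F != 0 -> 0 < rkhs_dot F F.
Proof.
move=> F0; rewrite lt_def rkhs_dot_ge0 andbT; apply: contra F0 => /eqP h.
by apply/eqP/rkhs_dot_eq0.
Qed.

HB.instance Definition _ := @isDotProduct.Build C rkhs rkhs_dot rkhs_dot_gt0.

Definition rkhs_hilbert : hilbertType R :=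
  @HilbertType R rkhs rkhs_dot (fun F => esym (hnorm2 F)).

End rkhs.

(** The vector of a point s is the class of the combination consisting of s
    alone, that is, the function k s. *)
Theorem kolmogorov (R : realType) (S : Type) (k : psd_kernel R S) :
  exists (V : hilbertType R) (v : S -> V), forall s t, inner V (v s) (v t) = k s t.
Proof.
exists (rkhs_hilbert k), (fun s => emb k [:: (1, s)]) => s t.
by rewrite [LHS]rkhs_dot_emb /comb_ip !big_seq1 /= rmorph1 !mul1r.
Qed.

(** * Baire category and the theorem of Pettis *)

Lemma countable_enum (T : Type) (A : set T) : countable A -> A !=set0 ->
  exists2 e : nat -> T, (forall n, A (e n)) & forall x, A x -> exists n, e n = x.
Proof.
move=> /pfcard_geP[->|[f]] [x Ax]; first by case: Ax.
exists f => [n|y Ay]; first exact: funS.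
by have [n _ <-] := @surj _ _ _ _ f y Ay; exists n.
Qed.

Section baire.
Context {G : topologicalGroupType}.
Implicit Types (A O W : set G) (F : set (set G)).

Lemma cvg_mulg (T : Type) (F : set_system T) (FF : Filter F) (f h : T -> G) (a b : G) :
  f @ F --> a -> h @ F --> b -> (fun x => (f x * h x)%g) @ F --> (a * b)%g.
Proof.
move=> fa hb; apply: (@cvg_comp _ _ _ (fun x => (f x, h x))
  (fun x : G * G => (x.1 * x.2)%g) F (nbhs (a, b))); first exact: cvg_pair.
exact: mulg_continuous (a, b).
Qed.

Lemma cvg_invg (T : Type) (F : set_system T) (FF : Filter F) (f : T -> G) (a : G) :
  f @ F --> a -> (fun x => (f x)^-1%g) @ F --> (a^-1)%g.
Proof. by move=> fa; apply: cvg_comp fa (invg_continuous _). Qed.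

Lemma mulgl_continuous (g : G) : continuous (fun h : G => (g * h)%g).
Proof. by move=> h; apply: cvg_mulg; [exact: cvg_cst|exact: cvg_id]. Qed.

Lemma mulgr_continuous (g : G) : continuous (fun h : G => (h * g)%g).
Proof. by move=> h; apply: cvg_mulg; [exact: cvg_id|exact: cvg_cst]. Qed.

Lemma nbhs1_divl (U : set G) : nbhs 1%g U ->
  exists2 V, nbhs 1%g V & forall x y, V x -> V y -> U (x^-1 * y)%g.
Proof.
move=> U1.
have : (fun z : G * G => (z.1^-1 * z.2)%g) @ ((1 : G)%g, (1 : G)%g) --> ((1 : G)^-1 * 1)%g.
  apply: cvg_mulg; last exact: cvg_snd.
  by apply: cvg_invg; exact: cvg_fst.
rewrite mulg1 invg1 => /(_ _ U1) [[V V'] [/= V1 V'1] VU].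
by exists (V `&` V'); [exact: filterI|move=> x y [Vx _] [_ Vy]; exact: (VU (x, y))].
Qed.

Lemma nbhs_translate (g : G) (U : set G) : nbhs g U -> nbhs 1%g [set h | U (g * h)%g].
Proof. by move=> Ug; apply: (@mulgl_continuous g 1%g); rewrite mulg1. Qed.

(** Choose V near 1 with V^-1 V inside g^-1 U and W = { h | h^-1 g in V }: if y
    is in the closure of W, some z in W has z^-1 y in V as well, and then g^-1
    y = (z^-1 g)^-1 (z^-1 y) lies in V^-1 V. *)
Lemma group_regular (g : G) (U : set G) : nbhs g U ->
  exists2 W, open_nbhs g W & closure W `<=` U.
Proof.
move=> /nbhs_translate/nbhs1_divl[V V1 VU].
exists ((fun h => h^-1 * g)%g @^-1` V^°).
  split; last by rewrite /= mulVg; exact: nbhs_singleton (nbhs_interior V1).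
  apply: open_comp; last exact: open_interior.
  by move=> h _; apply: cvg_mulg; [exact: invg_continuous|exact: cvg_cst].
move=> y cy; have : nbhs y [set z | V (z^-1 * y)%g].
  have : (fun z : G => (z^-1 * y)%g) @ y --> (y^-1 * y)%g.
    by apply: cvg_mulg; [exact: invg_continuous|exact: cvg_cst].
  by rewrite mulVg => /(_ _ V1).
move/cy => [z [/interior_subset /= Vz Vyz]].
have := VU _ _ Vz Vyz.
by rewrite /= !invgM invgK !mulgA !mulgV !mul1g mulgV mul1g.
Qed.

Definition meager A := exists F : set (set G),
  [/\ countable F, forall B, F B -> open (~` B) /\ dense (~` B) &
      A `<=` \bigcup_(B in F) B].

Lemma meager_sub A B : A `<=` B -> meager B -> meager A.
Proof. by move=> AB [F [cF hF BF]]; exists F; split=> //; exact: subset_trans BF. Qed.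

Lemma meager_bigcup (A : nat -> set G) : (forall n, meager (A n)) ->
  meager (\bigcup_n A n).
Proof.
move=> /choice[F hF]; exists (\bigcup_n F n); split.
- by apply: bigcup_countable => // n _; case: (hF n).
- by move=> B [n _ FB]; case: (hF n) => _ /(_ _ FB).
- move=> x [n _ Ax]; case: (hF n) => _ _ /(_ _ Ax)[B FB Bx].
  by exists B => //; exists n.
Qed.

Lemma meagerU A B : meager A -> meager B -> meager (A `|` B).
Proof.
move=> mA mB; rewrite -bigcup2E; apply: meager_bigcup => -[|[|n]] //=.
by exists set0; split=> // ? [].
Qed.

Lemma meager_preimage (t t' : G -> G) A : continuous t -> continuous t' ->
  cancel t t' -> cancel t' t -> meager A -> meager (t @^-1` A).
Proof.
move=> ct ct' tK t'K [F [cF hF AF]]; exists [set t @^-1` B | B in F]; split.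
- by apply: card_le_trans cF; exact: card_image_le.
- move=> _ [B FB <-]; rewrite preimage_setC; split.
    by apply: open_comp; [move=> ? _; exact: ct|case: (hF _ FB)].
  move=> W [x Wx] oW; have [_ dB] := hF _ FB.
  have [||y [/= Wy By]] := dB (t' @^-1` W).
  + by exists (t x); rewrite /= tK.
  + by apply: open_comp => // ? _; exact: ct'.
  + by exists (t' y); split=> //; rewrite /= t'K.
- by move=> x /AF[B FB Bx]; exists (t @^-1` B) => //; exists B.
Qed.

Definition baire_property A := exists2 O, open O &
  meager [set x | ~ (A x <-> O x)].

(** This is what makes the Baire property stable under complements: the
    complement of an open set differs from its own interior by a nowhere dense
    set. *)
Lemma meager_boundary O : open O -> meager (~` O `\` (~` O)^°).
Proof.
move=> oO; exists [set ~` O `\` (~` O)^°]; split=> [|B /= ->|x ?]; last first.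
- by exists (~` O `\` (~` O)^°).
- have -> : ~` (~` O `\` (~` O)^°) = O `|` (~` O)^° by rewrite setCD setCK setUC.
  split; first by apply: openU => //; exact: open_interior.
  move=> W [x Wx] oW; have [[y [Wy Oy]]|h] := pselect (exists y, W y /\ O y).
    by exists y; split=> //; left.
  exists x; split=> //; right; rewrite /interior /= nbhsE; exists W => //.
  by move=> y Wy Oy; apply: h; exists y.
- exact: countable1.
Qed.

(** Sets with the Baire property form a sigma-algebra that contains the open
    sets. *)
Lemma baire_property_borel A : <<s @open G >> A -> baire_property A.
Proof.
move=> hA; apply: hA; split; last first.
  move=> O oO; exists O => //; exists set0; split=> // x /=; tauto.
split.
- exists set0; first exact: open0; exists set0; split=> // x /=; tauto.
- move=> B [U oU mU]; exists (~` U)^°; first exact: open_interior.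
  apply: meager_sub (meagerU mU (meager_boundary oU)).
  move=> x /= h; have [Ox|nOx] := pselect ((~` U)^° x).
    left=> BO; apply: h; split=> // _; split=> //.
    by move=> /BO; exact: interior_subset Ox.
  have [Ox|Ox] := pselect (U x); last by right.
  left=> BO; apply: h; split=> // -[_]; tauto.
- move=> B hB; have /choice[U hU] : forall n, exists U, open U /\
      meager [set x | ~ (B n x <-> U x)].
    by move=> n; have [U oU mU] := hB n; exists U.
  exists (\bigcup_n U n); first by apply: bigcup_open => n _; case: (hU n).
  apply: meager_sub (meager_bigcup (fun n => proj2 (hU n))) => x /= h.
  apply: contrapT => nx; apply: h; split=> -[n _ ?]; exists n => //;
    apply: contrapT => h; apply: nx; exists n => //=; tauto.
Qed.

Hypothesis hG : lcsc G.

(** Baire's theorem for locally compact groups, inside a given open set: a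
    decreasing sequence of open sets whose closures avoid the closed nowhere
    dense sets one after the other has a cluster point, the first closure being
    compact. *)
Lemma baire_category F : countable F ->
  (forall B, F B -> open (~` B) /\ dense (~` B)) ->
  forall W, open W -> W !=set0 -> ~ (W `<=` \bigcup_(B in F) B).
Proof.
move=> cF hF W oW [x Wx] WF.
have F0 : (F `|` [set set0]) !=set0 by exists set0; right.
have [|e eF Fe] := countable_enum _ F0.
  rewrite -bigcup2E; apply: bigcup_countable => [|[|[|i]] _] //=; exact: countable1.
have eo n : open (~` e n) /\ dense (~` e n).
  case: (eF n) => [/hF//|->]; rewrite setC0; split; first exact: openT.
  by move=> O O0 _; rewrite setIT.
have lc := hG; case: lc => hT lc _.
have [K] := lc x I; rewrite /within /= => K1 [cK clK].
have nK : nbhs x K by move: K1; apply: filterS => y; apply.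
(* The state carries the index of the next set to avoid. *)
pose T := {V : set G | open V /\ V !=set0}.
have step (s : nat * T) : {s' : nat * T | s'.1 = s.1.+1 /\
    closure (sval s'.2) `<=` sval s.2 `&` ~` e s.1}.
  apply: cid; case: s => n [V [oV V0]] /=.
  have [oe de] := eo n; have [y [Vy ey]] := de V V0 oV.
  have [|V' [oV' V'y] cV'] := @group_regular y (V `&` ~` e n).
    by apply: open_nbhs_nbhs; split=> //; exact: openI.
  by exists (n.+1, exist _ V' (conj oV' (ex_intro _ y V'y))).
have [|V0 [oV0 V0x] cV0] := @group_regular x (W `&` K).
  by apply: filterI => //; exact: open_nbhs_nbhs.
have [f [f0 fS]] := dependent_choice step
  (0%N, exist _ V0 (conj oV0 (ex_intro _ x V0x)) : T).
have f1 n : (f n).1 = n by elim: n => [|n ih]; rewrite ?f0//; case: (fS n) => -> _; rewrite ih.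
pose V n := sval (f n).2.
have VS n : closure (V n.+1) `<=` V n `&` ~` e n.
  by have [_] := fS n; rewrite f1.
have Vmono m n : (m <= n)%N -> V n `<=` V m.
  elim: n => [|n ih]; first by rewrite leqn0 => /eqP ->.
  rewrite leq_eqVlt => /predU1P[->//|/ih h].
  by apply: subset_trans h => y /subset_closure /VS[].
have V0E : V 0%N = V0 by rewrite /V f0.
pose B := filter_from [set: nat] (fun n => V n).
have FB : ProperFilter B.
  apply: filter_from_proper; last by move=> n _; have [_] := svalP (f n).2.
  apply: filter_from_filter; first by exists 0%N.
  move=> i j _ _; exists (maxn i j) => // y Vy; split; apply: Vmono Vy; rewrite ?leq_maxl ?leq_maxr//.
have [|y [Ky cy]] := cK B FB.
  by exists 0%N => // y; rewrite V0E => /subset_closure /cV0[].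
have yV n : closure (V n) y.
  by move=> U Uy; apply: cy => //; exists n.
have [Wy _] : (W `&` K) y by apply: cV0; rewrite -V0E; exact: yV.
have [B' FB' By] := WF _ Wy.
have [n en] := Fe B' (or_introl FB').
by have [_] := VS n y (yV n.+1); rewrite en.
Qed.

Lemma nonmeagerT : ~ meager [set: G].
Proof.
move=> [F [cF hF GF]]; apply: (baire_category cF hF openT) => //.
by exists 1%g.
Qed.

(** If A agrees with the open set O up to a meager set, and O meets its
    preimage under the homeomorphism t, then O and t^-1 O share a nonempty open
    set, which is not covered by the two exceptional meager sets. *)
Lemma nonmeager_meet A (t t' : G -> G) O (o : G) : continuous t -> continuous t' ->
  cancel t t' -> cancel t' t -> open O -> meager [set x | ~ (A x <-> O x)] ->
  O o -> O (t o) -> exists h, A h /\ A (t h).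
Proof.
move=> ct ct' tK t'K oO mO Oo Oto.
have [F [cF hF MF]] := meagerU mO (meager_preimage ct ct' tK t'K mO).
pose W := O `&` t @^-1` O.
have oW : open W by apply: openI => //; apply: open_comp => // ? _; exact: ct.
have W0 : W !=set0 by exists o.
have /existsNP[h /not_implyP[[Oh Oth] nF]] := baire_category cF hF oW W0.
have nM := contra_not (MF h) nF.
exists h; split.
  by apply: contrapT => nA; apply: nM; left=> /=; tauto.
by apply: contrapT => nA; apply: nM; right=> /=; tauto.
Qed.

(** Some member E of the cover is not meager; it agrees with a nonempty open
    set O up to a meager set. For g near 1 the sets O and O g^-1 meet, so
    [nonmeager_meet] gives h in E with h g in E. *)
Theorem pettis (E : nat -> set G) : (forall n, <<s @open G >> (E n)) ->
  (forall g, exists n, E n g) ->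
  exists n, \forall g \near (1 : G)%g,
    exists h k, [/\ E n h, E n k & g = (h^-1 * k)%g].
Proof.
move=> bE cE.
have [n nE] : exists n, ~ meager (E n).
  apply: contrapT => /forallNP h; apply: nonmeagerT.
  apply: meager_sub (meager_bigcup (fun n => contrapT (h n))) => g _.
  by have [n Eg] := cE g; exists n.
exists n; have [U oU mU] := baire_property_borel (bE n).
have [U0|/set0P[u Uu]] := eqVneq U set0.
  by exfalso; apply: nE; apply: meager_sub mU => x /= Ex; rewrite U0 => -[/(_ Ex)].
have : nbhs (1 : G)%g [set g | U (u * g)%g].
  by apply: nbhs_translate; apply: open_nbhs_nbhs.
apply: filterS => g Ug.
have [h [Eh Ek]] := @nonmeager_meet (E n) (fun x => x * g)%g (fun x => x * g^-1)%g U u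
  (@mulgr_continuous g) (@mulgr_continuous g^-1%g)
  (mulgK g) (mulgVK g) oU mU Uu Ug.
by exists h, (h * g)%g; split=> //; rewrite mulKg.
Qed.

End baire.

(** * Probabilities of symmetric differences *)

Lemma second_countable_enum (T : topologicalType) : @second_countable T ->
  exists2 b : nat -> set T, (forall n, open (b n)) &
    forall x (N : set T), nbhs x N -> exists2 n, b n x & b n `<=` N.
Proof.
move=> [B cB [oB nB]].
have [||e eB Be] := @countable_enum _ (B `|` [set set0]).
- rewrite -bigcup2E; apply: bigcup_countable => [|[|[|i]] _] //=; exact: countable1.
- by exists set0; right.
exists e => [n|x N Nx]; first by case: (eB n) => [/oB//|->]; exact: open0.
have [U [BU Ux] UN] := nB x N Nx.
by have [n en] := Be U (or_introl BU); exists n; rewrite en.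
Qed.

Lemma open_bigcup_base (T : topologicalType) (b : nat -> set T) :
  (forall n, open (b n)) ->
  (forall x (N : set T), nbhs x N -> exists2 n, b n x & b n `<=` N) ->
  forall U : set T, open U -> U = \bigcup_(n in [set n | b n `<=` U]) b n.
Proof.
move=> ob nb U oU; apply/seteqP; split=> [x Ux|x [n /= bU bx]]; last exact: bU.
have [|n bx bU] := nb x U; first exact: open_nbhs_nbhs.
by exists n.
Qed.

Section probability_real.
Context {R : realType} {d} {X : measurableType d} (mu : probability X R).
Implicit Types A B : set X.

Definition pr A : R := fine (mu A).

Lemma prE A : measurable A -> mu A = (pr A)%:E.
Proof. by move=> mA; rewrite fineK// fin_num_measure. Qed.

Lemma pr_le A B : measurable A -> measurable B -> A `<=` B -> pr A <= pr B.
Proof. by move=> mA mB AB; rewrite -lee_fin -!prE// le_measure// inE. Qed.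

Lemma prU A B : measurable A -> measurable B -> pr (A `|` B) <= pr A + pr B.
Proof.
move=> mA mB; rewrite -lee_fin EFinD -!prE//; last exact: measurableU.
exact: measureU2.
Qed.

Lemma pr_leU A B C : measurable A -> measurable B -> measurable C ->
  A `<=` B `|` C -> pr A <= pr B + pr C.
Proof.
move=> mA mB mC h; apply: le_trans (prU mB mC); apply: pr_le => //.
exact: measurableU.
Qed.

Lemma pr_cvg0 (A : nat -> set X) : (forall n, measurable (A n)) ->
  (forall m n, (m <= n)%N -> A n `<=` A m) -> \bigcap_n A n = set0 ->
  forall e : R, 0 < e -> exists n, pr (A n) < e.
Proof.
move=> mA hA A0 e e0.
have : mu \o A @ \oo --> mu (\bigcap_n A n).
  apply: nonincreasing_cvg_mu => //.
  - by rewrite (le_lt_trans (probability_le1 _ _))// ltry.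
  - exact: bigcap_measurable.
  - by move=> m n mn; apply/subsetPset; exact: hA.
rewrite A0 measure0 => /fine_cvgP[_].
move=> /cvgr0Pnorm_lt /(_ _ e0)[n _ /(_ n (leqnn n))] /=.
by rewrite ger0_norm ?fine_ge0// => h; exists n.
Qed.

Definition sdiff A B := (A `\` B) `|` (B `\` A).

Lemma measurable_sdiff A B : measurable A -> measurable B -> measurable (sdiff A B).
Proof. by move=> mA mB; apply: measurableU; exact: measurableD. Qed.

Lemma sdiffC A B : sdiff (~` A) (~` B) = sdiff A B.
Proof.
by apply/seteqP; split=> x /=; rewrite /sdiff /=;
  have [?|?] := pselect (A x); have [?|?] := pselect (B x); tauto.
Qed.

(** * A countable dense algebra of sets *)

(** Trees code the finite Boolean combinations of a sequence of sets, and trees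
    are countable; a node is the complement of the union of its children, which
    suffices for all Boolean operations. *)
Fixpoint term_set (b : nat -> set X) (t : GenTree.tree nat) : set X :=
  match t with
  | GenTree.Leaf i => b i
  | GenTree.Node _ s => ~` (foldr (fun u A => term_set b u `|` A) set0 s)
  end.

Definition approximable (b : nat -> set X) A := measurable A /\
  forall e : R, 0 < e -> exists t, measurable (term_set b t) /\ pr (sdiff A (term_set b t)) < e.

Lemma approximableC b A : approximable b A -> approximable b (~` A).
Proof.
move=> [mA hA]; split=> [|e /hA[t [mt ht]]]; first exact: measurableC.
exists (GenTree.Node 0 [:: t]); rewrite /= setU0; split; first exact: measurableC.
by rewrite sdiffC.
Qed.

Lemma approximableU b A B : approximable b A -> approximable b B ->
  approximable b (A `|` B).
Proof.
move=> [mA hA] [mB hB]; split=> [|e e0]; first exact: measurableU.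
have e2 : 0 < e / 2 by rewrite divr_gt0.
have [t [mt ht]] := hA _ e2; have [u [mu' hu]] := hB _ e2.
exists (GenTree.Node 0 [:: GenTree.Node 0 [:: t; u]]).
rewrite /= !setU0 setCK; split; first exact: measurableU.
rewrite (splitr e); apply: le_lt_trans (ltrD ht hu).
apply: pr_leU; try exact: measurable_sdiff.
  by apply: measurable_sdiff => //; exact: measurableU.
by move=> x /=; rewrite /sdiff /=; tauto.
Qed.

(** A countable union is approximated by a finite one, by continuity of the
    measure from above. *)
Lemma approximable_sigma b : sigma_algebra setT (approximable b).
Proof.
have h0 : approximable b set0.
  (* The empty set is the complement of the complement of the empty union. *)
  split=> // e e0; pose t : GenTree.tree nat := GenTree.Node 0 [:: GenTree.Node 0 [::]].
  exists t; rewrite /= setU0 setCK; split=> //.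
  by rewrite /sdiff setD0 setU0 /pr measure0.
split=> // [A hA|A hA].
  by rewrite setTD; exact: approximableC.
have mA : measurable (\bigcup_n A n) by apply: bigcup_measurable => n _; case: (hA n).
split=> // e e0; have e2 : 0 < e / 2 by rewrite divr_gt0.
pose B n := \big[setU/set0]_(i < n) A i.
have hB n : approximable b (B n).
  rewrite /B; elim: n => [|n ih]; first by rewrite big_ord0.
  by rewrite big_ord_recr /=; exact: approximableU.
have [n hn] : exists n, pr (\bigcup_n A n `\` B n) < e / 2.
  apply: (@pr_cvg0 (fun n => \bigcup_n A n `\` B n)) => //.
  - by move=> n; apply: measurableD => //; case: (hB n).
  - move=> m n mn x [? Bx]; split=> //; apply: contra_not Bx.
    by rewrite /B -!bigcup_mkord => -[i /= im Ai]; exists i => //=; exact: leq_trans mn.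
  - apply/seteqP; split=> // x h; have [[n _ Ax] _] := h 0%N I.
    by have [_] := h n.+1 I; apply; rewrite /B -bigcup_mkord; exists n => /=.
have [_ /(_ _ e2)[t [mt ht]]] := hB n; exists t; split=> //.
rewrite (splitr e); apply: le_lt_trans (ltrD hn ht).
have mB : measurable (B n) by case: (hB n).
apply: pr_leU; first exact: measurable_sdiff.
- exact: measurableD.
- exact: measurable_sdiff.
move=> x; rewrite /sdiff /= => -[[Ux tx]|[tx Ux]].
  by have [?|?] := pselect (B n x); tauto.
right; right; split=> //; apply: contra_not Ux; rewrite /B -bigcup_mkord.
by move=> [i _ ?]; exists i.
Qed.

(** The sets that are approximated by Boolean combinations of a countable base
    form a sigma-algebra containing the open sets, hence contain all Borel
    sets. *)
Lemma dense_sequence : standard_borel R X ->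
  exists2 A : nat -> set X, (forall n, measurable (A n)) &
    forall B, measurable B -> forall e : R, 0 < e ->
      exists n, pr (sdiff B (A n)) < e.
Proof.
move=> [P [f [_ sP _ fB]]].
have [b ob nb] := second_countable_enum sP.
pose c n := f @^-1` (b n).
have mc n : measurable (c n).
  by apply/fB; exists (b n) => //; exact: sub_gen_smallest.
have key B : measurable B -> approximable c B.
  move=> /fB[D hD ->]; apply: (hD [set D | approximable c (f @^-1` D)]); split.
    have [h0 hC hU] := approximable_sigma c; split=> /=.
    - by rewrite preimage_set0.
    - by move=> E /hC; rewrite !setTD preimage_setC.
    - by move=> E /hU; rewrite preimage_bigcup.
  move=> U oU /=; rewrite (open_bigcup_base ob nb oU) preimage_bigcup bigcup_mkcond.
  have [h0 hC hU] := approximable_sigma c; apply: hU => n.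
  case: ifPn => // _; split; first exact: mc.
  move=> e e0; exists (GenTree.Leaf n) => /=; split; first exact: mc.
  by rewrite /sdiff setDv setU0 /pr measure0.
pose A n := if unpickle n is Some t then
  (if pselect (measurable (term_set c t)) then term_set c t else set0) else set0.
exists A => [n|B mB e e0].
  by rewrite /A; case: unpickle => [t|//]; case: pselect => m_t /=.
have [_ /(_ _ e0)[t [mt ht]]] := key B mB.
by exists (pickle t); rewrite /A pickleK; case: pselect.
Qed.

(** * A countable dense family of partitions *)

(** A list of indices codes a partition into finitely many pieces: the number
    of x is the position of the first listed set that contains it. *)
Definition set_code (A : nat -> set X) (l : seq nat) (x : X) : nat :=
  find (fun m => `[< A m x >]) l.

Lemma measurable_set_code (A : nat -> set X) l i : (forall n, measurable (A n)) ->
  measurable (set_code A l @^-1` [set i]).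
Proof.
move=> mA; elim: l i => [|m l ih] i.
  have [->|i0] := eqVneq i 0%N.
    by rewrite [X in measurable X](_ : _ = setT)//; apply/seteqP; split.
  by rewrite [X in measurable X](_ : _ = set0)//; apply/seteqP; split=> // x /= /esym/eqP; rewrite (negbTE i0).
rewrite [X in measurable X](_ : _ = (A m `&` (if i == 0%N then setT else set0)) `|`
    (~` A m `&` (if i is j.+1 then set_code A l @^-1` [set j] else set0))).
  apply: measurableU; apply: measurableI => //; first by case: ifP.
    exact: measurableC.
  by case: i => // j; exact: ih.
apply/seteqP; split=> x /=; rewrite /set_code /=; case: asboolP => Ax.
- by move=> <-; left.
- by move=> <-; right.
- by case: i => [//|i] [[_ []]|[/(_ Ax)]].
- by case: i => [|i] [[/Ax]|[_]] // <-.
Qed.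

Lemma set_code_le (A : nat -> set X) l x : (set_code A l x <= size l)%N.
Proof. exact: find_size. Qed.

(** Approximate the first N level sets of c by sets A (m i), N being such that
    c < N off a small set: outside these sets and the N symmetric differences,
    the first A (m i) containing x is the one with i = c x. *)
Lemma set_code_approx (A : nat -> set X) : (forall n, measurable (A n)) ->
  (forall B, measurable B -> forall e : R, 0 < e -> exists n, pr (sdiff B (A n)) < e) ->
  forall (c : X -> nat), (forall i, measurable (c @^-1` [set i])) ->
  forall e : R, 0 < e -> exists l, pr [set x | set_code A l x <> c x] < e.
Proof.
move=> mA dA c mc e e0; have e2 : 0 < e / 2 by rewrite divr_gt0.
pose T n := [set x | (n <= c x)%N].
have mT n : measurable (T n).
  rewrite (_ : T n = \bigcup_(i in [set i | (n <= i)%N]) (c @^-1` [set i])).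
    exact: bigcup_measurable.
  apply/seteqP; split=> [x /= nc|x [i /= ni ci]]; first by exists (c x).
  by rewrite /T /= ci.
have [N hN] : exists n, pr (T n) < e / 2.
  apply: pr_cvg0 => //.
  - by move=> m n mn x /=; exact: leq_trans.
  - by apply/seteqP; split=> // x /(_ (c x).+1 I); rewrite /T /= ltnn.
have eN : 0 < e / 2 / N.+1%:R by rewrite divr_gt0.
have /choice[m hm] : forall i, exists m, pr (sdiff (c @^-1` [set i]) (A m)) < e / 2 / N.+1%:R.
  by move=> i; exact: dA.
exists (mkseq m N).
pose D i := sdiff (c @^-1` [set i]) (A (m i)).
have mD i : measurable (D i) by exact: measurable_sdiff.
pose U := \big[setU/set0]_(i < N) D i.
have mU : measurable U by apply: bigsetU_measurable.
have prUle : pr U <= e / 2.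
  rewrite -lee_fin -prE//; apply: le_trans (Boole_inequality _ _) _ => //.
  apply: (@le_trans _ _ (\sum_(i < N) (e / 2 / N.+1%:R)%:E)%E).
    apply: lee_sum => i _; rewrite -[leLHS]/(mu (D i)) prE ?lee_fin//.
    by rewrite ltW// /D; exact: hm.
  rewrite sumEFin lee_fin sumr_const card_ord -[_ *+ _]mulr_natr.
  by rewrite mulrAC ler_pdivrMr// ler_wpM2l ?(ltW e2)// ler_nat.
rewrite (splitr e); apply: le_lt_trans (ltr_leD hN prUle).
have -> : [set x | set_code A (mkseq m N) x <> c x] =
    ~` \bigcup_i ((set_code A (mkseq m N) @^-1` [set i]) `&` (c @^-1` [set i])).
  apply/seteqP; split=> x /=.
    by move=> h [i _ [/= h1 h2]]; apply: h; rewrite h1 h2.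
  by move=> h h'; apply: h; exists (c x).
apply: pr_leU => //.
  apply: measurableC; apply: bigcup_measurable => i _; apply: measurableI => //.
  exact: measurable_set_code.
move=> x /= h; apply: contrapT => /not_orP[/negP]; rewrite -ltnNge => cN nU.
apply: h; exists (c x) => //; split=> //=.
have nD i : (i < N)%N -> ~ D i x.
  by move=> iN Dx; apply: nU; rewrite /U -bigcup_mkord; exists i.
have hA : A (m (c x)) x.
  apply: contrapT => h; apply: (nD _ cN); left; split=> //.
have hB i : (i < c x)%N -> ~ A (m i) x.
  move=> ic h; apply: (nD i); first exact: ltn_trans cN.
  by right; split=> //= ci; rewrite ci ltnn in ic.
rewrite /set_code; set p := (fun _ => _); apply/eqP; rewrite eqn_leq; apply/andP; split.
  rewrite leqNgt; apply/negP => /(before_find 0%N).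
  by rewrite /p nth_mkseq// => /asboolPn.
rewrite leqNgt; apply/negP => lt.
have : has p (mkseq m N) by rewrite has_find size_mkseq; exact: ltn_trans cN.
move=> /(nth_find 0%N); rewrite {1}/p nth_mkseq; last exact: ltn_trans cN.
by move=> /asboolP; exact: hB.
Qed.

End probability_real.

(** * Integrals of real functions and the Radon-Nikodym change of variables *)

Section mean.
Context {R : realType} {d} {X : measurableType d} (mu : probability X R).
Implicit Types (f g h : X -> R) (A B : set X).

Definition L1 f := mu.-integrable setT (EFin \o f).
Definition mean f : R := \int[mu]_x f x.
Local Notation mf f := (measurable_fun setT f).

Lemma L1_mf f : L1 f -> mf f.
Proof. by move=> /measurable_int/measurable_EFinP. Qed.

Lemma L1_le f g : mf f -> (forall x, `|f x| <= g x) -> L1 g -> L1 f.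
Proof.
move=> mf fg; apply: le_integrable => //; first exact/measurable_EFinP.
by move=> x _ /=; rewrite lee_fin (le_trans (fg x))// ler_norm.
Qed.

Lemma L1D f g : L1 f -> L1 g -> L1 (fun x => f x + g x).
Proof. by move=> hf hg; exact: (integrableD measurableT hf hg). Qed.

Lemma L1Z (c : R) f : L1 f -> L1 (fun x => c * f x).
Proof. by move=> hf; exact: (integrableZl measurableT c hf). Qed.

Lemma L1B f g : L1 f -> L1 g -> L1 (fun x => f x - g x).
Proof. by move=> hf hg; exact: (integrableB measurableT hf hg). Qed.

Lemma L1_cst (c : R) : L1 (fun=> c).
Proof.
apply/integrableP; split; first exact/measurable_EFinP.
by rewrite integral_cst//= probability_setT mule1 ltry.
Qed.

Lemma L1_norm f : L1 f -> L1 (fun x => `|f x|).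
Proof. exact: integrable_norm. Qed.

Lemma L1_indic f A : measurable A -> L1 f -> L1 (fun x => f x * \1_A x).
Proof.
move=> mA hf; apply: L1_le (L1_norm hf).
  by apply: measurable_funM; [exact: L1_mf|exact: measurable_indic].
move=> x; rewrite normrM indicE; case: (_ \in _); rewrite ?normr1 ?mulr1//.
by rewrite normr0 mulr0.
Qed.

Lemma L1_ae f g : mf g -> {ae mu, forall x, f x = g x} -> L1 f -> L1 g.
Proof.
move=> mg fg /integrableP[mf fi]; apply/integrableP; split.
  exact/measurable_EFinP.
rewrite -(@ge0_ae_eq_integral _ _ _ mu setT (fun x => `|(f x)%:E|%E))//.
- exact: measurableT_comp.
- by do 2 apply: measurableT_comp => //.
- by move: fg; apply: filterS => x /= -> _.
Qed.

Lemma mean_ae f g : mf f -> mf g -> {ae mu, forall x, f x = g x} -> mean f = mean g.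
Proof.
move=> mf mg fg; congr fine; apply: ae_eq_integral => //; try exact/measurable_EFinP.
by move: fg; apply: filterS => x /= -> _.
Qed.

Lemma eq_mean f g : (forall x, f x = g x) -> mean f = mean g.
Proof. by move=> fg; congr fine; apply: eq_integral => x _; rewrite fg. Qed.

Lemma meanD f g : L1 f -> L1 g -> mean (fun x => f x + g x) = mean f + mean g.
Proof. exact: RintegralD. Qed.

Lemma meanB f g : L1 f -> L1 g -> mean (fun x => f x - g x) = mean f - mean g.
Proof. exact: RintegralB. Qed.

Lemma meanZ (c : R) f : L1 f -> mean (fun x => c * f x) = c * mean f.
Proof. exact: RintegralZl. Qed.

Lemma mean_le f g : L1 f -> L1 g -> (forall x, f x <= g x) -> mean f <= mean g.
Proof. by move=> hf hg fg; apply: le_Rintegral. Qed.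

Lemma mean_ge0 f : (forall x, 0 <= f x) -> 0 <= mean f.
Proof. by move=> f0; apply: Rintegral_ge0. Qed.

Lemma mean_le_ae f g : L1 f -> L1 g -> {ae mu, forall x, f x <= g x} -> mean f <= mean g.
Proof.
move=> hf hg fg; rewrite -subr_ge0 -meanB//.
have mfg : mf (fun x => g x - f x) by apply: measurable_funB; exact: L1_mf.
rewrite (@mean_ae _ (fun x => Num.max 0 (g x - f x)))//.
- by apply: mean_ge0 => x; rewrite le_max lexx.
- exact: measurable_maxr.
- by move: fg; apply: filterS => x; rewrite -subr_ge0 => /max_r ->.
Qed.

Lemma mean_cst (c : R) : mean (fun=> c) = c.
Proof. by rewrite /mean Rintegral_cst// -[X in _ * fine X]/(mu setT) probability_setT mulr1. Qed.

Lemma mean_norm f : L1 f -> `|mean f| <= mean (fun x => `|f x|).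
Proof. exact: le_normr_Rintegral. Qed.

Lemma mean_indic A : measurable A -> mean (\1_A : X -> R) = pr mu A.
Proof. by move=> mA; rewrite /mean /Rintegral integral_indic// setIT. Qed.

(** Absolute continuity of the integral. *)
Lemma mean_small f (e : R) : L1 f -> 0 < e -> exists2 dl : R, 0 < dl &
  forall A, measurable A -> pr mu A < dl -> mean (fun x => `|f x| * \1_A x) < e.
Proof.
move=> hf e0; have [dl [dl0 h]] := integral_normr_continuous hf e0.
exists dl => // A mA Ad; have : (mu A < dl%:E)%E by rewrite prE// lte_fin.
move/(h A mA).
congr (_ < e); rewrite Rintegral_mkcond /mean; apply: eq_Rintegral => x _.
by rewrite patchE indicE; case: ifPn; rewrite ?mulr1 ?mulr0.
Qed.

Lemma mean_tail f (A : nat -> set X) (e : R) : L1 f -> (forall n, measurable (A n)) ->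
  (forall m n, (m <= n)%N -> A n `<=` A m) -> \bigcap_n A n = set0 ->
  0 < e -> exists n, mean (fun x => `|f x| * \1_(A n) x) < e.
Proof.
move=> hf mA hA A0 e0; have [dl dl0 h] := mean_small hf e0.
by have [n hn] := pr_cvg0 mu mA hA A0 dl0; exists n; exact: h.
Qed.

End mean.

Section jacobian.
Context {R : realType} {G : topologicalGroupType} {d} {X : measurableType d}
  {mu : probability X R} (a : nonsingular_action G mu).
Local Notation mf f := (measurable_fun setT f).
Local Notation chi := (radon_nikodym_cocycle a).

Lemma translate_dominated g : translate a g `<< mu.
Proof.
apply/null_content_dominatesP => A mA muA0.
by apply/(act_null a g^-1%g mA).
Qed.

Lemma L1_radon_nikodym g : L1 mu (chi g).
Proof.
have h := @Radon_Nikodym_integrable _ _ _ (charge_of_finite_measure (translate a g)) mu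
   (translate_dominated g).
apply: eq_integrable h => // x _ /=.
by rewrite /radon_nikodym_cocycle fineK// Radon_Nikodym_fin_num//; exact: translate_dominated.
Qed.

(** The square root that occurs in the Koopman representation. *)
Definition jac (g : G) (x : X) : R := Num.sqrt (chi g x).

Lemma mf_jac g : mf (jac g).
Proof.
exact: (measurableT_comp (continuous_measurable_fun (@sqrt_continuous R)) (L1_mf (L1_radon_nikodym g))).
Qed.

Lemma jac_ge0 g x : 0 <= jac g x. Proof. exact: sqrtr_ge0. Qed.

Let S g := Radon_Nikodym_SigmaFinite.f (translate a g) mu.

Lemma radon_nikodym_sigma_finite g : {ae mu, forall x, (chi g x)%:E = S g x}.
Proof.
have := ae_eq_Radon_Nikodym_SigmaFinite (translate_dominated g) measurableT.
apply: filterS => x /(_ I) h; rewrite /S h /radon_nikodym_cocycle fineK//.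
by apply: Radon_Nikodym_fin_num; exact: translate_dominated.
Qed.

Lemma jac2 g : {ae mu, forall x, jac g x ^+ 2 = chi g x}.
Proof.
have := radon_nikodym_sigma_finite g; apply: filterS => x h; rewrite /jac sqr_sqrtr// -lee_fin h.
exact: Radon_Nikodym_SigmaFinite.f_ge0 (translate_dominated g) _.
Qed.

Lemma mf_act g (f : X -> R) : mf f -> mf (fun x => f (a g x)).
Proof. by move=> h; exact: (measurableT_comp h (measurable_act1 a g)). Qed.

Lemma L1_translate g (f : X -> R) : mf f -> L1 mu (fun x => f (a g^-1%g x)) ->
  (translate a g).-integrable setT (EFin \o f).
Proof.
move=> mf h; have mf' : measurable_fun setT (EFin \o f) by exact/measurable_EFinP.
exact: (integrable_pushforward (measurable_act1 a g^-1%g) mf' (D := setT) h measurableT).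
Qed.

(** Change of variables for the measure translated by g, whose density is the
    Radon-Nikodym cocycle. *)
Lemma mean_jac2 g (f : X -> R) : mf f -> L1 mu (fun x => f (a g^-1%g x)) ->
  L1 mu (fun x => f x * jac g x ^+ 2) /\
  mean mu (fun x => f x * jac g x ^+ 2) = mean mu (fun x => f (a g^-1%g x)).
Proof.
move=> mf hf.
have mj : measurable_fun setT (fun x => f x * jac g x ^+ 2).
  by apply: measurable_funM => //; apply: measurable_funX; exact: mf_jac.
have nf := L1_translate mf hf.
have i1 : L1 mu (fun x => `|f x| * fine (S g x)).
  have := Radon_Nikodym_SigmaFinite.integrableM (translate_dominated g)
    (f := fun x => `|f x|%:E) (fun x => normr_ge0 (f x)) measurableT (integrable_norm nf).
  apply: eq_integrable => // x _ /=; rewrite EFinM fineK//.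
  exact: Radon_Nikodym_SigmaFinite.f_fin_num (translate_dominated g) _.
have i2 : L1 mu (fun x => f x * jac g x ^+ 2).
  have : L1 mu (fun x => `|f x * jac g x ^+ 2|).
    apply: L1_ae i1; first exact: measurableT_comp mj.
    have := jac2 g; apply: filterS2 (radon_nikodym_sigma_finite g) => x h1 h2.
    by rewrite normrM (ger0_norm (sqr_ge0 _)) h2 -h1.
  by apply: L1_le mj _.
split=> //; rewrite /mean /Rintegral; congr fine.
have mf' : measurable_fun setT (EFin \o f) by exact/measurable_EFinP.
have e1 := integral_pushforward (measurable_act1 a g^-1%g) mf' (D := setT) hf measurableT.
transitivity (\int[translate a g]_x (f x)%:E)%E; last exact: e1.
have <- := Radon_Nikodym_change_of_variables (translate_dominated g) measurableT nf.
apply: ae_eq_integral => //.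
- exact/measurable_EFinP.
- apply: emeasurable_funM; first exact/measurable_EFinP.
  have hR := @Radon_Nikodym_integrable _ _ _ (charge_of_finite_measure (translate a g)) mu
    (translate_dominated g).
  exact: measurable_int hR.
- have := jac2 g; apply: filterS => x h _; rewrite EFinM h /radon_nikodym_cocycle.
  by rewrite fineK// Radon_Nikodym_fin_num//; exact: translate_dominated.
Qed.

End jacobian.

(** * Strong continuity of the action *)

Lemma near_forall_lt (T : Type) (F : set_system T) (FF : Filter F) (P : nat -> T -> Prop) n :
  (forall i, \forall x \near F, P i x) ->
  \forall x \near F, forall i, (i < n)%N -> P i x.
Proof.
move=> h; elim: n => [|n ih]; first by near=> x.
apply: filterS2 ih (h n) => x hx hn i.
by rewrite ltnS leq_eqVlt => /predU1P[->|/hx].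
Unshelve. all: by end_near. Qed.

Lemma indic_sdiff {R : realType} {d} {X : measurableType d} (A B : set X) y :
  `|\1_B y - \1_A y| = \1_(sdiff B A) y :> R.
Proof.
rewrite !indicE; have [Ay|Ay] := pselect (A y); have [By|By] := pselect (B y).
- by rewrite (mem_set Ay) (mem_set By) memNset ?subrr ?normr0//; rewrite /sdiff /=; tauto.
- by rewrite (mem_set Ay) (memNset By) mem_set ?sub0r ?normrN ?normr1//; right.
- by rewrite (mem_set By) (memNset Ay) mem_set ?subr0 ?normr1//; left.
- by rewrite (memNset Ay) (memNset By) memNset ?subrr ?normr0//; rewrite /sdiff /=; tauto.
Qed.

Lemma indic_preimage {R : realType} (S T : Type) (f : S -> T) (B : set T) y :
  \1_(f @^-1` B) y = \1_B (f y) :> R.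
Proof.
by rewrite !indicE.
Qed.

Section continuity.
Context {R : realType} {G : topologicalGroupType} {d} {X : measurableType d}
  {mu : probability X R} (a : nonsingular_action G mu).
Local Notation mf f := (measurable_fun setT f).
Local Notation mean := (mean mu).
Local Notation L1 := (L1 mu).
Local Notation pr := (pr mu).

Lemma measurable_preact g (B : set X) : measurable B -> measurable (a g @^-1` B).
Proof.
by move=> mB; rewrite -[X in measurable X]setTI; exact: (measurable_act1 a g).
Qed.

Lemma act_inv g x : a g^-1%g (a g x) = x.
Proof. by rewrite -actM mulVg act1. Qed.

Lemma act_invr g x : a g (a g^-1%g x) = x.
Proof. by rewrite -actM mulgV act1. Qed.

Lemma pr_le_ae (A B : set X) : measurable A -> measurable B ->
  {ae mu, forall x, A x -> B x} -> pr A <= pr B.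
Proof.
move=> mA mB AB; rewrite -!mean_indic//; apply: mean_le_ae.
- exact: integrable_indic.
- exact: integrable_indic.
move: AB; apply: filterS => x AB; rewrite !indicE ler_nat.
by have [/set_mem/AB/mem_set ->|] := boolP (x \in A).
Qed.

Lemma mf_mean_param (f : borel G * X -> R) : measurable_fun setT f ->
  (forall z, 0 <= f z) -> measurable_fun [set: borel G] (fun k => mean (fun x => f (k, x))).
Proof.
move=> mf f0.
have h := @measurable_fun_fubini_tonelli_F _ _ (borel G) X R mu (EFin \o f)
  (proj2 (measurable_EFinP _ _) mf) (fun z => f0 z).
exact: (measurableT_comp (fine_measurable measurableT) h).
Qed.

(** The mass that the image under [k] of the measure with density [F] gives to
    [B]. *)
Definition nu (F : X -> R) k (B : set X) : R := mean (fun x => F x * \1_B (a k x)).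

(** The image of mu under the inverse of k has an integrable density, whence it
    is absolutely continuous in the epsilon-delta sense. *)
Lemma translate_small k (e : R) : 0 < e -> exists2 dl : R, 0 < dl &
  forall B, measurable B -> pr B < dl -> pr (a k @^-1` B) < e.
Proof.
move=> e0.
have [h _] := @mean_jac2 _ _ _ _ mu a k^-1%g (fun=> 1) (measurable_cst _) (L1_cst _ _).
have [dl dl0 hd] := mean_small h e0; exists dl => // B mB Bd.
have := hd B mB Bd; congr (_ < e).
have mI : mf (\1_B : X -> R) by exact: measurable_indic.
have L1I : L1 (fun x => \1_B (a k^-1^-1%g x)).
  have := integrable_indic mu (measurable_preact k mB).
  by apply: eq_integrable => // x _; rewrite /= invgK.
have [_] := mean_jac2 mI L1I.
rewrite invgK => e1; rewrite -mean_indic; last exact: measurable_preact.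
rewrite -[RHS]e1; apply: eq_mean => x.
by rewrite mul1r ger0_norm ?sqr_ge0// mulrC.
Qed.

Section fixed_function.
Variables (F : X -> R) (LF : L1 F) (F0 : forall x, 0 <= F x).

Lemma L1_nu k B : measurable B -> L1 (fun x => F x * \1_B (a k x)).
Proof. by move=> mB; exact: (L1_indic (measurable_preact k mB) LF). Qed.

Lemma nu_small k (e : R) : 0 < e -> exists2 dl : R, 0 < dl &
  forall B, measurable B -> pr B < dl -> nu F k B < e.
Proof.
move=> e0; have [d1 d10 h1] := mean_small LF e0.
have [d2 d20 h2] := translate_small k d10; exists d2 => // B mB /(h2 _ mB).
move=> /(h1 _ (measurable_preact k mB)); congr (_ < e).
by apply: eq_mean => x; rewrite ger0_norm.
Qed.

Lemma nu_sdiff k A B : measurable A -> measurable B ->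
  `|nu F k B - nu F k A| <= nu F k (sdiff B A).
Proof.
move=> mA mB; rewrite /nu -meanB ?L1_nu//.
apply: le_trans (mean_norm _) _; first by apply: L1B; exact: L1_nu.
apply: mean_le; first by apply: L1_norm; apply: L1B; exact: L1_nu.
  by apply: L1_nu; exact: measurable_sdiff.
by move=> x; rewrite -mulrBr normrM ger0_norm// indic_sdiff.
Qed.

(** Both set functions are continuous for the pseudometric of symmetric
    differences, so it suffices to compare them on a dense sequence. *)
Lemma nu_close_dense (A : nat -> set X) h k (e : R) :
  (forall n, measurable (A n)) ->
  (forall B, measurable B -> forall e : R, 0 < e -> exists n, pr (sdiff B (A n)) < e) ->
  (forall j, `|nu F k (A j) - nu F h (A j)| <= e) ->
  forall B, measurable B -> `|nu F k B - nu F h B| <= e.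
Proof.
move=> mA dA hA B mB; apply/ler_addgt0Pr => z z0.
have z2 : 0 < z / 2 by rewrite divr_gt0.
have [d1 d10 h1] := nu_small k z2; have [d2 d20 h2] := nu_small h z2.
have [j] := dA B mB (Num.min d1 d2) (ltac:(by rewrite lt_min d10)).
rewrite lt_min => /andP[j1 j2].
have ms : measurable (sdiff B (A j)) by exact: measurable_sdiff.
have n1 := le_lt_trans (nu_sdiff k (mA j) mB) (h1 _ ms j1).
have n2 := le_lt_trans (nu_sdiff h (mA j) mB) (h2 _ ms j2).
move: n1 n2 (hA j); rewrite !ltr_norml !ler_norml.
move: (nu F k B) (nu F k (A j)) (nu F h B) (nu F h (A j)) => p q r s.
move=> /andP[? ?] /andP[? ?] /andP[? ?]; apply/andP; split; lra.
Qed.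

(** A countable family of step functions: [p = ((m, N), l)] codes the one with
    values i / (m + 1), i at most N, on the pieces of the partition coded by
    [l]. *)
Definition step_approx (A : nat -> set X) (p : nat * nat * seq nat) (y : X) : R :=
  p.1.1.+1%:R^-1 * (minn p.1.2 (set_code A p.2 y))%:R.

Lemma measurable_nat_fun (c : X -> nat) (q : nat -> R) :
  (forall i, measurable (c @^-1` [set i])) -> mf (q \o c).
Proof.
move=> mc _ Y mY; rewrite setTI.
rewrite (_ : _ @^-1` _ = \bigcup_(i in [set i | Y (q i)]) (c @^-1` [set i])).
  exact: bigcup_measurable.
apply/seteqP; split=> [x Yx|x [i /= Yi ci]]; first by exists (c x).
by rewrite /= ci.
Qed.

Lemma L1_step A p : (forall n, measurable (A n)) -> L1 (step_approx A p).
Proof.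
move=> mA; have ms : mf (step_approx A p).
  apply: (@measurable_nat_fun (set_code A p.2) (fun i => p.1.1.+1%:R^-1 * (minn p.1.2 i)%:R)).
  by move=> i; exact: measurable_set_code.
apply: L1_le ms _ (L1_cst mu (p.1.2%:R)) => x; rewrite /step_approx.
rewrite ger0_norm; last by rewrite mulr_ge0// invr_ge0.
rewrite -[leRHS]mul1r ler_pM ?invr_ge0//; last by rewrite ler_nat geq_minl.
by rewrite invf_le1// ler1n.
Qed.

(** The density of [nu F k]. *)
Definition dens k (y : X) : R := F (a k^-1%g y) * jac a k^-1%g y ^+ 2.

Lemma dens_ge0 k y : 0 <= dens k y.
Proof. by rewrite mulr_ge0// sqr_ge0. Qed.

Lemma L1_dens k : L1 (dens k).
Proof.
have h : L1 (fun x => F (a k^-1%g (a k^-1^-1%g x))).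
  by apply: eq_integrable LF => // x _; rewrite /= invgK act_inv.
by have [] := mean_jac2 (mf_act a k^-1%g (L1_mf LF)) h.
Qed.

Lemma nu_dens k B : measurable B -> nu F k B = mean (fun y => dens k y * \1_B y).
Proof.
move=> mB; pose f y := F (a k^-1%g y) * \1_B y.
have mff : mf f.
  apply: measurable_funM; first exact: mf_act (L1_mf LF).
  exact: measurable_indic.
have h : L1 (fun x => f (a k^-1^-1%g x)).
  have := L1_nu k mB; apply: eq_integrable => // x _.
  by rewrite /= /f invgK act_inv.
have [_ e] := mean_jac2 mff h.
transitivity (mean (fun x => f (a k^-1^-1%g x))).
  by apply: eq_mean => x; rewrite /f invgK act_inv.
by rewrite -e; apply: eq_mean => x; rewrite /f /dens mulrAC.
Qed.

(** Round the density down to multiples of 1/(m + 1), cut it off at height N,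
    and replace its level sets by those of a coded partition; the three errors
    are controlled by m, by integrability, and by [set_code_approx]. *)
Lemma step_approx_dense (A : nat -> set X) k (e : R) :
  (forall n, measurable (A n)) ->
  (forall B, measurable B -> forall e : R, 0 < e -> exists n, pr (sdiff B (A n)) < e) ->
  0 < e -> exists p, mean (fun y => `|dens k y - step_approx A p y|) <= e.
Proof.
move=> mA dA e0; have e3 : 0 < e / 3 by rewrite divr_gt0.
have mdk := L1_mf (L1_dens k).
have [m _ /(_ m (leqnn m)) /= hm] := near_infty_natSinv_lt (PosNum e3).
pose dl : R := m.+1%:R^-1.
have dl0 : 0 < dl by rewrite invr_gt0.
pose T n := [set y | n%:R * dl <= dens k y].
have mT n : measurable (T n).
  by rewrite -[X in measurable X]setTI; apply: measurable_fun_le; [exact: measurableT|exact: measurable_cst|].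
have [N hN] : exists n, mean (fun y => `|dens k y| * \1_(T n) y) < e / 3.
  apply: mean_tail (L1_dens k) mT _ _ e3.
    move=> i j ij y; apply: le_trans; rewrite ler_wpM2r ?ler_nat//; exact: ltW.
  apply/seteqP; split=> // y /(_ (Num.truncn (dens k y / dl)).+1 I) /=.
  by rewrite /T /= leNgt -ltr_pdivrMr// Num.Theory.truncnS_gt.
pose c y := Num.truncn (dens k y / dl).
have c_le y : (c y)%:R * dl <= dens k y < (c y).+1%:R * dl.
  rewrite -ler_pdivlMr// -ltr_pdivrMr//; apply: Num.Theory.truncn_itv.
  by rewrite divr_ge0 ?dens_ge0// ltW.
have mc i : measurable (c @^-1` [set i]).
  rewrite (_ : _ @^-1` _ = T i `\` T i.+1); first exact: measurableD.
  apply/seteqP; split=> y /=; rewrite /T /=.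
    move=> <-; have /andP[c1 c2] := c_le y; split=> //.
    by apply/negP; rewrite -ltNge.
  move=> [y1 /negP]; rewrite -ltNge => y2; apply: Num.Theory.truncn_def.
  by rewrite ler_pdivlMr// y1 ltr_pdivrMr.
(* On the set where the partitions disagree, the error is at most N * dl. *)
pose eta : R := e / 3 / (N%:R * dl + 1).
have eta0 : 0 < eta by rewrite divr_gt0// ltr_wpDl// mulr_ge0// ltW.
have [l hl] := set_code_approx mA dA mc eta0.
pose D := [set y | set_code A l y <> c y].
have mD : measurable D.
  rewrite (_ : D = ~` \bigcup_i ((set_code A l @^-1` [set i]) `&` (c @^-1` [set i]))).
    apply: measurableC; apply: bigcup_measurable => i _; apply: measurableI => //.
    exact: measurable_set_code.
  apply/seteqP; split=> x /=.
    by move=> h [i _ [/= h1 h2]]; apply: h; rewrite h1 h2.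
  by move=> h h'; apply: h; exists (c x).
exists ((m, N), l).
have L1I : L1 (\1_D : X -> R) by exact: integrable_indic.
have L1T : L1 (fun y => `|dens k y| * \1_(T N) y).
  by apply: L1_indic => //; apply: L1_norm; exact: L1_dens.
apply: (@le_trans _ _ (mean (fun y => dl + (`|dens k y| * \1_(T N) y + (N%:R * dl) * \1_D y)))).
  apply: mean_le.
  - by apply: L1_norm; apply: L1B; [exact: L1_dens|exact: L1_step].
  - by apply: L1D; [exact: L1_cst|apply: L1D => //; exact: L1Z].
  move=> y; rewrite /step_approx /= -/dl.
  have key : `|dens k y - dl * (minn N (c y))%:R| <= dl + `|dens k y| * \1_(T N) y.
    have /andP[c1 c2] := c_le y; rewrite indicE.
    have [yT|yT] := boolP (y \in T N).
      have Ny : N%:R * dl <= dens k y by exact: set_mem yT.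
      rewrite mulr1 (ger0_norm (dens_ge0 k y)) ler_norml; apply/andP; split.
        have : dl * (minn N (c y))%:R <= dens k y.
          rewrite mulrC; apply: le_trans c1; rewrite ler_wpM2r ?ler_nat ?geq_minr//.
          exact: ltW.
        have := dens_ge0 k y; lra.
      have : 0 <= dl * (minn N (c y))%:R by rewrite mulr_ge0// ltW.
      lra.
    have Ny : dens k y < N%:R * dl.
      by rewrite ltNge; apply: contra yT => h; apply/mem_set.
    rewrite (minn_idPr _) ?mulr0 ?addr0.
      rewrite ger0_norm; last by rewrite subr_ge0 mulrC.
      move: c2; rewrite -natr1 mulrDl mul1r mulrC; lra.
    have := le_lt_trans c1 Ny; rewrite ltr_pM2r// ltr_nat; exact: ltnW.
  rewrite addrA; have [yD|yD] := pselect (D y).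
    rewrite [\1_D y]indicE mem_set// mulr1.
    apply: (@le_trans _ _ (`|dens k y - dl * (minn N (c y))%:R| +
       `|dl * (minn N (c y))%:R - dl * (minn N (set_code A l y))%:R|)).
      by rewrite -[leLHS]/(`|_|) -(subrKA (dl * (minn N (c y))%:R)) ler_normD.
    apply: lerD => //.
    have b n : 0 <= dl * (minn N n)%:R <= N%:R * dl.
      rewrite mulr_ge0 ?(ltW dl0)//= mulrC ler_wpM2r ?ler_nat ?geq_minl//; exact: ltW.
    have /andP[? ?] := b (c y); have /andP[? ?] := b (set_code A l y).
    rewrite ler_norml; apply/andP; split; lra.
  rewrite [\1_D y]indicE memNset// mulr0 addr0.
  by have -> : set_code A l y = c y by apply: contrapT.
rewrite (meanD (L1_cst mu dl) (L1D L1T (L1Z (N%:R * dl) L1I))).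
rewrite (meanD L1T (L1Z (N%:R * dl) L1I)) (meanZ _ L1I) mean_cst mean_indic//.
have Nd0 : 0 <= N%:R * dl by rewrite mulr_ge0// ltW.
have h3 : N%:R * dl * pr D <= e / 3.
  apply: (@le_trans _ _ (N%:R * dl * eta)); first by rewrite ler_wpM2l// ltW.
  rewrite /eta mulrA ler_pdivrMr ?ltr_wpDl// mulrC ler_wpM2l ?lerDl//; exact: ltW.
by move: h3 hN hm; rewrite -/dl; lra.
Qed.

Hypotheses (hG : lcsc G) (hX : standard_borel R X).

(** By Fubini's theorem, k |-> nu F k B is a Borel function. *)
Lemma borel_nu_close B (c e : R) : measurable B ->
  <<s @open G >> [set k | `|nu F k B - c| <= e].
Proof.
move=> mB.
have mF : measurable_fun [set: borel G * X] (fun z => F z.2 * \1_B (a z.1 z.2)).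
  apply: measurable_funM; first exact: (measurableT_comp (L1_mf LF) measurable_snd).
  have mI : mf (\1_B : X -> R) by exact: measurable_indic.
  exact: (measurableT_comp mI (measurable_act a)).
have F0' (z : borel G * X) : 0 <= F z.2 * \1_B (a z.1 z.2) by rewrite mulr_ge0.
have := mf_mean_param mF F0' => h.
have hh : measurable_fun [set: borel G] (fun k => `|nu F k B - c|).
  by apply: (measurableT_comp (@normr_measurable R setT)); exact: measurable_funB.
have -> : [set k | `|nu F k B - c| <= e] =
    [set: borel G] `&` (fun k => `|nu F k B - c|) @^-1` `]-oo, e].
  by rewrite setTI; apply/seteqP; split=> k /=; rewrite in_itv.
exact: hh.
Qed.

(** The sets of k for which the density of [nu F k] is close to a given step
    function are Borel and cover [G]; here only countably many sets A j are
    tested. If k and h lie in the same one, then [nu F k] and [nu F h] are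
    uniformly close, hence so are their translates, and g = h^-1 k is close to
    1. As every g near 1 arises in this way, the action is continuous on L^1.
    *)
Theorem nu_continuous (e : R) : 0 < e -> \forall g \near (1 : G)%g,
  forall B, measurable B -> `|nu F g B - nu F 1%g B| <= e.
Proof.
move=> e0; have e2 : 0 < e / 2 by rewrite divr_gt0.
have [A mA dA] := dense_sequence mu hX.
(* The density of nu F k is within e / 2 of the step function p, tested on A j.
   *)
pose P p := [set k | forall j, `|nu F k (A j) - mean (fun y => step_approx A p y * \1_(A j) y)| <= e / 2].
pose E n : set G := if unpickle n is Some p then P p else set0.
have [||n] := @pettis G hG E.
- move=> n; rewrite /E; case: unpickle => [p|]; last exact: (@measurable0 _ (borel G)).
  rewrite (_ : P p = \bigcap_j [set k | `|nu F k (A j) -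
     mean (fun y => step_approx A p y * \1_(A j) y)| <= e / 2]); last first.
    by apply/seteqP; split=> [k hk j _|k hk j]; [exact: hk|exact: hk].
  by apply: (@bigcap_measurable _ (borel G)) => // j _; exact: borel_nu_close.
- move=> k; have [p hp] := step_approx_dense k mA dA e2.
  exists (pickle p); rewrite /E pickleK => j; rewrite nu_dens// -meanB; last 2 first.
  + by apply: L1_indic => //; exact: L1_dens.
  + by apply: L1_indic => //; exact: L1_step.
  have Ld : L1 (fun y => dens k y - step_approx A p y) by apply: L1B; [exact: L1_dens|exact: L1_step].
  apply: le_trans (mean_norm _) _.
    by apply: L1B; apply: L1_indic => //; [exact: L1_dens|exact: L1_step].
  apply: le_trans hp; apply: mean_le; last 1 first.
  + move=> y; rewrite -mulrBl normrM ler_piMr// indicE.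
    by case: (_ \in _); rewrite ?normr1 ?normr0.
  + by apply: L1_norm; apply: L1B; apply: L1_indic => //; [exact: L1_dens|exact: L1_step].
  + exact: L1_norm.
apply: filterS => g [h [k [Eh Ek ->]]] B mB.
have hj j : `|nu F k (A j) - nu F h (A j)| <= e.
  move: Eh Ek; rewrite /E; case: unpickle => [p|[]] /(_ j) hh /(_ j).
  move: hh; move: (nu F k _) (nu F h _) (mean _) => u v w.
  rewrite !ler_norml => /andP[? ?] /andP[? ?]; apply/andP; split; lra.
have := nu_close_dense mA dA hj (measurable_preact h^-1%g mB).
congr (`|_ - _| <= e); apply: eq_mean => x; rewrite indic_preimage.
  by rewrite -actM.
by rewrite act_inv act1.
Qed.

End fixed_function.
End continuity.

(** * Continuity of the cocycle in measure *)

Lemma measurable_fun_of_open {R : realType} {d} {X : measurableType d} (f : X -> R) :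
  (forall U, open U -> measurable (f @^-1` U)) -> measurable_fun setT f.
Proof.
move=> h; apply: (measurability _ (RGenOpens.measurableE R)) => _ [_ [x [y ->]] <-].
by rewrite setTI; apply: h; exact: interval_open.
Qed.

Section lcsc_topology.
Context {H : topologicalGroupType} (hH : lcsc H).

Lemma open_borel (U : set H) : open U -> measurable (U : set (borel H)).
Proof. exact: sub_gen_smallest. Qed.

(** Finite unions of the relatively compact members of a countable base. *)
Lemma compact_exhaustion : exists K : nat -> set H,
  [/\ forall n, compact (K n) /\ closed (K n), forall m n, (m <= n)%N -> K m `<=` K n &
      forall C, compact C -> exists n, C `<=` K n].
Proof.
have lc := hH; case: lc => hT lc sc.
have [b ob nb] := second_countable_enum sc.
pose c i := if pselect (compact (closure (b i))) then closure (b i) else set0.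
have cc i : compact (c i) by rewrite /c; case: pselect => h /=; [exact: h|exact: compact0].
pose K n := \big[setU/set0]_(i < n) c i.
have Kmono m n : (m <= n)%N -> K m `<=` K n.
  by move=> mn x; rewrite /K -!bigcup_mkord => -[i im ci]; exists i => //; exact: leq_trans mn.
have cK n : compact (K n) by apply: (@bigsetU_compact H 'I_n (fun i => c i)) => i _; exact: cc.
exists K; split=> // [n|C]; first by split; [exact: cK|exact: compact_closed].
move=> /compact_near_coveringP/(_ nat \oo (fun n x => K n x)) h.
have [|N _ hN] := h _.
  move=> x Cx; have [D] := lc x I; rewrite /within /= => Dx [cD clD].
  have nD : nbhs x D by apply: filterS Dx => y; apply.
  have [i bi biD] := nb x D nD.
  have ci : compact (closure (b i)).
    apply: subclosed_compact cD _; first exact: closed_closure.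
    by rewrite [D](closure_id _).1//; exact: closureS.
  exists (b i, [set n | (i < n)%N]) => /=; last first.
    move=> [y n] [/= biy lt]; rewrite /K -bigcup_mkord; exists i => //.
    by rewrite /c; case: pselect => h' //=; exact: subset_closure.
  by split; [exact: open_nbhs_nbhs|exists i.+1].
by exists N; exact: hN N (leqnn N).
Qed.

Lemma measurable_pair_open {d} {X : measurableType d} (s t : X -> borel H) (O : set (H * H)) :
  measurable_fun setT s -> measurable_fun setT t -> open O ->
  measurable [set y | O (s y, t y)].
Proof.
move=> ms mt oO; have [_ _ sc] := hH.
have [b ob nb] := second_countable_enum sc.
pose I : set (nat * nat) := [set p | b p.1 `*` b p.2 `<=` O].
have -> : [set y | O (s y, t y)] =
    \bigcup_i \bigcup_(j in [set j | I (i, j)]) ((s @^-1` b i) `&` (t @^-1` b j)).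
  apply/seteqP; split=> y /=; last first.
    by move=> [i _ [j /= ij [si tj]]]; exact: (ij (s y, t y)).
  move=> Oy; have : nbhs (s y, t y) O by exact: open_nbhs_nbhs.
  move=> [[P Q] [/= Py Qy] PQ].
  have [i si iP] := nb _ _ Py; have [j tj jQ] := nb _ _ Qy.
  exists i => //; exists j => //= -[u v] [/= bu bv].
  by apply: PQ; split; [exact: iP|exact: jQ].
apply: bigcup_measurable => i _; apply: bigcup_measurable => j _.
apply: measurableI.
- by rewrite -[X in measurable X]setTI; apply: ms => //; exact: open_borel.
- by rewrite -[X in measurable X]setTI; apply: mt => //; exact: open_borel.
Qed.

Lemma measurable_pair_continuous {R : realType} {d} {X : measurableType d}
    (s t : X -> borel H) (Q : H * H -> R) :
  measurable_fun setT s -> measurable_fun setT t -> continuous Q ->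
  measurable_fun setT (fun y => Q (s y, t y)).
Proof.
move=> ms mt cQ; apply: measurable_fun_of_open => U oU.
apply: (measurable_pair_open ms mt (O := Q @^-1` U)).
by apply: open_comp => // x _; exact: cQ.
Qed.

(** D (s, s * t) is jointly continuous and vanishes for t = 1, so each s has a
    neighbourhood on which it is small for t near 1; compactness makes t
    uniform. *)
Lemma compact_translate_small {R : realType} (D : H * H -> R) (K : set H) (e : R) :
  continuous D -> (forall s, D (s, s) = 0) -> compact K -> 0 < e ->
  \forall t \near (1 : H)%g, forall s, K s -> D (s, (s * t)%g) < e.
Proof.
move=> cD D0 cK e0.
move/compact_near_coveringP : cK => /(_ H (nbhs (1 : H)%g) (fun t s => D (s, (s * t)%g) < e)).
apply => s Ks.
have c : (fun z : H * H => D (z.1, (z.1 * z.2)%g)) @ (s, (1 : H)%g) --> D (s, (s * 1)%g).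
  apply: (@cvg_comp _ _ _ (fun z : H * H => (z.1, (z.1 * z.2)%g)) D _ (nbhs (s, (s * 1)%g))).
    apply: cvg_pair; first exact: cvg_fst.
    by apply: cvg_mulg; [exact: cvg_fst|exact: cvg_snd].
  exact: cD.
move: c; rewrite mulg1 D0 => /cvgrPdist_lt/(_ _ e0); apply: filterS => z /=.
by rewrite sub0r normrN => /(le_lt_trans (ler_norm _)).
Qed.

End lcsc_topology.

(** A countable cover by sets that are small for the left uniformity. *)
Lemma group_continuous_cover {H : topologicalGroupType} (U : set H) :
  @second_countable H -> nbhs 1%g U ->
  exists Y : nat -> set H, [/\ forall n, open (Y n), forall y, exists n, Y n y &
    forall n y y', Y n y -> Y n y' -> U (y^-1 * y')%g].
Proof.
move=> sc U1; have [b ob nb] := second_countable_enum sc.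
have [V V1 VU] := nbhs1_divl U1.
pose good n := forall y y', b n y -> b n y' -> U (y^-1 * y')%g.
exists (fun n => if pselect (good n) then b n else set0); split=> [n|y|n y y'].
- by case: pselect => h /=; [exact: ob|exact: open0].
- have : nbhs y [set z | V (y^-1 * z)%g].
    by apply: (@mulgl_continuous _ (y^-1)%g y); rewrite mulVg.
  move=> /nb[n bny bnV]; exists n; case: pselect => //= -[] z z' /bnV Vz /bnV Vz'.
  by have := VU _ _ Vz Vz'; rewrite invgM invgK -mulgA mulVKg.
- by case: pselect => //= gn; exact: gn.
Qed.

Section cocycle_continuity.
Context {R : realType} {G H : topologicalGroupType} {d} {X : measurableType d}
  {mu : probability X R} (a : nonsingular_action G mu) (omega : G -> X -> H).
Hypotheses (hG : lcsc G) (hH : lcsc H) (hX : standard_borel R X)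
  (homega : cocycle a omega).
Local Notation mf f := (measurable_fun setT f).
Local Notation mean := (mean mu).
Local Notation L1 := (L1 mu).
Local Notation pr := (pr mu).

Lemma preact1 (B : set X) : a 1%g @^-1` B = B.
Proof. by apply/seteqP; split=> x /=; rewrite act1. Qed.

Lemma measurable_omega g : measurable_fun setT (omega g : X -> borel H).
Proof.
have mg : measurable_fun [set: X] (fun x => (g, x) : borel G * X).
  exact: pair1_measurable.
exact: (measurableT_comp (proj1 homega) mg).
Qed.

Lemma measurable_omega_open g (U : set H) : open U -> measurable [set x | U (omega g x)].
Proof.
move=> oU; rewrite -[X in measurable X]setTI.
by apply: (measurable_omega g) => //; exact: open_borel.
Qed.

Lemma omega1 : {ae mu, forall x, omega 1%g x = 1%g}.
Proof.
have := proj2 homega 1%g 1%g; apply: filterS => x; rewrite mulg1 act1.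
by move/(congr1 (fun z => (omega 1%g x)^-1 * z)%g); rewrite mulVg mulKg.
Qed.

Lemma omegaV g : {ae mu, forall x, omega g^-1%g (a g x) = (omega g x)^-1%g}.
Proof.
have := proj2 homega g^-1%g g; apply: filterS2 omega1 => x; rewrite mulVg => ->.
by move/(congr1 (fun z => z * (omega g x)^-1)%g); rewrite mul1g mulgK.
Qed.

Lemma mean1_nu g B : measurable B -> nu (mu := mu) a (fun=> 1) g B = pr (a g @^-1` B).
Proof.
move=> mB; rewrite -mean_indic; last exact: measurable_preact.
by apply: eq_mean => x; rewrite mul1r indic_preimage.
Qed.

(** A finite partition is moved little by g near 1: apply [nu_continuous] to
    the indicators of its pieces. *)
Lemma partition_continuous (c : X -> nat) N (e : R) :
  (forall i, measurable (c @^-1` [set i])) -> (forall x, (c x <= N)%N) -> 0 < e ->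
  \forall g \near (1 : G)%g, pr [set x | c (a g x) <> c x] <= e.
Proof.
move=> mc cN e0; have eN : 0 < e / N.+1%:R by rewrite divr_gt0.
have n1 i : \forall g \near (1 : G)%g,
    pr ((c @^-1` [set i]) `&` a g @^-1` (~` (c @^-1` [set i]))) <= e / N.+1%:R.
  have LI : L1 (\1_(c @^-1` [set i])) by exact: integrable_indic.
  have I0 x : 0 <= (\1_(c @^-1` [set i]) x : R) by rewrite indicE.
  have := nu_continuous a LI I0 hG hX eN; apply: filterS => g /(_ (~` (c @^-1` [set i]))).
  move=> /(_ (measurableC (mc i))).
  have -> : nu (mu := mu) a (\1_(c @^-1` [set i])) 1%g (~` (c @^-1` [set i])) = 0.
    rewrite -[RHS](@mean_cst _ _ _ mu 0); apply: eq_mean => x; rewrite act1 !indicE.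
    have [h|h] := pselect (c x = i); first by rewrite (@memNset _ (~` _)) ?mulr0// => /(_ h).
    by rewrite memNset ?mul0r.
  rewrite subr0 -mean_indic; last first.
    by apply: measurableI => //; apply: measurable_preact; exact: measurableC.
  move=> /(le_trans (ler_norm _)); congr (_ <= _); apply: eq_mean => x.
  by rewrite indicI indic_preimage.
have := near_forall_lt (nbhs_filter _) N.+1 n1; apply: filterS => g hg.
pose D i := (c @^-1` [set i]) `&` a g @^-1` (~` (c @^-1` [set i])).
have mD i : measurable (D i).
  by apply: measurableI => //; apply: measurable_preact; exact: measurableC.
have mU : measurable (\big[setU/set0]_(i < N.+1) D i) by apply: bigsetU_measurable.
have -> : [set x | c (a g x) <> c x] = \big[setU/set0]_(i < N.+1) D i.
  rewrite -bigcup_mkord; apply/seteqP; split=> x /=.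
    by move=> h; exists (c x); rewrite /= ?ltnS.
  by move=> [i _ [/= <- h]].
rewrite -lee_fin -prE//; apply: le_trans (Boole_inequality _ _) _ => //.
apply: (@le_trans _ _ (\sum_(i < N.+1) (e / N.+1%:R)%:E)%E).
  by apply: lee_sum => i _; rewrite -[leLHS]/(mu (D i)) prE ?lee_fin ?hg.
by rewrite sumEFin lee_fin sumr_const card_ord -[_ *+ _]mulr_natr divfK.
Qed.

(** Cover [H] by countably many open sets Y n with Y n^-1 Y n inside U. Each
    omega(k, _) is approximated in measure by a coded partition l, in that
    omega(k, x) lies in Y (l x) for most x, and the sets of such k are Borel.
    By Pettis' theorem every g near 1 is h^-1 k with h, k in the same set. For
    most x one then has omega(k, x) in Y (l x), omega(h, gx) in Y (l (gx)) and
    l (gx) = l x, so that omega(g, x) = omega(h, gx)^-1 omega(k, x) is in U. *)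
Theorem cocycle_continuous (U : set H) (e : R) : open U -> U 1%g -> 0 < e ->
  \forall g \near (1 : G)%g, pr [set x | ~ U (omega g x)] <= e.
Proof.
move=> oU U1 e0; have [_ _ sc] := hH.
have [|Y [oY cY YU]] := group_continuous_cover sc (U := U); first exact: open_nbhs_nbhs.
have e4 : 0 < e / 4 by rewrite divr_gt0.
have [A mA dA] := dense_sequence mu hX.
(* The points where the partition l mispredicts the piece Y n that contains
   omega k x. *)
pose Bad l k := [set x | ~ Y (set_code A l x) (omega k x)].
pose Bad2 l : set (borel G * X) := [set z | ~ Y (set_code A l z.2) (omega z.1 z.2)].
have mBad2 l : measurable (Bad2 l).
  rewrite (_ : Bad2 l = ~` \bigcup_i ([set z | set_code A l z.2 = i] `&`
      [set z | Y i (omega z.1 z.2)])); last first.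
    apply/seteqP; split=> z /=; first by move=> h [i _ [/= <-]].
    by move=> h h'; apply: h; exists (set_code A l z.2).
  apply: measurableC; apply: bigcup_measurable => i _; apply: measurableI.
    have : measurable_fun [set: borel G * X] snd by exact: measurable_snd.
    by move=> /(_ measurableT _ (measurable_set_code l i mA)); rewrite setTI.
  have := proj1 homega => /(_ measurableT _ (open_borel (oY i))).
  by rewrite setTI.
have mBad l k : measurable (Bad l k).
  have : measurable_fun [set: X] (fun x => (k, x) : borel G * X) by exact: pair1_measurable.
  by move=> /(_ measurableT _ (mBad2 l)); rewrite setTI.
pose E n : set G := if unpickle n is Some l then [set k | pr (Bad l k) < e / 4] else set0.
have [||n] := @pettis G hG E.
- move=> n; rewrite /E; case: unpickle => [l|]; last exact: (@measurable0 _ (borel G)).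
  have mI : measurable_fun setT (\1_(Bad2 l) : borel G * X -> R) by exact: measurable_indic.
  have I0 z : 0 <= (\1_(Bad2 l) z : R) by rewrite indicE.
  have := mf_mean_param (mu := mu) mI I0 => h.
  have -> : [set k | pr (Bad l k) < e / 4] = [set: borel G] `&`
      (fun k => mean (fun x => \1_(Bad2 l) (k, x))) @^-1` `]-oo, e / 4[.
    rewrite setTI; apply/seteqP; split=> k /=; rewrite in_itv /= -mean_indic//;
    by rewrite (@eq_mean _ _ _ mu _ (\1_(Bad l k)))// => x; rewrite !indicE.
  exact: h.
- move=> k; have exY x : exists n, `[< Y n (omega k x) >].
    by have [n Yn] := cY (omega k x); exists n; apply/asboolP.
  (* The first piece containing omega k x is a measurable choice. *)
  pose c x := ex_minn (exY x).
  have mc i : measurable (c @^-1` [set i]).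
    rewrite (_ : _ @^-1` _ = [set x | Y i (omega k x)] `\`
        \bigcup_(j in [set j | (j < i)%N]) [set x | Y j (omega k x)]).
      apply: measurableD; first exact: measurable_omega_open.
      by apply: bigcup_measurable => j _; exact: measurable_omega_open.
    apply/seteqP; split=> x /=; rewrite /c; case: ex_minnP => m /asboolP Ym min_m.
      by move=> <-; split=> // -[j /= jm] /asboolP /min_m; rewrite leqNgt jm.
    move=> [/asboolP/min_m mi h]; apply/eqP; rewrite eqn_leq mi leqNgt; apply/negP => im.
    by apply: h; exists m.
  have [l hl] := set_code_approx mA dA mc e4; exists (pickle l); rewrite /E pickleK /=.
  apply: le_lt_trans hl; apply: pr_le => //.
    rewrite (_ : mkset _ = ~` \bigcup_i ((set_code A l @^-1` [set i]) `&` (c @^-1` [set i]))).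
      apply: measurableC; apply: bigcup_measurable => i _; apply: measurableI => //.
      exact: measurable_set_code.
    apply/seteqP; split=> x /=.
      by move=> h [i _ [/= h1 h2]]; apply: h; rewrite h1 h2.
    by move=> h h'; apply: h; exists (c x).
  move=> x; rewrite /Bad /= => h e'; apply: h; rewrite e' /c.
  by case: ex_minnP => m /asboolP.
rewrite /E; case: unpickle => [l|]; last by apply: filterS => g [h [k []]].
have L1c : L1 (fun=> 1) by exact: L1_cst.
have n1 := nu_continuous a L1c (fun=> ler01) hG hX e4.
have n2 := partition_continuous (measurable_set_code l ^~ mA) (set_code_le A l) e4.
apply: filterS3 n1 n2 => g n1 n2 [h [k [/= Eh Ek gE]]].
have mM : measurable [set x | set_code A l (a g x) <> set_code A l x].
  rewrite (_ : mkset _ = ~` \bigcup_i ((a g @^-1` (set_code A l @^-1` [set i])) `&`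
      (set_code A l @^-1` [set i]))).
    apply: measurableC; apply: bigcup_measurable => i _; apply: measurableI.
      by apply: measurable_preact; exact: measurable_set_code.
    exact: measurable_set_code.
  apply/seteqP; split=> x /=.
    by move=> h' [i _ [/= h1 h2]]; apply: h'; rewrite h1 h2.
  by move=> h' h''; apply: h'; exists (set_code A l x).
have nb : pr (a g @^-1` (Bad l h)) <= e / 4 + e / 4.
  have := n1 _ (mBad l h); rewrite !mean1_nu// preact1.
  move/(le_trans (ler_norm _)); move: Eh; lra.
have kE : k = (h * g)%g by rewrite gE mulVKg.
have := proj2 homega h g; rewrite -kE => ae_k.
have mU : measurable [set x | ~ U (omega g x)].
  by apply: measurableC; exact: measurable_omega_open.
apply: (@le_trans _ _ (pr ([set x | set_code A l (a g x) <> set_code A l x] `|`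
   (a g @^-1` (Bad l h) `|` Bad l k)))).
  apply: pr_le_ae => //.
    by do 2 apply: measurableU => //; exact: measurable_preact.
  move: ae_k; apply: filterS => x e1 nU; apply: contrapT => /not_orP[c1 /not_orP[c2 c3]].
  have {}c1 : set_code A l (a g x) = set_code A l x by exact: contrapT.
  have {}c2 : Y (set_code A l (a g x)) (omega h (a g x)) by exact: contrapT.
  have {}c3 : Y (set_code A l x) (omega k x) by exact: contrapT.
  rewrite c1 in c2; have := YU _ _ _ c2 c3; rewrite e1 mulKg; exact: nU.
have mg := measurable_preact a g (mBad l h).
have := prU mu mM (measurableU _ _ mg (mBad l k)).
have := prU mu mg (mBad l k).
by move: Ek n2 nb; lra.
Qed.

End cocycle_continuity.

(** * Integrals of complex functions and the cocycle identity of the Jacobian *)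

Section complex_mean.
Context {R : realType} {d} {X : measurableType d} (mu : probability X R).
Local Notation C := R[i].
Local Notation Re := (@complex.Re R).
Local Notation Im := (@complex.Im R).
Local Notation mean := (mean mu).
Local Notation L1 := (L1 mu).
Implicit Types u v : X -> C.

Definition cL1 u := L1 (fun x => Re (u x)) /\ L1 (fun x => Im (u x)).
Definition complex_mean u : C := (mean (fun x => Re (u x)) +i* mean (fun x => Im (u x)))%C.

Lemma complexReD (x y : C) : Re (x + y) = Re x + Re y.
Proof. by case: x => a b; case: y. Qed.

Lemma complexImD (x y : C) : Im (x + y) = Im x + Im y.
Proof. by case: x => a b; case: y. Qed.

Lemma complexReM (x y : C) : Re (x * y) = Re x * Re y - Im x * Im y.
Proof. by case: x => a b; case: y => c d'. Qed.

Lemma complexImM (x y : C) : Im (x * y) = Re x * Im y + Im x * Re y.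
Proof. by case: x => a b; case: y => c d'. Qed.

Lemma normc_ge0 (x : C) : 0 <= normc x.
Proof. by case: x => a b; exact: sqrtr_ge0. Qed.

Lemma Re_le_normc (x : C) : `|Re x| <= normc x.
Proof. by case: x => a b /=; rewrite -sqrtr_sqr ler_wsqrtr// lerDl sqr_ge0. Qed.

Lemma Im_le_normc (x : C) : `|Im x| <= normc x.
Proof. by case: x => a b /=; rewrite -sqrtr_sqr ler_wsqrtr// lerDr sqr_ge0. Qed.

Lemma cL1_le u (g : X -> R) : measurable_fun setT (fun x => Re (u x)) ->
  measurable_fun setT (fun x => Im (u x)) -> (forall x, normc (u x) <= g x) -> L1 g -> cL1 u.
Proof.
move=> mr mi ug hg; split.
  by apply: L1_le mr _ hg => x; exact: le_trans (Re_le_normc _) (ug x).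
by apply: L1_le mi _ hg => x; exact: le_trans (Im_le_normc _) (ug x).
Qed.

Lemma cL1D u v : cL1 u -> cL1 v -> cL1 (fun x => u x + v x).
Proof.
move=> [ur ui] [vr vi]; split.
  by apply: eq_integrable (L1D ur vr) => // x _; rewrite /= complexReD.
by apply: eq_integrable (L1D ui vi) => // x _; rewrite /= complexImD.
Qed.

Lemma cL1Z (c : C) u : cL1 u -> cL1 (fun x => c * u x).
Proof.
move=> [ur ui]; split.
  by apply: eq_integrable (L1B (L1Z (Re c) ur) (L1Z (Im c) ui)) => // x _; rewrite /= complexReM.
by apply: eq_integrable (L1D (L1Z (Re c) ui) (L1Z (Im c) ur)) => // x _; rewrite /= complexImM.
Qed.

Lemma cL1_sum n (u : 'I_n -> X -> C) : (forall i, cL1 (u i)) ->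
  cL1 (fun x => \sum_i u i x).
Proof.
elim: n u => [|n ih] u hu.
  by split; apply: eq_integrable (L1_cst mu 0) => // x _; rewrite /= big_ord0.
have := cL1D (ih _ (fun i => hu (widen_ord (leqnSn n) i))) (hu ord_max).
by congr cL1; apply/funext => x; rewrite big_ord_recr.
Qed.

Lemma cmeanD u v : cL1 u -> cL1 v -> complex_mean (fun x => u x + v x) = complex_mean u + complex_mean v.
Proof.
move=> [ur ui] [vr vi]; rewrite /complex_mean; apply/eqP; rewrite eq_complex /=.
rewrite -(meanD ur vr) -(meanD ui vi); apply/andP; split; apply/eqP;
 by apply: eq_mean => x; rewrite ?complexReD ?complexImD.
Qed.

Lemma cmeanZ (c : C) u : cL1 u -> complex_mean (fun x => c * u x) = c * complex_mean u.
Proof.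
move=> [ur ui]; rewrite /complex_mean; apply/eqP; rewrite eq_complex complexReM complexImM /=.
have e1 := meanB (L1Z (Re c) ur) (L1Z (Im c) ui).
have e2 := meanD (L1Z (Re c) ui) (L1Z (Im c) ur).
rewrite !meanZ// in e1 e2; rewrite -e1 -e2.
by apply/andP; split; apply/eqP; apply: eq_mean => x; rewrite ?complexReM ?complexImM.
Qed.

Lemma cmean_sum n (u : 'I_n -> X -> C) : (forall i, cL1 (u i)) ->
  complex_mean (fun x => \sum_i u i x) = \sum_i complex_mean (u i).
Proof.
elim: n u => [|n ih] u hu.
  rewrite big_ord0 /complex_mean; apply/eqP; rewrite eq_complex /=.
  by apply/andP; split; apply/eqP; rewrite -[RHS](@mean_cst _ _ _ mu);
   apply: eq_mean => x; rewrite big_ord0.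
rewrite big_ord_recr /= -ih// -cmeanD//; last exact: cL1_sum.
by congr complex_mean; apply/funext => x; rewrite big_ord_recr.
Qed.

Lemma eq_cmean u v : (forall x, u x = v x) -> complex_mean u = complex_mean v.
Proof. by move=> uv; congr complex_mean; apply/funext. Qed.

Lemma cmean_ae u v : cL1 u -> cL1 v -> {ae mu, forall x, u x = v x} -> complex_mean u = complex_mean v.
Proof.
move=> [ur ui] [vr vi] uv; congr (_ +i* _)%C.
  by apply: mean_ae (L1_mf ur) (L1_mf vr) _; move: uv; apply: filterS => x ->.
by apply: mean_ae (L1_mf ui) (L1_mf vi) _; move: uv; apply: filterS => x ->.
Qed.

Lemma cmean_conj u : cL1 u -> complex_mean (fun x => (u x)^*) = (complex_mean u)^*.
Proof.
move=> [ur ui]; rewrite /complex_mean; apply/eqP; rewrite eq_complex /=.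
apply/andP; split; apply/eqP; first by apply: eq_mean => x; case: (u x).
by rewrite -[RHS]mulN1r -meanZ//; apply: eq_mean => x; case: (u x) => ? ? /=; rewrite mulN1r.
Qed.

Lemma cmean_real (g : X -> R) : complex_mean (fun x => (g x)%:C%C) = (mean g)%:C%C.
Proof. by rewrite /complex_mean /= mean_cst. Qed.

Lemma cL1_real (g : X -> R) : L1 g -> cL1 (fun x => (g x)%:C%C).
Proof. by move=> hg; split => //=; exact: L1_cst. Qed.

Lemma cmean_ge0 u : (forall x, 0 <= u x) -> 0 <= complex_mean u.
Proof.
move=> u0; rewrite (@eq_cmean _ (fun x => (Re (u x))%:C%C)).
  rewrite cmean_real ler0c; apply: mean_ge0 => x.
  by have := u0 x; rewrite lecE => /andP[_].
by move=> x; rewrite RRe_real// ger0_real.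
Qed.

(** Rotate the integral onto the positive half-line, where it is the integral
    of a real part. *)
Lemma normc_cmean u (g : X -> R) : cL1 u -> L1 g -> {ae mu, forall x, normc (u x) <= g x} ->
  normc (complex_mean u) <= mean g.
Proof.
move=> hu hg ug; set z := complex_mean u.
have [z0|z0] := eqVneq (normc z) 0.
  rewrite z0 -[leLHS](@mean_cst _ _ _ mu); apply: mean_le_ae => //; first exact: L1_cst.
  by move: ug; apply: filterS => x; apply: le_trans; exact: normc_ge0.
have zp : 0 < normc z by rewrite lt_def z0 normc_ge0.
(* The unimodular number that rotates z onto its modulus. *)
pose c : C := z^* / (normc z)%:C%C.
have cn : normc c = 1.
  rewrite /c ComplexField.Normc.normcM ComplexField.Normc.normcV.
  have -> : normc z^* = normc z by case: (z) => ? ? /=; rewrite sqrrN.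
  have -> : normc (normc z)%:C%C = normc z.
    by rewrite /= expr0n addr0 sqrtr_sqr ger0_norm// normc_ge0.
  by rewrite divff.
have e : (normc z)%:C%C = complex_mean (fun x => c * u x).
  rewrite cmeanZ// -/z /c mulrAC [_^* * _]mulrC -normCK.
  rewrite -[`|z|]/((normc z)%:C%C) expr2 mulfK//.
  by apply/eqP => /(congr1 Re) /=; apply/eqP.
have -> : normc z = mean (fun x => Re (c * u x)) by move/(congr1 Re): e.
apply: mean_le_ae => //; first by case: (cL1Z c hu).
move: ug; apply: filterS => x h; apply: le_trans h.
apply: le_trans (ler_norm _) _; apply: le_trans (Re_le_normc _) _.
by rewrite ComplexField.Normc.normcM cn mul1r.
Qed.

End complex_mean.

Section jac_cocycle.
Context {R : realType} {G : topologicalGroupType} {d} {X : measurableType d}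
  {mu : probability X R} (a : nonsingular_action G mu).
Local Notation mf f := (measurable_fun setT f).
Local Notation mean := (mean mu).
Local Notation L1 := (L1 mu).

Lemma L1_jac2 g : L1 (fun x => jac a g x ^+ 2).
Proof.
have [h _] := @mean_jac2 _ _ _ _ mu a g (fun=> 1) (measurable_cst _) (L1_cst _ _).
by apply: eq_integrable h => // x _; rewrite /= mul1r.
Qed.

(** Densities are determined by the measure. *)
Lemma ae_eq_of_mean (u v : X -> R) : L1 u -> L1 v ->
  (forall B, measurable B -> mean (fun x => u x * \1_B x) = mean (fun x => v x * \1_B x)) ->
  {ae mu, forall x, u x = v x}.
Proof.
move=> hu hv uv.
have key : forall w : X -> R, L1 w -> forall B, measurable B ->
    (\int[mu]_(x in B) (w x)%:E)%E = (mean (fun x => w x * \1_B x))%:E.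
  move=> w hw B mB; rewrite integral_mkcond /mean /Rintegral fineK.
    by apply: eq_integral => x _; rewrite patchE indicE; case: ifPn; rewrite ?mulr1 ?mulr0.
  by apply: integrable_fin_num => //; exact: L1_indic.
have : ae_eq mu setT (EFin \o u) (EFin \o v).
  apply: integral_ae_eq => //; first by apply/measurable_EFinP; exact: L1_mf hv.
  by move=> B _ mB; rewrite !key// uv.
by apply: filterS => x /(_ I) [].
Qed.

Lemma mean_jac2_indic g B : measurable B ->
  mean (fun x => jac a g x ^+ 2 * \1_B x) = mean (fun x => \1_B (a g^-1%g x)).
Proof.
move=> mB; have mI : mf (\1_B : X -> R) by exact: measurable_indic.
have LI : L1 (fun x => \1_B (a g^-1%g x)).
  exact: integrable_indic (measurable_preact a g^-1%g mB).
by have [_ <-] := mean_jac2 mI LI; apply: eq_mean => x; rewrite mulrC.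
Qed.

(** The squares of the Jacobians are densities of translates of mu, so their
    cocycle identities hold because densities are unique. *)
Lemma jac1 : {ae mu, forall x, jac a 1%g x = 1}.
Proof.
have := @ae_eq_of_mean (fun x => jac a 1%g x ^+ 2) (fun=> 1) (L1_jac2 1%g) (L1_cst _ _).
move=> /(_ _)/wrap[B mB|].
  by rewrite mean_jac2_indic//; apply: eq_mean => x; rewrite invg1 act1 mul1r.
apply: filterS => x /eqP; rewrite sqrp_eq1 ?jac_ge0//; exact/eqP.
Qed.

Lemma jacM g h : {ae mu, forall x, jac a (g * h)%g x = jac a g (a h x) * jac a h x}.
Proof.
have m1 : mf (fun x => jac a g (a h x) ^+ 2).
  by apply: measurable_funX; exact: mf_act (mf_jac a g).
have L' : L1 (fun x => jac a g (a h (a h^-1%g x)) ^+ 2).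
  by apply: eq_integrable (L1_jac2 g) => // x _; rewrite /= act_invr.
have [Lg _] := mean_jac2 m1 L'.
have := ae_eq_of_mean (L1_jac2 (g * h)%g) Lg.
move=> /(_ _)/wrap[B mB|].
  rewrite mean_jac2_indic//.
  have mI : mf (\1_B : X -> R) by exact: measurable_indic.
  have m2 : mf (fun x => jac a g (a h x) ^+ 2 * \1_B x) by exact: measurable_funM.
  have L2 : L1 (fun x => jac a g (a h (a h^-1%g x)) ^+ 2 * \1_B (a h^-1%g x)).
    have := L1_indic (measurable_preact a h^-1%g mB) L'.
    by apply: eq_integrable => // x _.
  have [_ e] := mean_jac2 m2 L2.
  transitivity (mean (fun x => jac a g x ^+ 2 * \1_(a h^-1%g @^-1` B) x)).
    rewrite mean_jac2_indic; last exact: measurable_preact.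
    by apply: eq_mean => x; rewrite [RHS]indic_preimage -actM invgM.
  transitivity (mean (fun x => jac a g (a h x) ^+ 2 * \1_B x * jac a h x ^+ 2)).
    by rewrite e; apply: eq_mean => x; rewrite act_invr [in LHS]indic_preimage.
  by apply: eq_mean => x; rewrite mulrAC.
apply: filterS => x e; apply/eqP; rewrite -(@eqrXn2 _ 2)// ?mulr_ge0 ?jac_ge0//.
by rewrite e exprMn.
Qed.

Lemma jacV g : {ae mu, forall x, jac a g^-1%g (a g x) * jac a g x = 1}.
Proof.
have := jacM g^-1%g g; apply: filterS2 jac1 => x e1; by rewrite mulVg e1 => <-.
Qed.

End jac_cocycle.

(** * Continuity along orbits *)

Section koopman_vectors.
Context {R : realType} {G H : topologicalGroupType} {d} {X : measurableType d}
  {mu : probability X R} (a : nonsingular_action G mu) (omega : G -> X -> H).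
Hypotheses (hG : lcsc G) (hH : lcsc H) (hX : standard_borel R X)
  (homega : cocycle a omega).
Local Notation mf f := (measurable_fun setT f).
Local Notation mean := (mean mu).
Local Notation cmean := (complex_mean mu).
Local Notation L1 := (L1 mu).
Local Notation cL1 := (cL1 mu).
Local Notation pr := (pr mu).
Local Notation C := R[i].

Variables (f : X -> R) (mff : mf f) (f0 : forall x, 0 <= f x)
  (Lf : L1 (fun x => f x ^+ 2)).

(** The Koopman operator on real functions. *)
Definition koop g y : R := f (a g^-1%g y) * jac a g^-1%g y.
(** By the cocycle identity, [(cocycle_inv g y)^-1 * cocycle_inv h y] is
    omega(g^-1 h, h^-1 y) almost surely. *)
Definition cocycle_inv g y : H := (omega g^-1%g y)^-1%g.

Lemma koop_ge0 g y : 0 <= koop g y.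
Proof. by rewrite mulr_ge0// jac_ge0. Qed.

Lemma koop_dens g y : koop g y ^+ 2 = dens a (fun x => f x ^+ 2) g y.
Proof. by rewrite exprMn. Qed.

Lemma mf_koop g : mf (koop g).
Proof. by apply: measurable_funM; [exact: mf_act|exact: mf_jac]. Qed.

Lemma L1_koop2 g : L1 (fun y => koop g y ^+ 2).
Proof.
apply: eq_integrable (L1_dens a Lf g) => // x _ /=.
by rewrite -koop_dens.
Qed.

Lemma mean_koop2 g : mean (fun y => koop g y ^+ 2) = mean (fun x => f x ^+ 2).
Proof.
have := nu_dens a Lf g measurableT; rewrite /nu => e.
transitivity (mean (fun y => dens a (fun x => f x ^+ 2) g y * \1_setT y)).
  by apply: eq_mean => y; rewrite indicT mulr1 koop_dens.
by rewrite -e; apply: eq_mean => y; rewrite indicT mulr1.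
Qed.

Lemma L1_prod (u v : X -> R) : mf u -> mf v -> L1 (fun x => u x ^+ 2) ->
  L1 (fun x => v x ^+ 2) -> L1 (fun x => u x * v x).
Proof.
move=> mu' mv hu hv; apply: L1_le (L1D hu hv); first exact: measurable_funM.
move=> x; rewrite normrM -(real_normK (num_real (u x))) -(real_normK (num_real (v x))).
move: (normr_ge0 (u x)) (normr_ge0 (v x)); move: (`|u x|) (`|v x|) => p q; nra.
Qed.

Lemma L1_koopM g h : L1 (fun y => koop g y * koop h y).
Proof. by apply: L1_prod; [exact: mf_koop|exact: mf_koop|exact: L1_koop2|exact: L1_koop2]. Qed.

Lemma L1_koopB2 g h : L1 (fun y => (koop g y - koop h y) ^+ 2).
Proof.
have h2 := L1B (L1D (L1_koop2 g) (L1_koop2 h)) (L1Z 2 (L1_koopM g h)).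
by apply: eq_integrable h2 => // y _; rewrite /=; congr EFin; ring.
Qed.

(** Since |p - q|^2 <= |p^2 - q^2| for nonnegative p and q, the L^2 distance is
    bounded by the L^1 distance of the squares, which are densities of
    translates of one measure; [nu_continuous] tested on the set where the
    difference of densities is nonnegative, and on its complement, bounds this
    distance. *)
Lemma L2_continuous g0 (e : R) : 0 < e -> \forall h \near (1 : G)%g,
  mean (fun y => (koop (g0 * h)%g y - koop g0 y) ^+ 2) <= e.
Proof.
move=> e0; have e2 : 0 < e / 2 by rewrite divr_gt0.
have F0 x : 0 <= f x ^+ 2 by exact: sqr_ge0.
have := nu_continuous a Lf F0 hG hX e2; apply: filterS => h hh.
pose F x := f x ^+ 2; pose u y := dens a F (g0 * h)%g y - dens a F g0 y.
have Lu : L1 u by apply: L1B; exact: L1_dens.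
have nuE B : measurable B -> `|mean (fun y => u y * \1_B y)| <= e / 2.
  move=> mB; have := hh _ (measurable_preact a g0 mB); congr (`|_| <= _).
  transitivity (nu (mu := mu) a F (g0 * h)%g B - nu (mu := mu) a F g0 B).
    congr (_ - _); apply: eq_mean => x; rewrite [in LHS]indic_preimage ?actM//.
    by rewrite act1.
  rewrite !nu_dens// -meanB; try by apply: L1_indic => //; exact: L1_dens.
  by apply: eq_mean => x; rewrite mulrBl.
pose B := [set y | 0 <= u y].
have mB : measurable B.
  rewrite -[X in measurable X]setTI; apply: measurable_fun_le => //.
  exact: L1_mf Lu.
have L2 : L1 (fun y => `|u y|) by exact: L1_norm.
apply: (@le_trans _ _ (mean (fun y => `|u y|))).
  apply: mean_le => //; first exact: L1_koopB2.
  move=> y; rewrite /u -!koop_dens subr_sqr normrM.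
  have := koop_ge0 (g0 * h)%g y; have := koop_ge0 g0 y.
  move: (koop _ y) (koop _ y) => p q p0 q0.
  rewrite (ger0_norm (addr_ge0 q0 p0)) -real_normK ?num_real// expr2.
  by rewrite ler_wpM2l// ler_norml; apply/andP; split; lra.
rewrite (@eq_mean _ _ _ mu _ (fun y => u y * \1_B y - u y * \1_(~` B) y)); last first.
  move=> y; rewrite !indicE; have [By|By] := pselect (B y).
    by rewrite mem_set// memNset ?mulr1 ?mulr0 ?subr0 ?ger0_norm// => /(_ By).
  rewrite memNset// mem_set ?mulr0 ?mulr1 ?sub0r// ler0_norm//.
  by rewrite ltW// ltNge; apply/negP.
have mBC : measurable (~` B) by exact: measurableC.
rewrite meanB; [|exact: L1_indic..].
have := nuE B mB; have := nuE _ mBC.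
rewrite !ler_norml => /andP[? ?] /andP[? ?]; lra.
Qed.

Lemma measurable_cocycle_inv g : measurable_fun setT (cocycle_inv g : X -> borel H).
Proof.
apply: (measurability _ (erefl : @measurable _ (borel H) = <<s @open H >>)).
move=> _ [U oU <-]; rewrite setTI.
apply: (measurable_omega_open homega g^-1%g (U := (fun x => x^-1%g) @^-1` U)).
by apply: open_comp => // x _; exact: invg_continuous.
Qed.

Lemma cocycle_invM g0 h : {ae mu, forall y,
  cocycle_inv (g0 * h)%g y = (cocycle_inv g0 y * (omega h^-1%g (a g0^-1%g y))^-1)%g}.
Proof.
have := proj2 homega h^-1%g g0^-1%g; apply: filterS => y e.
by rewrite /cocycle_inv invgM e invgM.
Qed.

(** By [cocycle_invM] the two arguments of D differ by the right factor
    omega(h^-1, _)^-1, which is near 1 off a small set. Off another small set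
    the first argument lies in a compact set, where D is uniformly small in
    that direction. *)
Lemma weight_continuous g0 (w : X -> R) (D : H * H -> R) (M e : R) :
  L1 w -> (forall y, 0 <= w y) -> continuous D -> (forall z, 0 <= D z <= M) ->
  (forall s, D (s, s) = 0) -> 0 < e ->
  \forall h \near (1 : G)%g, mean (fun y => w y * D (cocycle_inv g0 y, cocycle_inv (g0 * h)%g y)) <= e.
Proof.
move=> Lw w0 cD DM D0 e0.
have M0 : 0 <= M by have /andP[h1 h2] := DM (1%g, 1%g); exact: le_trans h2.
have M1 : 0 < M + 1 by lra.
have eM : 0 < e / 3 / (M + 1) by rewrite !divr_gt0.
have mw0 : 0 <= mean w by exact: mean_ge0.
have mw1 : 0 < mean w + 1 by lra.
have ew : 0 < e / 3 / (mean w + 1) by rewrite !divr_gt0.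
have [K [cK Kmono Kall]] := compact_exhaustion hH.
pose T n := cocycle_inv g0 @^-1` (~` K n).
have mT n : measurable (T n).
  rewrite -[X in measurable X]setTI; apply: (measurable_cocycle_inv g0) => //.
  by apply: open_borel; apply: closed_openC; case: (cK n).
have [N hN] : exists n, mean (fun y => `|w y| * \1_(T n) y) < e / 3 / (M + 1).
  apply: mean_tail Lw mT _ _ eM.
    by move=> m n mn y /= h; apply: contra_not h; exact: Kmono.
  apply/seteqP; split=> // y h.
  have [n hn] := Kall _ (@compact_set1 _ (cocycle_inv g0 y)).
  by apply: (h n I); exact: hn.
have := compact_translate_small cD D0 (proj1 (cK N)) ew => nearU.
pose U0 := [set t : H | forall s, K N s -> D (s, (s * t)%g) < e / 3 / (mean w + 1)].
pose U := U0^°.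
have U1 : U 1%g by exact: nbhs_singleton (nbhs_interior nearU).
have oU : open U by exact: open_interior.
pose V := (fun x : H => x^-1%g) @^-1` U.
have oV : open V by apply: open_comp => // x _; exact: invg_continuous.
have V1 : V 1%g by rewrite /V /= invg1.
have [dl dl0 hdl] := mean_small Lw eM.
have [d2 d20 hd2] := translate_small a g0^-1%g dl0.
have n1 := cocycle_continuous hG hH hX homega oV V1 (divr_gt0 d20 (ltr0n _ 2) : 0 < d2 / 2).
have n2 : \forall h \near (1 : G)%g, pr [set x | ~ V (omega h^-1%g x)] <= d2 / 2.
  have ci : (fun g : G => g^-1%g) @ (1 : G)%g --> (1 : G)%g.
    by rewrite -[X in _ --> X]invg1; exact: invg_continuous.
  exact: (ci _ n1).
apply: filterS n2 => h hh.
pose Bad := [set x | ~ V (omega h^-1%g x)].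
have mBad : measurable Bad by apply: measurableC; exact: (measurable_omega_open homega h^-1%g oV).
have mBad' := measurable_preact a g0^-1%g mBad.
have hb : mean (fun y => `|w y| * \1_(a g0^-1%g @^-1` Bad) y) < e / 3 / (M + 1).
  apply: hdl => //; apply: hd2 => //; have hh' : pr Bad <= d2 / 2 by [].
  by apply: (le_lt_trans hh'); lra.
have L3 := L1_indic (mT N) (L1_norm Lw).
have L4 := L1_indic mBad' (L1_norm Lw).
have mQ : mf (fun y => D (cocycle_inv g0 y, cocycle_inv (g0 * h)%g y)).
  exact: (measurable_pair_continuous hH (measurable_cocycle_inv _) (measurable_cocycle_inv _) cD).
have LQ : L1 (fun y => w y * D (cocycle_inv g0 y, cocycle_inv (g0 * h)%g y)).
  apply: L1_le (L1Z M Lw); first by apply: measurable_funM => //; exact: L1_mf Lw.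
  move=> y; have /andP[h1 h2] := DM (cocycle_inv g0 y, cocycle_inv (g0 * h)%g y).
  by rewrite ger0_norm ?mulr_ge0// mulrC ler_wpM2r.
apply: (@le_trans _ _ (mean (fun y => (e / 3 / (mean w + 1)) * w y +
   (M * (`|w y| * \1_(T N) y) + M * (`|w y| * \1_(a g0^-1%g @^-1` Bad) y))))).
  apply: mean_le_ae => //.
    by apply: L1D; [exact: L1Z|apply: L1D; exact: L1Z].
  have := cocycle_invM g0 h; apply: filterS => y sE.
  have /andP[h1 h2] := DM (cocycle_inv g0 y, cocycle_inv (g0 * h)%g y).
  have i0 (B : set X) : 0 <= (\1_B y : R) by rewrite indicE.
  have wE : `|w y| = w y by rewrite ger0_norm.
  rewrite wE; set B := a g0^-1%g @^-1` Bad.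
  have t1 : 0 <= e / 3 / (mean w + 1) * w y by rewrite mulr_ge0// ltW.
  have t2 : 0 <= M * (w y * \1_(T N) y) by rewrite !mulr_ge0.
  have t3 : 0 <= M * (w y * \1_B y) by rewrite !mulr_ge0.
  have wD : w y * D (cocycle_inv g0 y, cocycle_inv (g0 * h)%g y) <= M * w y by rewrite mulrC ler_wpM2r.
  have [yT|yT] := pselect (T N y).
    have e1 : (\1_(T N) y : R) = 1 by rewrite indicE mem_set.
    by move: t1 t3; rewrite e1 mulr1; lra.
  have [yB|yB] := pselect (B y).
    have e1 : (\1_B y : R) = 1 by rewrite indicE mem_set.
    by move: t1 t2; rewrite e1 mulr1; lra.
  have hs : D (cocycle_inv g0 y, cocycle_inv (g0 * h)%g y) < e / 3 / (mean w + 1).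
    rewrite sE; have Ut : U0 ((omega h^-1 (a g0^-1 y))^-1)%g.
      by apply: interior_subset; exact: (contrapT yB).
    by apply: Ut; exact: contrapT.
  have : w y * D (cocycle_inv g0 y, cocycle_inv (g0 * h)%g y) <= e / 3 / (mean w + 1) * w y.
    by rewrite mulrC ler_wpM2r// ltW.
  by move: t2 t3; lra.
rewrite meanD ?meanD ?meanZ//; try by [exact: L1Z|apply: L1D; exact: L1Z].
have b1 : e / 3 / (mean w + 1) * mean w <= e / 3.
  by rewrite mulrAC ler_pdivrMr// ler_wpM2l ?lerDl// divr_ge0// ltW.
have b2 (z : R) : z < e / 3 / (M + 1) -> M * z <= e / 3.
  move=> hz; apply: (@le_trans _ _ (M * (e / 3 / (M + 1)))).
    by rewrite ler_wpM2l// ltW.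
  by rewrite mulrA ler_pdivrMr// mulrC ler_wpM2l ?lerDl// divr_ge0// ltW.
have := b2 _ hN; have := b2 _ hb; move: b1; lra.
Qed.

End koopman_vectors.

(** * Complex numbers and Hilbert spaces as topological spaces *)

Section complex_topology.
Context {R : realType}.
Local Notation C := R[i].

Lemma complex_gt0E (e : C) : 0 < e -> exists2 r : R, 0 < r & e = r%:C%C.
Proof.
move=> e0; have eE : e = (complex.Re e)%:C%C by rewrite RRe_real// ger0_real// ltW.
by exists (complex.Re e) => //; move: e0; rewrite {1}eE ltcR.
Qed.

Lemma lipschitz_continuousC (p : C -> R) :
  (forall z w, `|p z - p w| <= normc (z - w)) -> continuous p.
Proof.
move=> hp z; have FF : Filter (nbhs z) by exact: nbhs_filter.
apply/(@cvgrPdist_lt _ _ _ (nbhs z) FF) => e e0.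
have ec : (0 : C) < e%:C%C by rewrite ltcR.
have idz : (fun w : C => w) @ z --> z by exact: cvg_id.
move/cvgrPdist_lt : idz => /(_ _ ec); apply: filterS => w /=.
by rewrite normCE ltcR; apply: le_lt_trans; exact: hp.
Qed.

Lemma normc_sub_le (z w : C) : `|normc z - normc w| <= normc (z - w).
Proof.
have t (x y : C) : normc x - normc y <= normc (x - y).
  by rewrite lerBlDr -{1}(subrK y x); exact: le_normcD.
rewrite ler_norml t andbT lerNl opprB (le_trans (t w z))//.
by rewrite -opprB normcN.
Qed.

Lemma Re_continuous : continuous (@complex.Re R).
Proof.
apply: lipschitz_continuousC => z w; apply: le_trans (Re_le_normc _).
by case: z => ? ?; case: w.
Qed.

Lemma Im_continuous : continuous (@complex.Im R).
Proof.
apply: lipschitz_continuousC => z w; apply: le_trans (Im_le_normc _).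
by case: z => ? ?; case: w.
Qed.

Lemma normc_continuous : continuous (@normc R).
Proof. by apply: lipschitz_continuousC => z w; exact: normc_sub_le. Qed.

End complex_topology.

Section hilbert.
Context {R : realType} (V : hilbertType R).
Local Notation C := R[i].
Implicit Types u v w : V.

Lemma innerDl u v w : inner V (u + v) w = inner V u w + inner V v w.
Proof. exact: linearDl. Qed.

Lemma innerDr u v w : inner V w (u + v) = inner V w u + inner V w v.
Proof. exact: linearDr. Qed.

Lemma innerZl (c : C) u w : inner V (c *: u) w = c * inner V u w.
Proof. exact: linearZl_LR. Qed.

Lemma innerZr (c : C) u w : inner V w (c *: u) = c^* * inner V w u.
Proof. exact: linearZr_LR. Qed.

Lemma innerC u v : inner V v u = (inner V u v)^*.
Proof. by rewrite (@hermitian_subproof _ _ _ _ (inner V)) expr0 mul1r. Qed.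

Lemma inner_sum n (c : 'I_n -> C) (v : 'I_n -> V) :
  \sum_i \sum_j c i * (c j)^* * inner V (v i) (v j) =
  inner V (\sum_i c i *: v i) (\sum_i c i *: v i).
Proof.
rewrite linear_sumlz; apply: eq_bigr => i _; rewrite linear_sumr; apply: eq_bigr => j _.
by rewrite /= [RHS]innerZl innerZr mulrA.
Qed.

Lemma inner_ge0 u : 0 <= inner V u u.
Proof. by rewrite inner_norm exprn_ge0. Qed.

Lemma inner_cs u v : `|inner V u v| <= `|u| * `|v|.
Proof.
rewrite -(@ler_pXn2r _ 2) ?nnegrE ?mulr_ge0// exprMn -!inner_norm.
apply: cauchy_schwarz_of_quadratic; rewrite ?inner_ge0// => c.
have := inner_ge0 (u + c *: v); congr (_ <= _).
rewrite innerDl !innerDr !innerZl !innerZr (innerC u v); ring.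
Qed.

(** Continuity of the inner product is deduced from that of the norm. *)
Lemma polarization u v : inner V u v = 4^-1 *
  (`|u + v| ^+ 2 - `|u - v| ^+ 2 + 'i * (`|u + 'i *: v| ^+ 2 - `|u - 'i *: v| ^+ 2)).
Proof.
have h c : `|u + c *: v| ^+ 2 =
    inner V u u + c^* * inner V u v + (c * inner V v u + c * (c^* * inner V v v)).
  by rewrite -(inner_norm (u + c *: v)) innerDl !innerDr !innerZl !innerZr.
have := h 1; have := h (-1); have := h 'i; have := h (- 'i).
rewrite scaleN1r scale1r scaleNr !rmorphN /= conjC1 conjCi => -> -> -> ->.
move: (inner V u u) (inner V v v) (inner V u v) (inner V v u) => p q r s.
have := @sqrCi C; rewrite expr2; move: ('i : C) => i ii.
transitivity (4^-1 * (2 * r + 2 * s + (i * i) * (2 * s - 2 * r))); first by rewrite ii; field.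
by congr (_ * _); ring.
Qed.

Lemma cvg_norm2 (T : Type) (F : set_system T) {FF : Filter F} (p : T -> V) (q : V) :
  p @ F --> q -> (fun z => `|p z| ^+ 2) @ F --> `|q| ^+ 2.
Proof.
by move=> h; rewrite expr2; under eq_fun do rewrite expr2; apply: cvgM; exact: cvg_norm.
Qed.

Lemma inner_continuous (T : topologicalType) (xi eta : T -> V) :
  continuous xi -> continuous eta ->
  continuous (fun z : T * T => inner V (xi z.1) (eta z.2)).
Proof.
move=> cx ce [s t].
have c1 : (fun z : T * T => xi z.1) @ (s, t) --> xi s.
  apply: (@cvg_comp _ _ _ fst xi (nbhs (s, t)) (nbhs s)); first exact: cvg_fst.
  exact: cx.
have c2 : (fun z : T * T => eta z.2) @ (s, t) --> eta t.
  apply: (@cvg_comp _ _ _ snd eta (nbhs (s, t)) (nbhs t)); first exact: cvg_snd.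
  exact: ce.
suff : (fun z : T * T => inner V (xi z.1) (eta z.2)) @ (s, t) --> inner V (xi s) (eta t) by [].
rewrite (polarization (xi s)).
have -> : (fun z : T * T => inner V (xi z.1) (eta z.2)) = (fun z => 4^-1 *
    (`|xi z.1 + eta z.2| ^+ 2 - `|xi z.1 - eta z.2| ^+ 2 +
     'i * (`|xi z.1 + 'i *: eta z.2| ^+ 2 - `|xi z.1 - 'i *: eta z.2| ^+ 2))).
  by apply/funext => z; exact: polarization.
apply: cvgMr; apply: cvgD.
  by apply: cvgB; apply: cvg_norm2; [exact: cvgD|exact: cvgB].
apply: cvgMr; apply: cvgB; apply: cvg_norm2; [apply: cvgD => //|apply: cvgB => //];
  exact: cvgZr.
Qed.

End hilbert.

(** * The induced function *)

Section induced_function.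
Context {R : realType} {G H : topologicalGroupType} {d} {X : measurableType d}
  {mu : probability X R} (a : nonsingular_action G mu) (omega : G -> X -> H).
Hypotheses (hG : lcsc G) (hH : lcsc H) (hX : standard_borel R X)
  (homega : cocycle a omega).
Local Notation mf f := (measurable_fun setT f).
Local Notation mean := (mean mu).
Local Notation cmean := (complex_mean mu).
Local Notation L1 := (L1 mu).
Local Notation cL1 := (cL1 mu).
Local Notation C := R[i].
Local Notation Re := (@complex.Re R).
Local Notation Im := (@complex.Im R).

Variables (f : X -> R) (mff : mf f) (f0 : forall x, 0 <= f x)
  (Lf : L1 (fun x => f x ^+ 2)) (f1 : mean (fun x => f x ^+ 2) <= 1).
Local Notation kf := (koop a f).
Local Notation sg := (cocycle_inv omega).

(** The Koopman coefficient of [f], twisted by [phi] along the cocycle; for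
    [phi] = 1 it is the coefficient itself. *)
Definition induced (phi : H -> C) (k : G) : C :=
  cmean (fun x => (kf k^-1%g x * f x)%:C%C * phi (omega k x)).

(** The same average for a kernel on [H]; [induced_kernelE] relates both. *)
Definition induced_kernel (Q : H * H -> C) (g h : G) : C :=
  cmean (fun y => (kf g y * kf h y)%:C%C * Q (sg g y, sg h y)).

Lemma normcZ (r : R) (z : C) : 0 <= r -> normc (r%:C%C * z) = r * normc z.
Proof.
move=> r0; rewrite ComplexField.Normc.normcM; congr (_ * _).
by rewrite /= expr0n addr0 sqrtr_sqr ger0_norm.
Qed.

Lemma cL1_weighted (w : X -> R) (q : X -> C) (M : R) : L1 w -> (forall x, 0 <= w x) ->
  mf (fun x => Re (q x)) -> mf (fun x => Im (q x)) -> (forall x, normc (q x) <= M) ->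
  cL1 (fun x => (w x)%:C%C * q x).
Proof.
move=> Lw w0 mr mi qM; apply: (@cL1_le _ _ _ _ _ (fun x => M * w x)).
- have -> : (fun x => Re ((w x)%:C%C * q x)) = (fun x => w x * Re (q x)).
    by apply/funext => x; rewrite complexReM /= mul0r subr0.
  by apply: measurable_funM => //; exact: L1_mf Lw.
- have -> : (fun x => Im ((w x)%:C%C * q x)) = (fun x => w x * Im (q x)).
    by apply/funext => x; rewrite complexImM /= mul0r addr0.
  by apply: measurable_funM => //; exact: L1_mf Lw.
- by move=> x; rewrite normcZ// mulrC ler_wpM2r.
- exact: L1Z.
Qed.

Lemma koopV k x : kf k^-1%g x = f (a k x) * jac a k x.
Proof. by rewrite /koop invgK. Qed.

Lemma koopf_ge0 k x : 0 <= kf k^-1%g x * f x.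
Proof. by rewrite mulr_ge0// koop_ge0. Qed.

Lemma koopM_ge0 g h y : 0 <= kf g y * kf h y.
Proof. by rewrite mulr_ge0// koop_ge0. Qed.

Lemma L1_koopf k : L1 (fun x => kf k^-1%g x * f x).
Proof. by apply: L1_prod => //; [exact: mf_koop|exact: L1_koop2]. Qed.

Lemma mean_koopf k : mean (fun x => kf k^-1%g x * f x) <= 1.
Proof.
apply: (@le_trans _ _ (mean (fun x => 2^-1 * (kf k^-1%g x ^+ 2 + f x ^+ 2)))).
  apply: mean_le; first exact: L1_koopf.
    by apply: L1Z; apply: L1D => //; exact: L1_koop2.
  move=> x; move: (kf _ x) (f x) => p q.
  have : 0 <= (p - q) ^+ 2 by exact: sqr_ge0.
  have -> : (p - q) ^+ 2 = p ^+ 2 - 2 * (p * q) + q ^+ 2 by ring.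
  by move: (p * q) (p ^+ 2) (q ^+ 2) => r s t; lra.
have h := L1_koop2 a Lf k^-1%g.
rewrite (meanZ _ (L1D h Lf)) (meanD h Lf) mean_koop2//.
move: f1; move: (mean _) => m; lra.
Qed.

Section bounded_function.
Variables (phi : H -> C) (M : R).
Hypotheses (cphi : continuous phi) (phiM : forall s, normc (phi s) <= M).

Lemma comp_continuous (p : C -> R) (t : H * H -> H) :
  continuous p -> continuous t -> continuous (fun z => p (phi (t z))).
Proof.
move=> cp ct z; apply: (@cvg_comp _ _ _ t (p \o phi)); first exact: ct.
by apply: (@cvg_comp _ _ _ phi p); [exact: cphi|exact: cp].
Qed.

Lemma fst_continuous : continuous (fst : H * H -> H).
Proof. by move=> [s t]; exact: cvg_fst. Qed.

Lemma div_continuous : continuous (fun z : H * H => (z.1^-1 * z.2)%g).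
Proof.
move=> [s t]; apply: cvg_mulg; last exact: cvg_snd.
by apply: cvg_invg; exact: cvg_fst.
Qed.

Lemma cL1_induced k : cL1 (fun x => (kf k^-1%g x * f x)%:C%C * phi (omega k x)).
Proof.
apply: (@cL1_weighted _ _ M) => //; [exact: L1_koopf|exact: koopf_ge0| |].
  exact: (measurable_pair_continuous hH (measurable_omega homega k) (measurable_omega homega k)
    (comp_continuous Re_continuous fst_continuous)).
exact: (measurable_pair_continuous hH (measurable_omega homega k) (measurable_omega homega k)
    (comp_continuous Im_continuous fst_continuous)).
Qed.

(** The weight (koop k^-1 f) f has integral at most 1 by Cauchy-Schwarz. It is
    kept as a factor of [c] because it need not be 1: for c = 1 this compares
    [induced phi k] with a Koopman coefficient, for c = 0 with 0. *)
Lemma induced_close (c : C) (e : R) k : 0 <= e ->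
  {ae mu, forall x, kf k^-1%g x * f x != 0 -> normc (phi (omega k x) - c) <= e} ->
  normc (induced phi k - c * (mean (fun x => kf k^-1%g x * f x))%:C%C) <= e.
Proof.
move=> e0 h; rewrite -cmean_real.
have L1c : cL1 (fun x => (kf k^-1%g x * f x)%:C%C) by apply: cL1_real; exact: L1_koopf.
have -> : induced phi k - c * cmean (fun x => (kf k^-1%g x * f x)%:C%C) =
    cmean (fun x => (kf k^-1%g x * f x)%:C%C * phi (omega k x) + (- c) * (kf k^-1%g x * f x)%:C%C).
  by rewrite cmeanD ?cmeanZ ?mulNr//; [exact: cL1_induced|exact: cL1Z].
apply: (@le_trans _ _ (mean (fun x => e * (kf k^-1%g x * f x)))); last first.
  by rewrite meanZ ?ler_piMr ?mean_koopf//; exact: L1_koopf.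
apply: normc_cmean.
- by apply: cL1D; [exact: cL1_induced|exact: cL1Z].
- by apply: L1Z; exact: L1_koopf.
move: h; apply: filterS => x hx.
have -> : (kf k^-1%g x * f x)%:C%C * phi (omega k x) + - c * (kf k^-1%g x * f x)%:C%C =
    (kf k^-1%g x * f x)%:C%C * (phi (omega k x) - c) by ring.
rewrite normcZ ?koopf_ge0//; have [->|n0] := eqVneq (kf k^-1%g x * f x) 0.
  by rewrite mul0r mulr0.
by rewrite mulrC ler_wpM2r ?koopf_ge0 ?hx.
Qed.

(** Split the difference into the variation of the weight, bounded by
    [L2_continuous], and that of phi(omega(k, x)), bounded by
    [weight_continuous]. *)
Lemma induced_continuous : continuous (induced phi).
Proof.
have M0 : 0 <= M by apply: le_trans (phiM 1%g); exact: normc_ge0.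
move=> k0; have FF : Filter (nbhs k0) by exact: nbhs_filter.
apply/(@cvgrPdist_lt _ _ _ (nbhs k0) FF) => _ /complex_gt0E[e e0 ->].
pose M' := M + 1; have M'0 : 0 < M' by rewrite /M'; lra.
(* Parameter of the inequality 2 p q <= t p^2 + q^2 / t, which splits the
   product of the variation of koop with f. *)
pose t := 2 * M' / e; have t0 : 0 < t by rewrite divr_gt0// mulr_gt0.
have e1 : 0 < e / (2 * M' * t).
  by apply: divr_gt0 => //; apply: mulr_gt0 => //; exact: mulr_gt0.
have e4 : 0 < e / 8 by rewrite divr_gt0.
pose w x := kf k0^-1%g x * f x.
have w0 x : 0 <= w x by exact: koopf_ge0.
pose D (z : H * H) := normc (phi (z.1^-1)%g - phi (z.2^-1)%g).
have cD : continuous D.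
  move=> [s t']; apply: (@cvg_comp _ _ _ (fun z : H * H => phi (z.1^-1)%g - phi (z.2^-1)%g)
     (@normc R)); last exact: normc_continuous.
  have c1 : (fun z : H * H => phi (z.1^-1)%g) @ (s, t') --> phi (s^-1)%g.
    apply: (@cvg_comp _ _ _ (fun z : H * H => (z.1^-1)%g) phi _ (nbhs (s^-1)%g)).
      by apply: cvg_invg; exact: cvg_fst.
    exact: cphi.
  have c2 : (fun z : H * H => phi (z.2^-1)%g) @ (s, t') --> phi (t'^-1)%g.
    apply: (@cvg_comp _ _ _ (fun z : H * H => (z.2^-1)%g) phi _ (nbhs (t'^-1)%g)).
      by apply: cvg_invg; exact: cvg_snd.
    exact: cphi.
  exact: cvgB c1 c2.
have DM z : 0 <= D z <= 2 * M.
  rewrite normc_ge0 /=; apply: le_trans (le_normcD _ _) _; rewrite normcN.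
  by have := phiM (z.1^-1)%g; have := phiM (z.2^-1)%g; lra.
have D0 s : D (s, s) = 0 by rewrite /D /= subrr ComplexField.Normc.normc0.
have n1 := weight_continuous hG hH hX homega k0^-1%g (L1_koopf k0) (koopf_ge0 k0) cD DM D0 e4.
have n2 := L2_continuous a hG hX mff f0 Lf k0^-1%g e1.
have ck : (fun k => (k0 * k^-1)%g) @ k0 --> (1 : G)%g.
  rewrite -[X in _ --> X](mulgV k0); apply: cvg_mulg; first exact: cvg_cst.
  exact: invg_continuous.
have m1 : \forall k \near k0, mean (fun y => w y *
  D (sg k0^-1%g y, sg (k0^-1 * (k0 * k^-1))%g y)) <= e / 8 := ck _ n1.
have m2 : \forall k \near k0, mean (fun y => (kf (k0^-1 * (k0 * k^-1))%g y -
  kf k0^-1%g y) ^+ 2) <= e / (2 * M' * t) := ck _ n2.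
apply: filterS2 m1 m2 => k.
rewrite mulKg => h1 h2; rewrite normCE ltcR.
have Lp k' := cL1_induced k'.
have -> : induced phi k0 - induced phi k =
    cmean (fun x => (kf k0^-1%g x * f x)%:C%C * phi (omega k0 x) +
      (-1) * ((kf k^-1%g x * f x)%:C%C * phi (omega k x))).
  by rewrite cmeanD ?cmeanZ ?mulN1r//; exact: cL1Z.
pose b x := M' * (2^-1 * (t * (kf k^-1%g x - kf k0^-1%g x) ^+ 2 + t^-1 * f x ^+ 2)) +
   w x * D (sg k0^-1%g x, sg k^-1%g x).
have Lq := L1_koopB2 a mff Lf k^-1%g k0^-1%g.
have mD : mf (fun x => D (sg k0^-1%g x, sg k^-1%g x)).
  exact: (measurable_pair_continuous hH (measurable_cocycle_inv homega _) (measurable_cocycle_inv homega _) cD).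
have LwD : L1 (fun x => w x * D (sg k0^-1%g x, sg k^-1%g x)).
  apply: L1_le (L1Z (2 * M) (L1_koopf k0)).
    by apply: measurable_funM => //; exact: L1_mf (L1_koopf k0).
  move=> x; have /andP[? ?] := DM (sg k0^-1%g x, sg k^-1%g x).
  rewrite ger0_norm; last by rewrite mulr_ge0// w0.
  by rewrite mulrC; apply: ler_wpM2r => //; exact: w0.
have Lq2 := L1D (L1Z t Lq) (L1Z t^-1 Lf).
apply: (@le_lt_trans _ _ (mean b)); last first.
  rewrite /b (meanD (L1Z M' (L1Z 2^-1 Lq2)) LwD) (meanZ _ (L1Z 2^-1 Lq2)) (meanZ _ Lq2).
  rewrite (meanD (L1Z t Lq) (L1Z t^-1 Lf)) (meanZ _ Lq) (meanZ _ Lf).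
  have b1 : M' * (2^-1 * (t * mean (fun x => (kf k^-1%g x - kf k0^-1%g x) ^+ 2))) <= e / 4.
    apply: (@le_trans _ _ (M' * (2^-1 * (t * (e / (2 * M' * t)))))).
      by rewrite !ler_wpM2l// ltW.
    rewrite le_eqVlt; apply/orP; left; apply/eqP; field.
    by rewrite !gt_eqF.
  have b2 : M' * (2^-1 * (t^-1 * mean (fun x => f x ^+ 2))) <= e / 4.
    apply: (@le_trans _ _ (M' * (2^-1 * (t^-1 * 1)))).
      by rewrite !ler_wpM2l// ?invr_ge0 ltW.
    rewrite le_eqVlt; apply/orP; left; apply/eqP; rewrite /t; field.
    by rewrite !gt_eqF.
  by rewrite !mulrDr; move: b1 b2 h1; rewrite -/w; lra.
apply: normc_cmean.
- by apply: cL1D => //; exact: cL1Z.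
- by rewrite /b; apply: L1D => //; do 2 apply: L1Z.
apply: nearW => x; rewrite /b /w /D /cocycle_inv !invgK /=.
have -> : (kf k0^-1%g x * f x)%:C%C * phi (omega k0 x) +
      (-1) * ((kf k^-1%g x * f x)%:C%C * phi (omega k x)) =
   (kf k0^-1%g x * f x)%:C%C * (phi (omega k0 x) - phi (omega k x)) +
   ((kf k0^-1%g x - kf k^-1%g x) * f x)%:C%C * phi (omega k x).
  by rewrite mulrBl rmorphB /=; ring.
apply: le_trans (le_normcD _ _) _; rewrite normcZ ?koopf_ge0// addrC lerD2r.
rewrite ComplexField.Normc.normcM.
have -> : normc ((kf k0^-1%g x - kf k^-1%g x) * f x)%:C%C = `|kf k0^-1%g x - kf k^-1%g x| * f x.
  by rewrite /= expr0n addr0 sqrtr_sqr normrM (ger0_norm (f0 x)).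
rewrite mulrC; apply: ler_pM => //; rewrite ?mulr_ge0//; first exact: normc_ge0.
  by have := phiM (omega k x); rewrite /M'; lra.
rewrite -(real_normK (num_real (kf k^-1%g x - kf k0^-1%g x))) distrC.
move: (normr_ge0 (kf k^-1%g x - kf k0^-1%g x)) (f0 x); move: (`|_|) (f x) => p q p0 q0.
have tV : t * t^-1 = 1 by rewrite mulfV// gt_eqF.
have : 0 <= t^-1 * (t * p - q) ^+ 2 by rewrite mulr_ge0 ?sqr_ge0// invr_ge0 ltW.
have -> : t^-1 * (t * p - q) ^+ 2 = t * p ^+ 2 + t^-1 * q ^+ 2 - 2 * (p * q).
  by field; rewrite gt_eqF.
lra.
Qed.

End bounded_function.
End induced_function.

(** * The induced kernel *)

Lemma conj_real {R : realType} (r : R) : (r%:C%C)^* = r%:C%C :> R[i].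
Proof. by apply/CrealP/complex_realP; exists r. Qed.

Section induced_kernel.
Context {R : realType} {G H : topologicalGroupType} {d} {X : measurableType d}
  {mu : probability X R} (a : nonsingular_action G mu) (omega : G -> X -> H).
Hypotheses (hG : lcsc G) (hH : lcsc H) (hX : standard_borel R X)
  (homega : cocycle a omega).
Local Notation mf f := (measurable_fun setT f).
Local Notation mean := (mean mu).
Local Notation cmean := (complex_mean mu).
Local Notation L1 := (L1 mu).
Local Notation cL1 := (cL1 mu).
Local Notation C := R[i].
Local Notation Re := (@complex.Re R).
Local Notation Im := (@complex.Im R).

Variables (f : X -> R) (mff : mf f) (f0 : forall x, 0 <= f x)
  (Lf : L1 (fun x => f x ^+ 2)) (f1 : mean (fun x => f x ^+ 2) <= 1).
Local Notation kf := (koop a f).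
Local Notation sg := (cocycle_inv omega).
Local Notation psi := (induced a omega f).
Local Notation kern := (induced_kernel (mu := mu) a omega f).

Section bounded_kernel.
Variables (Q : H * H -> C) (M : R).
Hypotheses (cQ : continuous Q) (QM : forall z, normc (Q z) <= M).

Lemma cL1_induced_kernel g h : cL1 (fun y => (kf g y * kf h y)%:C%C * Q (sg g y, sg h y)).
Proof.
apply: (@cL1_weighted _ _ _ _ _ _ M) => //.
- exact: L1_koopM.
- by move=> y; exact: koopM_ge0.
- apply: (measurable_pair_continuous hH (measurable_cocycle_inv homega g) (measurable_cocycle_inv homega h)
    (Q := Re \o Q)).
  by move=> z; apply: (@cvg_comp _ _ _ Q Re); [exact: cQ|exact: Re_continuous].
- apply: (measurable_pair_continuous hH (measurable_cocycle_inv homega g) (measurable_cocycle_inv homega h)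
    (Q := Im \o Q)).
  by move=> z; apply: (@cvg_comp _ _ _ Q Im); [exact: cQ|exact: Im_continuous].
Qed.

End bounded_kernel.

Lemma cmean_jac2 h (u : X -> C) : cL1 u ->
  cL1 (fun x => (jac a h x ^+ 2)%:C%C * u (a h x)) /\
  cmean (fun x => (jac a h x ^+ 2)%:C%C * u (a h x)) = cmean u.
Proof.
have key (v : X -> R) : L1 v -> L1 (fun x => v (a h x) * jac a h x ^+ 2) /\
    mean (fun x => v (a h x) * jac a h x ^+ 2) = mean v.
  move=> Lv; have mv := mf_act a h (L1_mf Lv).
  have L' : L1 (fun x => v (a h (a h^-1%g x))).
    by apply: eq_integrable Lv => // x _; rewrite /= act_invr.
  have [h1 h2] := mean_jac2 mv L'; split=> //; rewrite h2.
  by apply: eq_mean => x; rewrite act_invr.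
move=> [Lr Li]; have [r1 r2] := key _ Lr; have [i1 i2] := key _ Li.
split; first split.
- apply: eq_integrable r1 => // x _; rewrite /= complexReM /= mul0r subr0; congr EFin.
  by rewrite mulrC.
- apply: eq_integrable i1 => // x _; rewrite /= complexImM /= mul0r addr0; congr EFin.
  by rewrite mulrC.
rewrite /complex_mean -r2 -i2; congr (_ +i* _)%C; apply: eq_mean => x.
  by rewrite complexReM /= mul0r subr0 mulrC.
by rewrite complexImM /= mul0r addr0 mulrC.
Qed.

(** Substitute y = h x in the kernel: the Jacobians combine by the chain rule
    and omega(g^-1, hx)^-1 is carried to omega(g^-1 h, x) by the cocycle
    identity. In particular the kernel depends on g^-1 h alone. *)
Lemma induced_kernelE (phi : H -> C) (M : R) g h : continuous phi ->
  (forall s, normc (phi s) <= M) ->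
  kern (fun z => phi (z.1^-1 * z.2)%g) g h = psi phi (g^-1 * h)%g.
Proof.
move=> cphi phiM.
have cQ : continuous (fun z : H * H => phi (z.1^-1 * z.2)%g).
  move=> z; apply: (@cvg_comp _ _ _ (fun z : H * H => (z.1^-1 * z.2)%g) phi).
    exact: div_continuous.
  exact: cphi.
have LK := cL1_induced_kernel cQ (fun z => phiM _) g h.
rewrite /induced_kernel; have [Lc <-] := cmean_jac2 h LK.
apply: cmean_ae => //; first exact: (cL1_induced hH homega mff f0 Lf cphi phiM).
have jj : {ae mu, forall x, jac a h^-1%g (a h x) * jac a h x = 1 /\
    jac a (g^-1 * h)%g x = jac a g^-1%g (a h x) * jac a h x}.
  by move: (jacV a h) (jacM a g^-1%g h); apply: filterS2.
move: jj.
have := proj2 homega g^-1%g h; have := omegaV homega h.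
apply: filterS3 => x o1 o2 [j1 j2].
rewrite koopV j2 /koop /cocycle_inv o1 !invgK o2 mulrA -rmorphM /=; congr (_%:C%C * _).
rewrite act_inv actM.
(* The Jacobians of h at x and of h^-1 at hx are inverse to each other. *)
transitivity (f (a g^-1%g (a h x)) * jac a g^-1%g (a h x) * f x * jac a h x *
   (jac a h^-1%g (a h x) * jac a h x)); first by ring.
by rewrite j1; ring.
Qed.

(** For fixed y the integrand is the quadratic form of phi at the points
    [cocycle_inv (g i) y], with coefficients scaled by the real numbers [koop
    (g i) f y]. *)
Lemma induced_positive (phi : H -> C) (M : R) : continuous phi ->
  (forall s, normc (phi s) <= M) -> positive_type phi -> positive_type (psi phi).
Proof.
move=> cphi phiM pphi n g c.
have cQ : continuous (fun z : H * H => phi (z.1^-1 * z.2)%g).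
  move=> z; apply: (@cvg_comp _ _ _ (fun z : H * H => (z.1^-1 * z.2)%g) phi).
    exact: div_continuous.
  exact: cphi.
have LK i j := cL1_induced_kernel cQ (fun z => phiM _) (g i) (g j).
have -> : \sum_i \sum_j (c i)^* * c j * psi phi ((g i)^-1 * g j)%g =
  cmean (fun y => \sum_i \sum_j (c i)^* * c j *
    ((kf (g i) y * kf (g j) y)%:C%C * phi ((sg (g i) y)^-1 * sg (g j) y)%g)).
  rewrite cmean_sum => [|i]; last by apply: cL1_sum => j; apply: cL1Z; exact: LK.
  apply: eq_bigr => i _; rewrite cmean_sum => [|j]; last by apply: cL1Z; exact: LK.
  by apply: eq_bigr => j _; rewrite (cmeanZ _ (LK i j)) -(induced_kernelE _ _ cphi phiM).
apply: cmean_ge0 => y.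
have := pphi n (fun i => sg (g i) y) (fun i => (kf (g i) y)%:C%C * c i).
congr (_ <= _); apply: eq_bigr => i _; apply: eq_bigr => j _.
have -> : ((kf (g i) y)%:C%C * c i)^* = (kf (g i) y)%:C%C * (c i)^*.
  rewrite rmorphM /=; congr (_ * _); apply/CrealP/complex_realP.
  by exists (kf (g i) y).
have -> : (kf (g i) y * kf (g j) y)%:C%C = (kf (g i) y)%:C%C * (kf (g j) y)%:C%C :> C.
  by rewrite rmorphM.
move: (phi _) (_%:C%C) (_%:C%C) (c i)^* (c j) => p q r s t; ring.
Qed.

Section schur_multiplier.
Variables (V : hilbertType R) (zeta : bool -> H -> V) (M : bool -> R).
Hypotheses (czeta : forall b, continuous (zeta b))
  (zetaM : forall b s, `|zeta b s| <= (M b)%:C%C).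

Let Q (i j : bool) (z : H * H) : C := inner V (zeta i z.1) (zeta j z.2).

Let cQ i j : continuous (Q i j).
Proof. exact: inner_continuous. Qed.

Let M0 b : 0 <= M b.
Proof. by rewrite -lecR; exact: le_trans (zetaM b 1%g). Qed.

Let QM i j z : normc (Q i j z) <= M i * M j.
Proof.
rewrite -lecR -normCE; apply: le_trans (inner_cs _ _) _.
by rewrite rmorphM /=; apply: ler_pM.
Qed.

(** The Gram kernel of both families at once: the index [b] tells which of
    [zeta true] and [zeta false] is transported, and the vectors of both have
    to lie in one Hilbert space. *)
Definition multiplier_ker (p q : bool * G) : C := kern (Q p.1 q.1) p.2 q.2.

Lemma multiplier_ker_conj p q : multiplier_ker q p = (multiplier_ker p q)^*.
Proof.
rewrite /multiplier_ker /induced_kernel -(cmean_conj (cL1_induced_kernel (@cQ p.1 q.1) (QM p.1 q.1) p.2 q.2)).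
apply: eq_cmean => y; rewrite [RHS]rmorphM /= conj_real /Q /=.
by rewrite (innerC (zeta p.1 (sg p.2 y))) (mulrC (kf q.2 y)).
Qed.

Let vec (p : bool * G) y : V := (kf p.2 y)%:C%C *: zeta p.1 (sg p.2 y).

Lemma inner_vec p q y : inner V (vec p y) (vec q y) =
  (kf p.2 y * kf q.2 y)%:C%C * Q p.1 q.1 (sg p.2 y, sg q.2 y).
Proof.
by rewrite /vec innerZl innerZr conj_real /Q /= mulrA -rmorphM.
Qed.

Let L1_vec p q : cL1 (fun y => inner V (vec p y) (vec q y)).
Proof.
have := cL1_induced_kernel (@cQ p.1 q.1) (QM p.1 q.1) p.2 q.2.
by congr cL1; apply/funext => y; rewrite inner_vec.
Qed.

Lemma multiplier_kerE p q : multiplier_ker p q = cmean (fun y => inner V (vec p y) (vec q y)).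
Proof. by apply: eq_cmean => y; rewrite inner_vec. Qed.

Lemma cL1_combination n (s : 'I_n -> bool * G) (c : 'I_n -> C) :
  cL1 (fun y => inner V (\sum_i c i *: vec (s i) y) (\sum_i c i *: vec (s i) y)).
Proof.
have : cL1 (fun y => \sum_i \sum_j c i * (c j)^* * inner V (vec (s i) y) (vec (s j) y)).
  by apply: cL1_sum => i; apply: cL1_sum => j; exact: cL1Z.
by congr cL1; apply/funext => y; rewrite inner_sum.
Qed.

Lemma multiplier_ker_sum n (s : 'I_n -> bool * G) (c : 'I_n -> C) :
  \sum_i \sum_j c i * (c j)^* * multiplier_ker (s i) (s j) =
  cmean (fun y => inner V (\sum_i c i *: vec (s i) y) (\sum_i c i *: vec (s i) y)).
Proof.
transitivity (cmean (fun y => \sum_i \sum_j c i * (c j)^* * inner V (vec (s i) y) (vec (s j) y))).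
  rewrite cmean_sum => [|i]; last by apply: cL1_sum => j; exact: cL1Z.
  apply: eq_bigr => i _; rewrite cmean_sum => [|j]; last exact: cL1Z.
  by apply: eq_bigr => j _; rewrite cmeanZ// multiplier_kerE.
by apply: eq_cmean => y; rewrite inner_sum.
Qed.

Lemma multiplier_ker_psd n (s : 'I_n -> bool * G) (c : 'I_n -> C) :
  0 <= \sum_i \sum_j c i * (c j)^* * multiplier_ker (s i) (s j).
Proof. by rewrite multiplier_ker_sum; apply: cmean_ge0 => y; exact: inner_ge0. Qed.

Lemma norm_realE (W : hilbertType R) (w : W) : `|w| = (Re `|w|)%:C%C.
Proof. by rewrite RRe_real// ger0_real. Qed.

(** |r zeta_s - r' zeta_s'|^2 <= 2 |r - r'|^2 |zeta_s'|^2 + 2 r^2 |zeta_s -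
    zeta_s'|^2. *)
Lemma vec_diff_le b g0 k y : Re (`|vec (b, g0) y - vec (b, k) y| ^+ 2) <=
  2 * M b ^+ 2 * (kf k y - kf g0 y) ^+ 2 +
  2 * (kf g0 y ^+ 2 * Re (`|zeta b (sg g0 y) - zeta b (sg k y)| ^+ 2)).
Proof.
rewrite (norm_realE (_ - vec _ _)) (norm_realE (_ - zeta _ _)) -!rmorphXn /=.
set p := Re _; set q := Re _.
have q0 : 0 <= q by rewrite -lecR /q -norm_realE normr_ge0.
have p0 : 0 <= p by rewrite -lecR /p -norm_realE normr_ge0.
pose r : R := `|kf g0 y - kf k y|.
have rE : (kf k y - kf g0 y) ^+ 2 = r ^+ 2.
  by rewrite /r real_normK ?num_real// -sqrrN opprB.
have r0 : 0 <= r by exact: normr_ge0.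
have : p <= r * M b + kf g0 y * q.
  rewrite -lecR -norm_realE.
  have -> : vec (b, g0) y - vec (b, k) y =
      (kf g0 y - kf k y)%:C%C *: zeta b (sg k y) +
      (kf g0 y)%:C%C *: (zeta b (sg g0 y) - zeta b (sg k y)).
    by rewrite /vec /= rmorphB /= scalerBl scalerBr [RHS]addrC subrKA.
  apply: le_trans (ler_normD _ _) _; rewrite !normrZ.
  have -> : (r * M b + kf g0 y * q)%:C%C =
    r%:C%C * (M b)%:C%C + (kf g0 y)%:C%C * q%:C%C :> C.
    by rewrite rmorphD !rmorphM.
  have nr (r' : R) : `|r'%:C%C| = `|r'|%:C%C :> C.
    by rewrite normCE /= expr0n addr0 sqrtr_sqr.
  rewrite !nr (ger0_norm (koop_ge0 a f0 g0 y)); apply: lerD.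
    by apply: ler_wpM2l => //; rewrite ler0c.
  by rewrite /q -norm_realE.
rewrite rE; move: (koop_ge0 a f0 g0 y) (M0 b) r0; clear rE.
move: (kf g0 y) (M b) r => s m r s0 m0 r0 h.
have h2 : p ^+ 2 <= (r * m + s * q) ^+ 2.
  have t0 : 0 <= r * m + s * q by exact: le_trans p0 h.
  by apply: lerXn2r; rewrite ?nnegrE.
apply: le_trans h2 _; rewrite -subr_ge0.
have -> : 2 * m ^+ 2 * r ^+ 2 + 2 * (s ^+ 2 * q ^+ 2) - (r * m + s * q) ^+ 2 =
   (r * m - s * q) ^+ 2 by ring.
exact: sqr_ge0.
Qed.

(** The vectors are those of Kolmogorov's construction for [multiplier_ker]. As
    |v_g|^2 is the integral of (koop g f)^2 |zeta|^2, their norms are at most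
    those of zeta; |v_g - v_k|^2 is the integral of |vec g - vec k|^2 and tends
    to 0 by [vec_diff_le], [L2_continuous] and [weight_continuous]. *)
Lemma multiplier_vectors : exists (W : hilbertType R) (v : bool -> G -> W),
  [/\ forall i j g h, inner W (v i g) (v j h) = kern (Q i j) g h,
      forall b, continuous (v b) & forall b g, `|v b g| <= (M b)%:C%C].
Proof.
have [W [v vE]] := kolmogorov (PsdKernel multiplier_ker_conj multiplier_ker_psd).
exists W, (fun b g => v (b, g)); split=> [i j g h|b|b g].
- exact: vE.
- move=> g0; have FF : Filter (nbhs g0) by exact: nbhs_filter.
  apply/(@cvgrPdist_lt _ _ _ (nbhs g0) FF) => _ /complex_gt0E[e e0 ->].
  have e2 : 0 < e ^+ 2 by rewrite exprn_gt0.
  pose D (z : H * H) : R := Re (`|zeta b z.1 - zeta b z.2| ^+ 2).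
  have D_real z : `|zeta b z.1 - zeta b z.2| ^+ 2 = (D z)%:C%C.
    by rewrite RRe_real// ger0_real// exprn_ge0.
  have cD : continuous D.
    move=> [s t]; apply: (@cvg_comp _ _ _ (fun z : H * H => `|zeta b z.1 - zeta b z.2| ^+ 2) Re);
      last exact: Re_continuous.
    have c1 : (fun z : H * H => zeta b z.1) @ (s, t) --> zeta b s.
      apply: (@cvg_comp _ _ _ fst (zeta b) (nbhs (s, t)) (nbhs s)); first exact: cvg_fst.
      exact: czeta.
    have c2 : (fun z : H * H => zeta b z.2) @ (s, t) --> zeta b t.
      apply: (@cvg_comp _ _ _ snd (zeta b) (nbhs (s, t)) (nbhs t)); first exact: cvg_snd.
      exact: czeta.
    exact: (cvg_norm2 (cvgB c1 c2)).
  have DM z : 0 <= D z <= (2 * M b) ^+ 2.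
    have -> : 2 * M b = M b + M b by ring.
    have MM : 0 <= M b + M b by rewrite addr_ge0.
    rewrite -!lecR -D_real exprn_ge0//= rmorphXn /= lerXn2r ?nnegrE ?ler0c//.
    by apply: le_trans (ler_normB _ _) _; rewrite rmorphD /= lerD.
  have D0 s : D (s, s) = 0 by rewrite /D /= subrr normr0 expr0n.
  have M1 : 0 < 8 * (M b ^+ 2 + 1) by rewrite mulr_gt0// ltr_wpDl// sqr_ge0.
  have e3 := divr_gt0 e2 M1; have e8 : 0 < e ^+ 2 / 8 by rewrite divr_gt0.
  have n1 := weight_continuous hG hH hX homega g0 (L1_koop2 a Lf g0)
    (fun y => sqr_ge0 (kf g0 y)) cD DM D0 e8.
  have n2 := L2_continuous a hG hX mff f0 Lf g0 e3.
  have ck : (fun k => (g0^-1 * k)%g) @ g0 --> (1 : G)%g.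
    by rewrite -[X in _ --> X](mulVg g0); exact: mulgl_continuous.
  have m1 : \forall k \near g0, mean (fun y => kf g0 y ^+ 2 *
    D (sg g0 y, sg (g0 * (g0^-1 * k))%g y)) <= e ^+ 2 / 8 := ck _ n1.
  have m2 : \forall k \near g0, mean (fun y => (kf (g0 * (g0^-1 * k))%g y -
    kf g0 y) ^+ 2) <= e ^+ 2 / (8 * (M b ^+ 2 + 1)) := ck _ n2.
  apply: filterS2 m1 m2 => k; rewrite mulVKg => h1 h2.
  rewrite -(@ltr_pXn2r _ 2) ?nnegrE ?ler0c//; last exact: ltW.
  rewrite -inner_norm -rmorphXn /=.
  pose c (i : 'I_2) : C := if i == ord0 then 1 else -1.
  pose p (i : 'I_2) : bool * G := if i == ord0 then (b, g0) else (b, k).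
  pose u y := vec (b, g0) y - vec (b, k) y.
  have uE y : u y = \sum_i c i *: vec (p i) y.
    by rewrite big_ord_recl big_ord1 /= scale1r scaleN1r.
  have vB : v (b, g0) - v (b, k) = \sum_i c i *: v (p i).
    by rewrite big_ord_recl big_ord1 /= scale1r scaleN1r.
  have innerE y : inner V (u y) (u y) = (Re (`|u y| ^+ 2))%:C%C.
    by rewrite inner_norm RRe_real// ger0_real// exprn_ge0.
  have nE : inner W (v (b, g0) - v (b, k)) (v (b, g0) - v (b, k)) =
      (mean (fun y => Re (`|u y| ^+ 2)))%:C%C.
    rewrite -cmean_real vB -inner_sum.
    transitivity (\sum_i \sum_j c i * (c j)^* * multiplier_ker (p i) (p j)).
      by apply: eq_bigr => i _; apply: eq_bigr => j _; rewrite vE.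
    by rewrite multiplier_ker_sum; apply: eq_cmean => y; rewrite -uE innerE.
  rewrite nE ltcR.
  have Lq := L1_koopB2 a mff Lf k g0.
  have mD : mf (fun y => D (sg g0 y, sg k y)).
    exact: (measurable_pair_continuous hH (measurable_cocycle_inv homega _) (measurable_cocycle_inv homega _) cD).
  have LwD : L1 (fun y => kf g0 y ^+ 2 * D (sg g0 y, sg k y)).
    apply: L1_le (L1Z ((2 * M b) ^+ 2) (L1_koop2 a Lf g0)).
      by apply: measurable_funM => //; exact: L1_mf (L1_koop2 a Lf g0).
    move=> y; have /andP[d1 d2] := DM (sg g0 y, sg k y).
    rewrite ger0_norm; last by apply: mulr_ge0 => //; exact: sqr_ge0.
    by rewrite mulrC; apply: ler_wpM2r => //; exact: sqr_ge0.
  have Lb := L1D (L1Z (2 * M b ^+ 2) Lq) (L1Z 2 LwD).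
  have Lu : L1 (fun y => Re (`|u y| ^+ 2)).
    have [h _] := cL1_combination p c.
    by apply: eq_integrable h => // y _; rewrite /= -uE innerE.
  apply: (@le_lt_trans _ _ (mean (fun y => 2 * M b ^+ 2 * (kf k y - kf g0 y) ^+ 2 +
     2 * (kf g0 y ^+ 2 * D (sg g0 y, sg k y))))).
    by apply: mean_le => // y; exact: vec_diff_le.
  rewrite (meanD (L1Z (2 * M b ^+ 2) Lq) (L1Z 2 LwD)) (meanZ _ Lq) (meanZ _ LwD).
  have : 2 * M b ^+ 2 * mean (fun y => (kf k y - kf g0 y) ^+ 2) <= e ^+ 2 / 4.
    apply: (@le_trans _ _ (2 * (M b ^+ 2 + 1) * (e ^+ 2 / (8 * (M b ^+ 2 + 1))))).
      apply: ler_pM => //; first by rewrite mulr_ge0// sqr_ge0.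
        by apply: mean_ge0 => y; exact: sqr_ge0.
      by rewrite ler_wpM2l// lerDl.
    rewrite le_eqVlt; apply/orP; left; apply/eqP; field.
    by rewrite gt_eqF// ltr_wpDl// sqr_ge0.
  by move: h1 e2; rewrite -/(D _); move: (mean _) (mean _) => r1 r2; lra.
- rewrite -(@ler_pXn2r _ 2) ?nnegrE//; last by rewrite ler0c.
  rewrite -inner_norm vE /= multiplier_kerE.
  rewrite (@eq_cmean _ _ _ _ _ (fun y => (Re (`|vec (b, g) y| ^+ 2))%:C%C)); last first.
    by move=> y; rewrite inner_norm RRe_real// ger0_real// exprn_ge0.
  rewrite cmean_real -rmorphXn /= lecR.
  apply: (@le_trans _ _ (mean (fun y => M b ^+ 2 * kf g y ^+ 2))); last first.
    by rewrite (meanZ _ (L1_koop2 a Lf g)) (mean_koop2 a Lf g) ler_piMr// sqr_ge0.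
  apply: mean_le.
  + have [h _] := L1_vec (b, g) (b, g).
    by apply: eq_integrable h => // y _; rewrite /= inner_norm.
  + by apply: L1Z; exact: L1_koop2.
  move=> y; rewrite (norm_realE (vec _ _)) -rmorphXn /= -exprMn.
  have kg : 0 <= kf g y by exact: koop_ge0.
  apply: lerXn2r; rewrite ?nnegrE; [|exact: mulr_ge0|].
    by rewrite -lecR -norm_realE normr_ge0.
  rewrite -lecR -norm_realE.
  have -> : vec (b, g) y = (kf g y)%:C%C *: zeta b (sg g y) by [].
  have -> : (M b * kf g y)%:C%C = (kf g y)%:C%C * (M b)%:C%C :> C by rewrite mulrC rmorphM.
  have e : `|(kf g y)%:C%C| = (kf g y)%:C%C :> C by rewrite ger0_norm// ler0c.
  by rewrite normrZ e; apply: ler_wpM2l => //; rewrite ler0c.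
Qed.

End schur_multiplier.
End induced_kernel.

(** * Uniform convergence on compact sets and L2 norms *)

Section compact_convergence.
Context {R : realType} {G : topologicalGroupType}.

Lemma cvg_to_1P (phi : nat -> G -> R[i]) : cvg_to_1 phi <->
  forall K, compact K -> forall e : R, 0 < e ->
    exists N, forall n, (N <= n)%N -> forall g, K g -> normc (phi n g - 1) < e.
Proof.
have FF : Filter (phi @ \oo) by exact: fmap_filter.
split=> [/fam_cvgP h K cK e e0|h]; last first.
  apply/fam_cvgP => K cK P /uniform_nbhs[E [entE EP]].
  move: entE; rewrite -entourage_ballE => -[e /= e0 eE].
  have [r r0 rE] := complex_gt0E e0.
  have [N hN] := h K cK r r0; exists N => // n Nn; apply: EP => g Kg.
  apply: eE; rewrite /= -ball_normE /= -opprB normrN normCE rE ltcR.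
  exact: hN.
have eC : (0 : R[i]) < e%:C%C by rewrite ltcR.
have : nbhs ((fun=> 1) : {uniform` K -> R[i]})
    [set u | forall g, K g -> normc (u g - 1) < e].
  apply/uniform_nbhs; exists [set xy | ball xy.1 e%:C%C xy.2]; split.
    exact: (entourage_ball _ (PosNum eC)).
  move=> u /= hu g Kg; have := hu g Kg; rewrite /= -ball_normE /= -opprB normrN normCE ltcR.
  by [].
by move=> /(h K cK)[N _ hN]; exists N => // n Nn; exact: hN.
Qed.

(** The norms in the definition of an amenable pair are extended reals, where
    closeness to 0 is read off the uniform structure. *)
Lemma cvg_to_0E (phi : nat -> G -> \bar R) :
  {family compact, phi @ \oo --> (fun _ : G => 0%E : \bar R)} ->
  forall K, compact K -> forall e : R, 0 < e ->
    exists N, forall n, (N <= n)%N -> forall g, K g -> (phi n g < e%:E)%E.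
Proof.
have FF : Filter (phi @ \oo) by exact: fmap_filter.
move=> /fam_cvgP h K cK e e0.
have : nbhs (0%E : \bar R) [set y | (y < e%:E)%E].
  by apply: open_nbhs_nbhs; split; [exact: open_ereal_lt_ereal|rewrite /= lte_fin].
rewrite -nbhs_entourageE => -[E entE /= EU].
have : nbhs ((fun=> 0%E) : {uniform` K -> \bar R})
    [set u | forall g, K g -> (u g < e%:E)%E].
  apply/uniform_nbhs; exists E; split=> // u /= hu g Kg.
  by apply: EU; apply/xsectionP; exact: hu.
by move=> /(h K cK)[N _ hN]; exists N => // n Nn; exact: hN.
Qed.

End compact_convergence.

Section L2_norm.
Context {R : realType} {d} {X : measurableType d} (mu : probability X R).
Local Notation C := R[i].

Lemma measurable_normc (xi : X -> C) :
  (forall U : set C, open U -> measurable (xi @^-1` U)) ->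
  measurable_fun setT (fun x => normc (xi x)).
Proof.
move=> mxi; apply: measurable_fun_of_open => U oU.
rewrite (_ : _ @^-1` U = xi @^-1` (@normc R @^-1` U)); last by [].
by apply: mxi; apply: open_comp => // z _; exact: normc_continuous.
Qed.

Lemma L2norm_sqr (xi : X -> C) :
  ((L2norm mu xi) `^ 2 = \int[mu]_x ((normc (xi x)) ^+ 2)%:E)%E.
Proof.
rewrite /L2norm poweR_Lnorm//; apply: eq_integral => x _.
rewrite -[X in (X `^ _)%E]/((`|normc (xi x)|%:E)) poweR_EFin powR_mulrn//.
by rewrite ger0_norm// normc_ge0.
Qed.

Lemma L2norm_le (xi : X -> C) (c : R) : measurable_fun setT (fun x => normc (xi x)) ->
  (L2norm mu xi <= c%:E)%E ->
  L1 mu (fun x => normc (xi x) ^+ 2) /\ mean mu (fun x => normc (xi x) ^+ 2) <= c ^+ 2.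
Proof.
move=> mx hc.
have n0 : (0 <= L2norm mu xi)%E by exact: Lnorm_ge0.
have c0 : 0 <= c by rewrite -lee_fin; exact: le_trans hc.
have : (\int[mu]_x ((normc (xi x)) ^+ 2)%:E <= (c ^+ 2)%:E)%E.
  rewrite -L2norm_sqr; apply: (@le_trans _ _ (c%:E `^ 2)%E).
    by apply: gt0_ler_poweR => //; rewrite in_itv /= ?n0 ?lee_fin ?c0 leey.
  by rewrite poweR_EFin powR_mulrn.
move=> hle; split.
  apply/integrableP; split; first by apply/measurable_EFinP; exact: measurable_funX.
  apply: le_lt_trans (ltry (c ^+ 2)); apply: le_trans hle.
  rewrite le_eqVlt; apply/orP; left; apply/eqP; apply: eq_integral => x _.
  by rewrite /= ger0_norm// sqr_ge0.
have n1 : (0 <= \int[mu]_x ((normc (xi x)) ^+ 2)%:E)%E.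
  by apply: integral_ge0 => x _; rewrite lee_fin sqr_ge0.
rewrite -lee_fin /mean /Rintegral fineK// ge0_fin_numE//.
by apply: le_lt_trans hle _; rewrite ltry.
Qed.

Lemma L2norm_eq1 (xi : X -> C) : L2norm mu xi = 1%E ->
  mean mu (fun x => normc (xi x) ^+ 2) = 1.
Proof. by move=> e; rewrite /mean /Rintegral -L2norm_sqr e poweR1r. Qed.

End L2_norm.

(** * Truncating an almost invariant vector *)

Lemma normc_real_sub1 {R : realType} (r : R) : r <= 1 -> normc (r%:C%C - 1 : R[i]) = 1 - r.
Proof.
move=> r1; rewrite /= oppr0 addr0 expr0n addr0 sqrtr_sqr ler0_norm ?opprB//.
by rewrite subr_le0.
Qed.

Section overlap.
Context {R : realType} {G : topologicalGroupType} {d} {X : measurableType d}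
  {mu : probability X R} (a : nonsingular_action G mu).
Local Notation mf f := (measurable_fun setT f).
Local Notation mean := (mean mu).
Local Notation L1 := (L1 mu).
Local Notation C := R[i].

Lemma normc_koopman (xi : X -> C) k x :
  `|normc (xi x) - koop a (fun y => normc (xi y)) k^-1%g x| <=
  normc (xi x - koopman a k^-1%g xi x).
Proof.
rewrite koopV /koopman invgK -/(jac a k x).
have <- : normc (xi (a k x) * (jac a k x)%:C%C) = normc (xi (a k x)) * jac a k x.
  by rewrite mulrC normcZ ?jac_ge0// mulrC.
exact: normc_sub_le.
Qed.

Lemma mf_Re (xi : X -> C) : (forall U : set C, open U -> measurable (xi @^-1` U)) ->
  mf (fun x => complex.Re (xi x)) /\ mf (fun x => complex.Im (xi x)).
Proof.
move=> mxi; split; apply: measurable_fun_of_open => U oU.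
  rewrite (_ : _ @^-1` U = xi @^-1` (@complex.Re R @^-1` U)); last by [].
  by apply: mxi; apply: open_comp => // z _; exact: Re_continuous.
rewrite (_ : _ @^-1` U = xi @^-1` (@complex.Im R @^-1` U)); last by [].
by apply: mxi; apply: open_comp => // z _; exact: Im_continuous.
Qed.

Lemma mf_normc_koopman (xi : X -> C) k :
  (forall U : set C, open U -> measurable (xi @^-1` U)) ->
  mf (fun x => normc (xi x - koopman a k^-1%g xi x)).
Proof.
move=> /mf_Re[mr mi].
have mre (h : X -> R) : mf h -> mf (fun x => h x - h (a k x) * jac a k x).
  by move=> mh; apply: measurable_funB => //; apply: measurable_funM;
    [exact: mf_act|exact: mf_jac].
have -> : (fun x => normc (xi x - koopman a k^-1%g xi x)) = (fun x => Num.sqrt (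
    (complex.Re (xi x) - complex.Re (xi (a k x)) * jac a k x) ^+ 2 +
    (complex.Im (xi x) - complex.Im (xi (a k x)) * jac a k x) ^+ 2)).
  apply/funext => x; rewrite /koopman invgK -/(jac a k x).
  case: (xi x) => p q; case: (xi (a k x)) => p' q' /=.
  by congr (Num.sqrt (_ ^+ 2 + _ ^+ 2)); ring.
apply: measurableT_comp; first by apply: continuous_measurable_fun; exact: sqrt_continuous.
by apply: measurable_funD; apply: measurable_funX; exact: mre.
Qed.

(** Passing to the modulus keeps a unit vector almost invariant; cutting it off
    puts its support inside a member of the proper family. *)
Definition truncation (xi : X -> C) (A : set X) (x : X) : R := normc (xi x) * \1_A x.

(** Without truncation the overlap of u = |xi| with its translate is 1 - |u -
    koop u|^2 / 2, and | |xi| - koop |xi| | <= |xi - koopman xi| pointwise.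
    Truncation loses the products that involve r = u 1_(~A); Young's inequality
    bounds them by t times squares of u and 1/t times squares of r, and the
    mean of r^2 is at most t^2. *)
Lemma overlap_truncated (xi : X -> C) (A : set X) (t alpha : R) (k : G) :
  (forall U : set C, open U -> measurable (xi @^-1` U)) ->
  L2norm mu xi = 1%E -> measurable A -> 0 < t ->
  mean (fun x => normc (xi x) ^+ 2 * \1_(~` A) x) <= t ^+ 2 ->
  (L2norm mu (fun x => (xi x - koopman a k^-1%g xi x)%R) <= alpha%:E)%E ->
  1 - 2 * t - alpha ^+ 2 / 2 <=
  mean (fun x => koop a (truncation xi A) k^-1%g x * truncation xi A x).
Proof.
move=> mxi xi1 mA t0 small close.
set f := truncation xi A.
pose u x := normc (xi x); pose r x := u x * \1_(~` A) x.
pose D x := normc (xi x - koopman a k^-1%g xi x) ^+ 2.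
have mu_ : mf u by exact: measurable_normc.
have mf1 (B : set X) : measurable B -> mf (fun x => u x * \1_B x).
  by move=> mB; apply: measurable_funM => //; exact: measurable_indic.
have [Lu _] : L1 (fun x => u x ^+ 2) /\ mean (fun x => u x ^+ 2) <= 1 ^+ 2.
  by apply: L2norm_le => //; rewrite xi1.
have eu : mean (fun x => u x ^+ 2) = 1 by exact: L2norm_eq1.
have [LD eD] : L1 D /\ mean D <= alpha ^+ 2.
  by apply: L2norm_le => //; exact: mf_normc_koopman.
have indic2 (B : set X) x : (u x * \1_B x) ^+ 2 = u x ^+ 2 * \1_B x.
  by rewrite indicE; case: (x \in B) => /=; ring.
have L2B (B : set X) : measurable B -> L1 (fun x => (u x * \1_B x) ^+ 2).
  move=> mB; rewrite (_ : (fun x => _) = fun x => u x ^+ 2 * \1_B x).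
    exact: L1_indic.
  by apply/funext => x.
have mC : measurable (~` A) by exact: measurableC.
have er : mean (fun x => r x ^+ 2) <= t ^+ 2.
  by apply: le_trans small; rewrite le_eqVlt (@eq_mean _ _ _ mu _ _ (indic2 _)) eqxx.
have Lpu := L1_koop2 a Lu k^-1%g; have epu := mean_koop2 a Lu k^-1%g.
have Lr : L1 (fun x => r x ^+ 2) by exact: L2B.
have Lpr := L1_koop2 a Lr k^-1%g; have epr := mean_koop2 a Lr k^-1%g.
have LS := L1D Lpu Lu; have LQ := L1D Lr Lpr.
have LE := L1B (L1B (L1Z (1 / 2 - t / 2) LS) (L1Z 2^-1 LD)) (L1Z (t^-1 / 2) LQ).
have tV : 0 < t^-1 by rewrite invr_gt0.
apply: (@le_trans _ _ (mean (fun x => (1 / 2 - t / 2) * (koop a u k^-1%g x ^+ 2 + u x ^+ 2)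
    - 2^-1 * D x - t^-1 / 2 * (r x ^+ 2 + koop a r k^-1%g x ^+ 2)))).
  rewrite meanB; [|exact: L1B (L1Z _ LS) (L1Z _ LD)|exact: L1Z].
  rewrite meanB; [|exact: L1Z|exact: L1Z].
  rewrite !meanZ// !meanD// epu epr eu.
  have : t^-1 * mean (fun x => r x ^+ 2) <= t.
    by rewrite mulrC ler_pdivrMr// -expr2.
  move: (mean D) eD (mean _) er => m1 h1 m2 h2 h3; lra.
apply: mean_le => //.
  by apply: L1_koopf; [exact: mf1|exact: L2B].
move=> x.
have := normc_koopman xi k x; rewrite -(ler_pXn2r (_ : 0 < 2)%N) ?nnegrE ?normc_ge0//.
rewrite real_normK ?num_real// -/(D x) -/(u x).
rewrite !koopV -/(u _).
rewrite /r /f /truncation -/(u _) -/(u _).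
have -> : \1_(~` A) x = 1 - \1_A x :> R.
  by rewrite !indicE in_setC; case: (x \in A) => /=; ring.
have -> : \1_(~` A) (a k x) = 1 - \1_A (a k x) :> R.
  by rewrite !indicE in_setC; case: (_ \in A) => /=; ring.
have j0 : 0 <= u (a k x) * jac a k x by rewrite mulr_ge0 ?jac_ge0 ?normc_ge0.
have u0 : 0 <= u x by exact: normc_ge0.
have -> : u (a k x) * \1_A (a k x) * jac a k x = u (a k x) * jac a k x * \1_A (a k x).
  by rewrite mulrAC.
rewrite (_ : u (a k x) * (1 - \1_A (a k x)) * jac a k x =
  u (a k x) * jac a k x * (1 - \1_A (a k x))); last by rewrite mulrAC.
have tw : t * t^-1 = 1 by rewrite divff// gt_eqF.
move: (u (a k x) * jac a k x) j0 (u x) u0 => p p0 q q0 hD.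
move: (D x) hD t^-1 tV tw => D' hD w w0 tw.
(* Young inequality with parameter t. *)
have amgm (y z : R) : 2 * y * z <= t * y ^+ 2 + w * z ^+ 2.
  rewrite -subr_ge0 (_ : _ - _ = w * (t * y - z) ^+ 2).
    by rewrite mulr_ge0 ?sqr_ge0// ltW.
  transitivity (t * (t * w) * y ^+ 2 + w * z ^+ 2 - 2 * (t * w) * y * z).
    by rewrite tw; ring.
  by ring.
have h1 := amgm p q; have h2 := amgm q p.
have tp : 0 <= t * p ^+ 2 by rewrite mulr_ge0 ?sqr_ge0// ltW.
have tq : 0 <= t * q ^+ 2 by rewrite mulr_ge0 ?sqr_ge0// ltW.
have wp : 0 <= w * p ^+ 2 by rewrite mulr_ge0 ?sqr_ge0// ltW.
have wq : 0 <= w * q ^+ 2 by rewrite mulr_ge0 ?sqr_ge0// ltW.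
rewrite !indicE; case: (x \in A); case: (a k x \in A); rewrite /= ?subrr ?subr0 ?mulr1 ?mulr0; lra.
Qed.

End overlap.

(** * Induced approximate units *)

Lemma precompact_sub {T : topologicalType} (A : set T) : precompact A ->
  exists2 B, A `<=` B & compact B /\ closed B.
Proof.
rewrite precompactE => cA; exists (closure A); first exact: subset_closure.
by split=> //; exact: closed_closure.
Qed.

Lemma factors_neq0 {R : realType} (y z w : R) : y * z * w != 0 -> y != 0 /\ w != 0.
Proof. by rewrite !mulf_eq0 !negb_or => /andP[/andP[]]. Qed.

Section transfer.
Context {R : realType} {G H : topologicalGroupType} {d} {X : measurableType d}
  {mu : probability X R} {a : nonsingular_action G mu} {omega : G -> X -> H}.
Hypotheses (hG : lcsc G) (hH : lcsc H) (homega : cocycle a omega) (ha : amenable_pair a).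
Variables (F : set (set X)).
Hypotheses (FM : F `<=` measurable) (Fw : proper_wrt a omega F)
  (Fe : forall e : R, 0 < e -> exists2 A, F A & (mu (~` A) < e%:E)%E).
Local Notation mf f := (measurable_fun setT f).
Local Notation mean := (mean mu).
Local Notation L1 := (L1 mu).
Local Notation C := R[i].

Definition weight (A : set X) (f : X -> R) := [/\ mf f, forall x, 0 <= f x,
  L1 (fun x => f x ^+ 2), mean (fun x => f x ^+ 2) <= 1 & forall x, f x != 0 -> A x].

Lemma weight_truncation (xi : X -> C) A :
  (forall U : set C, open U -> measurable (xi @^-1` U)) -> L2norm mu xi = 1%E ->
  measurable A -> weight A (truncation xi A).
Proof.
move=> mxi xi1 mA.
have [Lu u1] : L1 (fun x => normc (xi x) ^+ 2) /\ mean (fun x => normc (xi x) ^+ 2) <= 1 ^+ 2.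
  by apply: L2norm_le; [exact: measurable_normc|rewrite xi1].
have mt : mf (truncation xi A).
  by apply: measurable_funM; [exact: measurable_normc|exact: measurable_indic].
have le x : truncation xi A x ^+ 2 <= normc (xi x) ^+ 2.
  rewrite /truncation indicE; case: (x \in A); rewrite /= ?mulr1// mulr0 expr0n /=.
  exact: sqr_ge0.
have Lt : L1 (fun x => truncation xi A x ^+ 2).
  apply: L1_le Lu; first exact: measurable_funX.
  by move=> x; rewrite ger0_norm ?sqr_ge0.
split=> //.
- by move=> x; rewrite mulr_ge0 ?normc_ge0// indicE.
- by move: u1; rewrite expr1n; apply: le_trans; exact: mean_le.
- move=> x; rewrite /truncation indicE; case: (boolP (x \in A)) => [/set_mem//|_].
  by rewrite mulr0 eqxx.
Qed.

(** Almost invariance makes the Koopman coefficient of the truncated vector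
    close to 1 on K. The compact set L(K, A, A) of properness depends on A, so
    the index n of [phi] is chosen last. *)
Lemma approximate_unit (phi : nat -> H -> C) (M : nat -> R) (K : set G) (e : R) :
  (forall n, continuous (phi n)) -> (forall n s, normc (phi n s) <= M n) ->
  cvg_to_1 phi -> compact K -> 0 < e < 1 ->
  exists A (f : X -> R) n, [/\ F A, weight A f &
    forall k, K k -> normc (induced a omega f (phi n) k - 1) <= 4 * e].
Proof.
move=> cphi bphi phi1 cK /andP[e0 e1].
have [xi xi2 xi0] := ha.
(* Almost invariance is needed under k^-1, since induced involves koop k^-1. *)
have cKV : compact [set k^-1%g | k in K].
  apply: continuous_compact => //; apply: continuous_subspaceT.
  exact: invg_continuous.
have [j hj] := cvg_to_0E xi0 cKV e0.
have [[mxi _] xi1] := xi2 j.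
have [Lu u1] : L1 (fun x => normc (xi j x) ^+ 2) /\ mean (fun x => normc (xi j x) ^+ 2) <= 1 ^+ 2.
  by apply: L2norm_le; [exact: measurable_normc|rewrite xi1].
have ee0 : 0 < e ^+ 2 by rewrite exprn_gt0.
have [dl dl0 hdl] := mean_small Lu ee0.
have [A FA Adl] := Fe dl0.
have mA := FM FA.
have mC : measurable (~` A) by exact: measurableC.
have [L0 pL0 hL0] := Fw.1 K cK A A FA FA.
have [L L0L [cL _]] := precompact_sub pL0.
have [n hn] := (cvg_to_1P phi).1 phi1 L cL e e0.
have small : mean (fun x => normc (xi j x) ^+ 2 * \1_(~` A) x) <= e ^+ 2.
  have : pr mu (~` A) < dl by rewrite -lte_fin; move: Adl; rewrite -(prE _ mC).
  move=> /(hdl _ mC)/ltW; apply: le_trans; rewrite le_eqVlt; apply/orP; left; apply/eqP.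
  by apply: eq_mean => x; rewrite ger0_norm// sqr_ge0.
have [mff f0 Lf f1 fA] := weight_truncation mxi xi1 mA.
exists A, (truncation (xi j) A), n; split=> // k Kk.
have hk : (L2norm mu (fun x => (xi j x - koopman a k^-1%g (xi j) x)%R) <= e%:E)%E.
  by apply/ltW/hj => //; exists k.
have lo := overlap_truncated mxi xi1 mA e0 small hk.
have hi := mean_koopf a mff Lf f1 k.
have pc : normc (induced a omega (truncation (xi j) A) (phi n) k -
    1 * (mean (fun x => koop a (truncation (xi j) A) k^-1%g x * truncation (xi j) A x))%:C%C) <= e.
  apply: (induced_close hH homega mff f0 Lf f1 (cphi n) (bphi n)) => //; first exact: ltW.
  have := hL0 k Kk; apply: filterS => x hx; rewrite koopV => /factors_neq0[Akx Ax].
  have {}Akx := fA _ Akx; have {}Ax := fA _ Ax.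
  by apply/ltW/hn => //; apply: L0L; exact: hx.
rewrite mul1r in pc.
rewrite -(subrK (mean (fun x => koop a (truncation (xi j) A) k^-1%g x * truncation (xi j) A x))%:C%C
  (induced _ _ _ _ _)) -addrA.
apply: (le_trans (le_normcD _ _)); rewrite normc_real_sub1//.
have : e ^+ 2 <= e by rewrite expr2 ler_piMr// ltW.
move: (mean _) lo hi pc => m lo hi; move: (normc _) => q; lra.
Qed.

(** Diagonal choice along a compact exhaustion of [G]. *)
Lemma transfer (phi : nat -> H -> C) (M : nat -> R) :
  (forall n, continuous (phi n)) -> (forall n s, normc (phi n s) <= M n) ->
  cvg_to_1 phi -> exists (A : nat -> set X) (f : nat -> X -> R) (N : nat -> nat),
    (forall m, F (A m) /\ weight (A m) (f m)) /\
    cvg_to_1 (fun m => induced a omega (f m) (phi (N m))).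
Proof.
move=> cphi bphi phi1.
have [K [Kc Kmono Kall]] := compact_exhaustion hG.
(* approximate_unit loses a factor 4. *)
pose e m : R := 5^-1 * m.+1%:R^-1.
have e01 m : 0 < e m < 1.
  have i0 : 0 < m.+1%:R^-1 :> R by rewrite invr_gt0 ltr0n.
  have i1 : m.+1%:R^-1 <= 1 :> R by rewrite invf_le1 ?ler1n ?ltr0n.
  by rewrite /e; move: (m.+1%:R^-1) i0 i1 => i i0 i1; apply/andP; split; lra.
have step m : exists q : set X * (X -> R) * nat, [/\ F q.1.1, weight q.1.1 q.1.2 &
    forall k, K m k -> normc (induced a omega q.1.2 (phi q.2) k - 1) <= 4 * e m].
  have [A [f [n h]]] := approximate_unit cphi bphi phi1 (Kc m).1 (e01 m).
  by exists (A, f, n).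
have [q hq] := choice step.
exists (fun m => (q m).1.1), (fun m => (q m).1.2), (fun m => (q m).2); split.
  by move=> m; have [? ? _] := hq m.
apply/cvg_to_1P => C cC r r0.
have [n0 Cn0] := Kall C cC.
have [n1 hn1] : exists n1, forall n, (n1 <= n)%N -> n.+1%:R^-1 < r.
  have [n1 _ h] : \forall n \near \oo, n.+1%:R^-1 < r by exact: near_infty_natSinv_lt (PosNum r0).
  by exists n1.
exists (maxn n0 n1) => n; rewrite geq_max => /andP[n0n n1n] k Ck.
have [_ _ h] := hq n; apply: (le_lt_trans (h k _)).
  by apply: (Kmono n0) => //; exact: Cn0.
apply: le_lt_trans (hn1 n n1n).
rewrite /e mulrA ler_piMl ?invr_ge0 ?ler0n//; lra.
Qed.

End transfer.

(** * Approximation properties *)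

Section bounded_functions.
Context {R : realType} {H : topologicalGroupType}.
Local Notation C := R[i].

Lemma bounded_vanishing (phi : H -> C) : continuous phi -> vanishes_at_infinity phi ->
  exists M : R, forall s, normc (phi s) <= M.
Proof.
move=> cphi v; have [K cK hK] := v 1 ltr01.
have cn : continuous (fun s => normc (phi s)).
  by move=> s; apply: continuous_comp; [exact: cphi|exact: normc_continuous].
have : compact [set normc (phi s) | s in K].
  by apply: continuous_compact => //; exact: continuous_subspaceT.
move=> /compact_bounded[M [_ hM]]; exists (Num.max 1 (M + 1)) => s.
rewrite le_max; have [Ks|nKs] := pselect (K s); last by rewrite (ltW (hK s nKs)).
apply/orP; right; apply: le_trans (ler_norm _) _.
by apply: (hM (M + 1)); [rewrite ltrDl|exists s].
Qed.

Lemma norm_leC (V : normedModType C) (v : V) (m : R) :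
  (`|v| <= m%:C%C) = (complex.Re `|v| <= m).
Proof.
have : 0 <= `|v| by [].
by rewrite !lecE /= => /andP[/eqP -> _]; rewrite eqxx.
Qed.

Variables (V : hilbertType R) (xi : H -> V).

Lemma sup_norm_ge0 : (0 <= sup_norm xi)%E.
Proof.
apply: (@le_trans _ _ (complex.Re `|xi 1%g|)%:E).
  have : 0 <= `|xi 1%g| by [].
  by rewrite lecE lee_fin => /andP[].
by apply: ereal_sup_ubound; exists 1%g.
Qed.

Hypothesis (fin : (sup_norm xi < +oo)%E).

Lemma sup_norm_fine : (fine (sup_norm xi))%:E = sup_norm xi.
Proof. by rewrite fineK// ge0_fin_numE// sup_norm_ge0. Qed.

Lemma norm_le_sup_norm s : `|xi s| <= (fine (sup_norm xi))%:C%C.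
Proof.
rewrite norm_leC -lee_fin sup_norm_fine.
by apply: ereal_sup_ubound; exists s.
Qed.

End bounded_functions.

Lemma bounded_hs_pair {R : realType} {H : topologicalGroupType} (phi : H -> R[i])
    (V : hilbertType R) (xi eta : H -> V) : hs_pair phi xi eta ->
  forall s, normc (phi s) <= fine (sup_norm xi) * fine (sup_norm eta).
Proof.
move=> [_ _ fx fe e] s.
rewrite -lecR -normCE -[s]mul1g -invg1 e rmorphM /=.
apply: (le_trans (inner_cs _ _)); apply: ler_pM => //; exact: norm_le_sup_norm.
Qed.

Section inherited.
Context {R : realType} {G H : topologicalGroupType} {d} {X : measurableType d}
  {mu : probability X R} {a : nonsingular_action G mu} {omega : G -> X -> H}.
Hypotheses (hG : lcsc G) (hH : lcsc H) (hX : standard_borel R X)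
  (homega : cocycle a omega).
Variables (F : set (set X)).
Hypotheses (FM : F `<=` measurable) (Fw : proper_wrt a omega F).
Variables (A : set X) (f : X -> R) (FA : F A) (Af : weight (mu := mu) A f).
Local Notation C := R[i].

(** The set K is compact and contains K(L, A, A): off it the integrand of
    [induced] involves only values of [phi] off L. *)
Lemma induced_support (phi : H -> C) (M : R) (L : set H) :
  continuous phi -> (forall s, normc (phi s) <= M) -> compact L ->
  exists2 K : set G, compact K /\ closed K & forall (e : R) g, 0 <= e -> ~ K g ->
    (forall s, ~ L s -> normc (phi s) <= e) -> normc (induced a omega f phi g) <= e.
Proof.
move=> cphi phiM cL.
have [K sK hK] := precompact_sub (Fw.2 L cL A A FA FA).
exists K => // e g e0 nKg small.
have [hH2 _ _] := hH.
have [mff f0 Lf f1 fA] := Af.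
pose E := [set x | [/\ A x, A (a g x) & L (omega g x)]].
have mE : measurable E.
  rewrite (_ : E = A `&` (a g @^-1` A `&` omega g @^-1` L)); last first.
    by apply/seteqP; split=> x /= => [[? ? ?]|[? [? ?]]].
  apply: measurableI; first exact: FM.
  apply: measurableI; first by apply: measurable_preact; exact: FM.
  have cLc : closed L := compact_closed hH2 cL.
  rewrite -(setCK L) preimage_setC; apply: measurableC.
  have := measurable_omega_open homega g (closed_openC cLc); exact.
have E0 : mu E = 0%E.
  apply/eqP; rewrite eq_le measure_ge0 andbT leNgt; apply/negP => h.
  by apply: nKg; apply: sK.
have := @induced_close _ _ _ _ _ _ _ _ hH homega _ mff f0 Lf f1 phi M cphi phiM 0 e g e0.
rewrite mul0r subr0; apply.
exists E; split=> // x; apply: contra_notP => nE /=.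
rewrite koopV => /factors_neq0[Akx Ax]; rewrite subr0; apply: small => Lx.
by apply: nE; split; [exact: fA|exact: fA|].
Qed.

Lemma induced_vanishes (phi : H -> C) (M : R) :
  continuous phi -> (forall s, normc (phi s) <= M) ->
  vanishes_at_infinity phi -> vanishes_at_infinity (induced a omega f phi).
Proof.
move=> cphi phiM v e e0; have e20 : 0 < e / 2 by rewrite divr_gt0.
have [L cL hL] := v _ e20.
have [K [cK _] hK] := induced_support cphi phiM cL.
exists K => // g nKg; apply: (@le_lt_trans _ _ (e / 2)); last by lra.
by apply: hK => //; [exact: ltW|move=> s /hL/ltW].
Qed.

Lemma induced_compactly_supported (phi : H -> C) (M : R) :
  continuous phi -> (forall s, normc (phi s) <= M) ->
  compactly_supported phi -> compactly_supported (induced a omega f phi).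
Proof.
move=> cphi phiM cs.
have [K [cK clK] hK] := induced_support cphi phiM cs.
apply: (subclosed_compact _ cK); first exact: closed_closure.
rewrite [X in _ `<=` X](closure_id K).1//; apply: closureS => g /= nz.
apply: contrapT => nKg; move/eqP: nz; apply.
apply: ComplexField.Normc.eq0_normc; apply/eqP; rewrite eq_le normc_ge0 andbT.
apply: hK => // s ns.
have -> : phi s = 0.
  by apply/eqP; apply: contra_notT ns => h; exact: subset_closure.
by rewrite /= expr0n addr0 sqrtr0.
Qed.

(** The supremum norms of the two families are bounded separately, so that the
    infimum defining the Herz-Schur norm can be compared pair by pair. *)
Lemma induced_hs_pair (phi : H -> C) (V : hilbertType R) (xi eta : H -> V) :
  continuous phi -> hs_pair phi xi eta ->
  exists (W : hilbertType R) (xi' eta' : G -> W),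
    [/\ hs_pair (induced a omega f phi) xi' eta', (sup_norm xi' <= sup_norm xi)%E &
        (sup_norm eta' <= sup_norm eta)%E].
Proof.
move=> cphi hp; have phiM := bounded_hs_pair hp.
have [cx ce fx fe e] := hp.
have [mff f0 Lf f1 _] := Af.
pose zeta b := if b then xi else eta.
have fz b : (sup_norm (zeta b) < +oo)%E by case: b.
have cz b : continuous (zeta b) by case: b.
have [W [v [iv cv nv]]] := multiplier_vectors hG hH hX homega mff f0 Lf f1 cz
  (fun b => norm_le_sup_norm (fz b)).
have sv b : (sup_norm (v b) <= sup_norm (zeta b))%E.
  apply: ge_ereal_sup => _ [g _ <-].
  by rewrite -(sup_norm_fine (fz b)) lee_fin -norm_leC.
exists W, (v true), (v false); split; [|exact: sv|exact: sv].
split; [exact: cv|exact: cv| | |].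
- exact: le_lt_trans (sv true) (fz true).
- exact: le_lt_trans (sv false) (fz false).
move=> g h; rewrite iv -(induced_kernelE hH homega mff f0 Lf g h cphi phiM) /=.
by congr (induced_kernel _ _ _ _ g h); apply/funext => z; rewrite /= e.
Qed.

Lemma induced_herz_schur (phi : H -> C) : herz_schur phi ->
  herz_schur (induced a omega f phi) /\ (hs_norm (induced a omega f phi) <= hs_norm phi)%E.
Proof.
move=> [cphi [V [xi [eta hp]]]].
have [mff f0 Lf f1 _] := Af.
split.
  split; first exact: (induced_continuous hG hH hX homega mff f0 Lf f1 cphi (bounded_hs_pair hp)).
  by have [W [x [y [? _ _]]]] := induced_hs_pair cphi hp; exists W, x, y.
apply: le_ereal_inf_tmp => _ [V' [xi' [eta' [hp' ->]]]].
have [W [x [y [hw sx sy]]]] := induced_hs_pair cphi hp'.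
apply: (@le_trans _ _ (sup_norm x * sup_norm y)%E).
  by apply: ereal_inf_lbound; exists W, x, y.
by apply: lee_pmul => //; exact: sup_norm_ge0.
Qed.

End inherited.
Section main.
Context {R : realType} {G H : topologicalGroupType} {d} {X : measurableType d}
  {mu : probability X R} {a : nonsingular_action G mu} {omega : G -> X -> H}.
Hypotheses (hG : lcsc G) (hH : lcsc H) (hX : standard_borel R X)
  (ha : amenable_pair a) (homega : cocycle a omega) (hp : proper_cocycle a omega).

Lemma haagerup_transfer : haagerup R H -> haagerup R G.
Proof.
have [F [FM Fw Fe]] := hp.
move=> [phi hphi phi1].
have cphi n : continuous (phi n) by have [] := hphi n.
have bphi n : exists M : R, forall s, normc (phi n s) <= M.
  by have [_ _ v] := hphi n; exact: bounded_vanishing.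
have [M hM] := choice bphi.
have [A [f [N [hf h1]]]] := transfer hG hH homega ha FM Fw Fe cphi hM phi1.
exists (fun m => induced a omega (f m) (phi (N m))) => // m.
have [FA wf] := hf m; have [mff f0 Lf f1 _] := wf; have [_ pos v] := hphi (N m).
split.
- exact: (induced_continuous hG hH hX homega mff f0 Lf f1 (cphi _) (hM _)).
- exact: (induced_positive hH homega mff f0 Lf (cphi _) (hM _) pos).
- exact: (induced_vanishes hH homega FM Fw FA wf (cphi _) (hM _) v).
Qed.

(** Weak amenability and the weak Haagerup property differ only in the decay
    condition, and both conditions are inherited by each induced multiplier. *)
Lemma herz_schur_transfer (phi : nat -> H -> R[i]) (c : \bar R) :
  (forall n, herz_schur (phi n) /\ (hs_norm (phi n) <= c)%E) -> cvg_to_1 phi ->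
  exists (induced : nat -> G -> R[i]) (N : nat -> nat),
    [/\ forall m, herz_schur (induced m) /\ (hs_norm (induced m) <= c)%E, cvg_to_1 induced,
      forall m, compactly_supported (phi (N m)) -> compactly_supported (induced m) &
      forall m, vanishes_at_infinity (phi (N m)) -> vanishes_at_infinity (induced m)].
Proof.
have [F [FM Fw Fe]] := hp.
move=> hphi phi1.
have cphi n : continuous (phi n) by have [[]] := hphi n.
have bphi n : exists M : R, forall s, normc (phi n s) <= M.
  have [[_ [V [xi [eta h]]]] _] := hphi n.
  by exists (fine (sup_norm xi) * fine (sup_norm eta)); exact: bounded_hs_pair.
have [M hM] := choice bphi.
have [A [f [N [hf h1]]]] := transfer hG hH homega ha FM Fw Fe cphi hM phi1.
exists (fun m => induced a omega (f m) (phi (N m))), N; split=> // m.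
- have [FA wf] := hf m; have [hs hc] := hphi (N m).
  have [hs' hc'] := induced_herz_schur hG hH hX homega wf hs.
  by split=> //; exact: le_trans hc.
- have [FA wf] := hf m.
  exact: (induced_compactly_supported hH homega FM Fw FA wf (cphi _) (hM _)).
- have [FA wf] := hf m.
  exact: (induced_vanishes hH homega FM Fw FA wf (cphi _) (hM _)).
Qed.

Lemma wa_constants_transfer : @wa_constants R H `<=` @wa_constants R G.
Proof.
move=> c [c1 [phi hphi phi1]]; split=> //.
have h n : herz_schur (phi n) /\ (hs_norm (phi n) <= c%:E)%E by have [] := hphi n.
have [induced [N [hinduced induced1 cs _]]] := herz_schur_transfer h phi1.
exists induced => // m; have [? ?] := hinduced m; split=> //.
by apply: cs; have [] := hphi (N m).
Qed.

Lemma wh_constants_transfer : @wh_constants R H `<=` @wh_constants R G.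
Proof.
move=> c [c1 [phi hphi phi1]]; split=> //.
have h n : herz_schur (phi n) /\ (hs_norm (phi n) <= c%:E)%E by have [] := hphi n.
have [induced [N [hinduced induced1 _ v]]] := herz_schur_transfer h phi1.
exists induced => // m; have [? ?] := hinduced m; split=> //.
by apply: v; have [] := hphi (N m).
Qed.

End main.

Local Open Scope ereal_scope.

Theorem theorem0p6 (R : realType) (G H : topologicalGroupType)
    (hG : lcsc G) (hH : lcsc H)
    (d : measure_display) (X : measurableType d) (hX : standard_borel R X)
    (mu : probability X R) (a : nonsingular_action G mu)
    (ha : amenable_pair a)
    (omega : G -> X -> H) (homega : cocycle a omega)
    (hproper : proper_cocycle a omega) :
  (haagerup R H -> haagerup R G) /\
  (weakly_amenable R H -> weakly_amenable R G) /\
  (weak_haagerup R H -> weak_haagerup R G) /\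
  Lambda_WA R G <= Lambda_WA R H /\
  Lambda_WH R G <= Lambda_WH R H.
Proof.
have wa := wa_constants_transfer hG hH hX ha homega hproper.
have wh := wh_constants_transfer hG hH hX ha homega hproper.
split; first exact: haagerup_transfer hG hH hX ha homega hproper.
split; first by move=> [c hc]; exists c; exact: wa.
split; first by move=> [c hc]; exists c; exact: wh.
by split; apply: ereal_inf_le_tmp => _ [c hc <-]; exists c => //; [exact: wa|exact: wh].
Qed.
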